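(* Assume (A1)–(A5) and let $L_\gamma=L_\gamma(\zeta)=\dfrac{L_\xi}{2(1-\zeta)}$ with a parameter $\zeta\in[0,1)$. Then the MoLDD algorithm defines a contraction: at each time step $n\geq 1$, for all $k\ge1$, $$\|\delta^k_{\lambda,h}\|_\gamma^2+\tau\|\delta^k_{\lambda,h}\|_{s,\gamma}^2+\left(\frac{L_\gamma}{2}+c_{\mathbf K,\gamma}\right)\tau\|\delta^k_{\mathbf u,h}\|_\gamma^2\le\left(\frac{L_\gamma}{2}-\zeta\xi_m\right)\tau\|\delta^{k-1}_{\mathbf u,h}\|_\gamma^2,$$ where $\delta^k_{\mathbf u,h}=\mathbf u^{n,k}_{h,\gamma}-\mathbf u^{n,k-1}_{h,\gamma}$ and $\delta^k_{\lambda,h}=\lambda^{n,k}_{h,\gamma}-\lambda^{n,k-1}_{h,\gamma}$, and the limit of the iterates is the unique solution $(\mathbf u^n_{h,\gamma},\lambda^n_{h,\gamma})$ of the reduced scheme.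
   Context: Geometry: $\Omega\subset\mathbb R^d$, $d\in\{2,3\}$, is a bounded domain with Lipschitz boundary; $\gamma\subset\Omega$ is a $(d-1)$-dimensional non self-intersecting surface of class $C^2$ (the fracture) dividing $\Omega$ into two subdomains, $\Omega=\Omega_1\cup\Omega_2\cup\gamma$, $\gamma=\partial\Omega_1\cap\partial\Omega_2$, $\Gamma_i=\partial\Omega_i\cap\partial\Omega$; $\mathbf n_i$ is the outward unit normal to $\partial\Omega_i$; $\nabla_\tau$, $\nabla_\tau\cdot$ are the tangential gradient and divergence on $\gamma$. $(\cdot,\cdot)_D$, $\|\cdot\|_D$ are the $L^2(D)$ scalar product and norm. $T>0$ is the final time. Continuous problem: $\mathbf K_i^{-1}\mathbf u_i+\nabla p_i=0$, $\partial_tp_i+\nabla\cdot\mathbf u_i=f_i$ in $(0,T)\times\Omega_i$, $p_i=0$ on $\Gamma_i$, $p_i(\cdot,0)=p_i^0$; $\xi(\mathbf u_\gamma)+\mathbf K_\gamma^{-1}\mathbf u_\gamma+\nabla_\tau p_\gamma=0$, $\partial_tp_\gamma+\nabla_\tau\cdot\mathbf u_\gamma=f_\gamma+\mathbf u_1\cdot\mathbf n_1+\mathbf u_2\cdot\mathbf n_2$ in $(0,T)\times\gamma$, $p_\gamma=0$ on $\partial\gamma$, $p_\gamma(\cdot,0)=p^0_\gamma$; $-\mathbf u_i\cdot\mathbf n_i+\alpha_\gamma p_i=\alpha_\gamma p_\gamma$ on $(0,T)\times\gamma$. Assumptions. (A1) $\xi:\mathbb R\to\mathbb R$ is $C^1$,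 strictly increasing and Lipschitz: there are $\xi_m>0$ and $L_\xi$ with $\xi_m\le\xi'\le L_\xi<\infty$; otherwise, if $\xi$ is only increasing ($\xi'\ge0$), the flux of the continuous problem is assumed bounded, $\mathbf u\in[L^\infty(\Omega)]^d$, and $L_\xi:=\sup_{|\mathbf u|\le C_\xi}\xi'(\mathbf u)$ with $C_\xi:=\sup_{\mathbf x\in\overline\Omega}|\mathbf u(\mathbf x)|$ (and $\xi_m=0$). (A2) $\mathbf K$ ($\mathbf K|_{\Omega_i}=\mathbf K_i$) is constant in time, $\zeta^T\mathbf K^{-1}\zeta\ge c_{\mathbf K}|\zeta|^2$, $|\mathbf K^{-1}\zeta|\le C_{\mathbf K}|\zeta|$ a.e., $c_{\mathbf K}>0$. (A3) $\mathbf K_\gamma$ is constant in time, $\zeta^T\mathbf K_\gamma^{-1}\zeta\ge c_{\mathbf K,\gamma}|\zeta|^2$, $|\mathbf K_\gamma^{-1}\zeta|\le C_{\mathbf K,\gamma}|\zeta|$ a.e. on $\gamma$, $c_{\mathbf K,\gamma}>0$. (A4) $\alpha_\gamma>0$ is a constant. (A5) $p_i^0\in L^2(\Omega_i)$, $p_\gamma^0\in L^2(\gamma)$, $f_i\in L^2(0,T;L^2(\Omega_i))$, $f_\gamma\in L^2(0,T;L^2(\gamma))$, and $f,f_\gamma$ are piecewise constant in time on the temporal mesh, with values $f^n,f_\gamma^n$. $\xi(\mathbf u_\gamma)$ denotes $\xi$ applied to the tangential velocity (componentwise if $d=3$). Discretization: $\mathcal T_{h,i}$ is a partition of $\Omega_i$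 into simplices or rectangular elements such that $\mathcal T_h=\mathcal T_{h,1}\cup\mathcal T_{h,2}$ is a conforming mesh of $\Omega$; $\mathcal T_{h,\gamma}$ is a partition of $\gamma$ induced by $\mathcal T_h$ or slightly coarser; $h$ is the maximal mesh size. $M_{h,i}$, $M_{h,\gamma}$ are piecewise constants on $\mathcal T_{h,i}$, $\mathcal T_{h,\gamma}$; $\mathbf V_{h,i}$, $\mathbf V_{h,\gamma}\subset\mathbf H(\mathrm{div}_\tau,\gamma)$ are the lowest-order Raviart–Thomas–Nédélec spaces. With $\mathcal Q_{h,i}$ the $L^2$-projection onto $\mathbf V_{h,i}\cdot\mathbf n_i$, $\|\lambda\|_\gamma\lesssim\|\mathcal Q_{h,1}\lambda\|_\gamma+\|\mathcal Q_{h,2}\lambda\|_\gamma$ for all $\lambda\in M_{h,\gamma}$. The time step (possibly depending on $n$) is denoted $\tau>0$. Forms: $a_i(\mathbf u,\mathbf v)=(\mathbf K^{-1}\mathbf u,\mathbf v)_{\Omega_i}+\alpha_\gamma^{-1}(\mathbf u\cdot\mathbf n_i,\mathbf v\cdot\mathbf n_i)_\gamma$, $b_i(\mathbf u,q)=(\nabla\cdot\mathbf u,q)_{\Omega_i}$, $c_i(p,q)=(p,q)_{\Omega_i}$, $a_\gamma(\mathbf u,\mathbf v)=(\mathbf K_\gamma^{-1}\mathbf u,\mathbf v)_\gamma$, $b_\gamma(\mathbf u,\mu)=(\nabla_\tau\cdot\mathbf u,\mu)_\gamma$, $c_\gamma(\lambda,\mu)=(\lambda,\mu)_\gamma$. Interface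 operators: for $\lambda\in M_{h,\gamma}$, $(\mathbf u^*_{h,i}(\lambda),p^*_{h,i}(\lambda))\in\mathbf V_{h,i}\times M_{h,i}$ solves $a_i(\mathbf u^*_{h,i},\mathbf v)-b_i(\mathbf v,p^*_{h,i})=-(\lambda,\mathbf v\cdot\mathbf n_i)_\gamma$, $c_i(p^*_{h,i},q)+\tau b_i(\mathbf u^*_{h,i},q)=0$ for all $(\mathbf v,q)\in\mathbf V_{h,i}\times M_{h,i}$; $s_\gamma(\lambda,\mu)=-\sum_{i=1}^2(\mathbf u^*_{h,i}(\lambda)\cdot\mathbf n_i,\mu)_\gamma$ and $\|\mu\|_{s,\gamma}=s_\gamma(\mu,\mu)^{1/2}$. Further $(\bar{\mathbf u}^n_{h,i},\bar p^n_{h,i})\in\mathbf V_{h,i}\times M_{h,i}$ solves $a_i(\bar{\mathbf u}^n_{h,i},\mathbf v)-b_i(\mathbf v,\bar p^n_{h,i})=0$, $c_i(\bar p^n_{h,i}-p^{n-1}_{h,i},q)+\tau b_i(\bar{\mathbf u}^n_{h,i},q)=\tau(f^n,q)_{\Omega_i}$, where $p^{n}_{h,i}=p^*_{h,i}(\lambda^{n}_{h,\gamma})+\bar p^{n}_{h,i}$ for $n\ge1$ and $p^0_{h,i}$ is the given initial approximation; $(g^n_\gamma,\mu)_\gamma=\sum_{i=1}^2(\bar{\mathbf u}^n_{h,i}\cdot\mathbf n_i,\mu)_\gamma$. Reduced scheme: for $n\ge1$ and given $\lambda^{n-1}_{h,\gamma}\in M_{h,\gamma}$, find $(\mathbf u^n_{h,\gamma},\lambda^n_{h,\gamma})\in\mathbf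 V_{h,\gamma}\times M_{h,\gamma}$ such that for all $(\mathbf v,\mu)\in\mathbf V_{h,\gamma}\times M_{h,\gamma}$: $(\xi(\mathbf u^n_{h,\gamma}),\mathbf v)_\gamma+a_\gamma(\mathbf u^n_{h,\gamma},\mathbf v)-b_\gamma(\mathbf v,\lambda^n_{h,\gamma})=0$ and $c_\gamma(\lambda^n_{h,\gamma}-\lambda^{n-1}_{h,\gamma},\mu)+\tau b_\gamma(\mathbf u^n_{h,\gamma},\mu)+\tau s_\gamma(\lambda^n_{h,\gamma},\mu)=\tau(f^n_\gamma+g^n_\gamma,\mu)_\gamma$. MoLDD algorithm (at time step $n$, stabilization $L_\gamma>0$): choose $\mathbf u^{n,-1}_{h,\gamma}\in\mathbf V_{h,\gamma}$; for $k=0,1,2,\dots$ find $(\mathbf u^{n,k}_{h,\gamma},\lambda^{n,k}_{h,\gamma})\in\mathbf V_{h,\gamma}\times M_{h,\gamma}$ such that for all $(\mathbf v,\mu)$: $(\xi(\mathbf u^{n,k-1}_{h,\gamma})+L_\gamma(\mathbf u^{n,k}_{h,\gamma}-\mathbf u^{n,k-1}_{h,\gamma}),\mathbf v)_\gamma+a_\gamma(\mathbf u^{n,k}_{h,\gamma},\mathbf v)-b_\gamma(\mathbf v,\lambda^{n,k}_{h,\gamma})=0$ and $c_\gamma(\lambda^{n,k}_{h,\gamma}-\lambda^{n-1}_{h,\gamma},\mu)+\tau b_\gamma(\mathbf u^{n,k}_{h,\gamma},\mu)+\tau s_\gamma(\lambda^{n,k}_{h,\gamma},\mu)=\tau(f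^n_\gamma+g^n_\gamma,\mu)_\gamma$.
   Formalization: In the second case of (A1), where ξ is only increasing, the iterates are additionally assumed to satisfy |u^{n,k}_{h,γ}| ≤ C_ξ on γ for all k ≥ -1, since the claim fails otherwise (zero data, ξ(s) = s + s³, large starting value). *)

(* Defs.v *)
From HB Require Import structures.
From mathcomp Require Import all_boot all_order all_algebra.
From mathcomp Require Import all_classical all_reals all_analysis.

Set Implicit Arguments.
Unset Strict Implicit.
Unset Printing Implicit Defensive.
Import Order.TTheory GRing.Theory Num.Theory numFieldNormedType.Exports.
Local Open Scope classical_set_scope.
Local Open Scope ring_scope.

Section euclidean.
Context {R : realType}.

Definition dot {d : nat} (x y : 'cV[R]_d) : R := \sum_i x i 0 * y i 0.

(* The library norm of a matrix is the max norm. *)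
Definition enorm {d : nat} (x : 'cV[R]_d) : R := Num.sqrt (dot x x).

(* Volume of the unit ball of R^k. *)
Fixpoint ball_volume (k : nat) : R :=
  match k with
  | 0%N => 1
  | 1%N => 2
  | (j.+1 as j1).+1 => 2 * pi / j1.+1%:R * ball_volume j
  end.

End euclidean.

Section hausdorff.
Context {R : realType} {d : nat} (k : nat).
Local Notation X := 'cV[R]_d.
Local Open Scope ereal_scope.

(* ball_volume k * (diam U / 2) ^ k, with value 0 on the empty set. *)
Definition hausdorff_gauge (U : set X) : \bar R :=
  ereal_sup (0 |` [set e | exists x y, [/\ U x, U y &
    e = (ball_volume k * (enorm (x - y) / 2) ^+ k)%:E]]).

Definition fine_cover (delta : R) (A : set X) : set ((set X)^nat) :=
  [set U | A `<=` \bigcup_j U j /\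
    forall j x y, U j x -> U j y -> (enorm (x - y) <= delta)%R].

Definition hausdorff_pre (delta : R) (A : set X) : \bar R :=
  ereal_inf [set \sum_(j <oo) hausdorff_gauge (U j) | U in fine_cover delta A].

(* The k-dimensional Hausdorff outer measure of R^d, normalised so that k = d is
   the Lebesgue measure and k = d - 1 is the surface measure. *)
Definition hausdorff (A : set X) : \bar R :=
  ereal_sup [set hausdorff_pre delta A | delta in [set r : R | (0 < r)%R]].

Lemma hausdorff_gauge_ge0 U : 0 <= hausdorff_gauge U.
Proof. by apply: ereal_sup_ubound; left. Qed.

Lemma hausdorff_gauge0 : hausdorff_gauge set0 = 0.
Proof.
apply/eqP; rewrite eq_le hausdorff_gauge_ge0 andbT.
by apply: ge_ereal_sup => e [->//|[x [y []]]].
Qed.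

Lemma hausdorff_pre_ge0 delta A : 0 <= hausdorff_pre delta A.
Proof.
apply: le_ereal_inf_tmp => _ [U _ <-].
by apply: nneseries_ge0 => j _ _; exact: hausdorff_gauge_ge0.
Qed.

Lemma hausdorff_pre_sigma_subadditive delta :
  sigma_subadditive (hausdorff_pre delta).
Proof.
move=> A; have [[i ioo]|] := pselect (exists i, hausdorff_pre delta (A i) = +oo).
  rewrite (eseries_pinfty _ _ ioo) ?leey// => n _.
  by rewrite -ltNye (lt_le_trans _ (hausdorff_pre_ge0 _ _)).
rewrite -forallNE => Aoo.
apply/lee_addgt0Pr => e e0.
rewrite (le_trans _ (epsilon_trick _ _ (ltW e0)))//; last first.
  by move=> n; exact: hausdorff_pre_ge0.
pose P n (B : (set X)^nat) := fine_cover delta (A n) B /\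
  \sum_(j <oo) hausdorff_gauge (B j) <=
    hausdorff_pre delta (A n) + (e / (2 ^ n.+1)%:R)%:E.
have [G PG] : {G : ((set X)^nat)^nat & forall n, P n (G n)}.
  apply: (@choice _ _ P) => n; rewrite /P /hausdorff_pre.
  set S := (Y in ereal_inf Y); move infS : (ereal_inf S) => iS.
  case: iS infS => [r Sr|Soo|Soo].
  - have en1 : (0 < e / (2 ^ n.+1)%:R)%R by rewrite divr_gt0// ltr0n expn_gt0.
    have /(lb_ereal_inf_adherent en1) : ereal_inf S \is a fin_num by rewrite Sr.
    move=> [x [B cB muBx] xS].
    by exists B; split => //; rewrite muBx -Sr; exact/ltW.
  - by have := Aoo n; rewrite /hausdorff_pre -/S Soo.
  - have := hausdorff_pre_ge0 delta (A n).
    by rewrite /hausdorff_pre -/S Soo.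
pose g := hausdorff_gauge \o uncurry G.
have g_ge0 x : 0 <= g x by exact: hausdorff_gauge_ge0.
apply: (@le_trans _ _ (\esum_(i in setT) g i)).
  rewrite /hausdorff_pre; apply: ereal_inf_lbound => /=.
  have /card_esym/ppcard_eqP[f] := card_nat2.
  exists (uncurry G \o f).
    split => [t [n _ Ant]|j x y /=].
      have [j _ Gt] := (PG n).1.1 _ Ant.
      by exists (f^-1%FUN (n, j)) => //=; rewrite invK ?inE.
    by case: (f j) => n l; exact: (PG n).1.2.
  by rewrite -(esum_pred_image g _ xpredT) ?[fun=> _]set_true// image_eq.
rewrite (_ : esum _ _ = \sum_(i <oo) \sum_(j <oo) hausdorff_gauge (G i j));
    last first.
  pose J : nat -> set (nat * nat) := fun i => [set (i, j) | j in setT].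
  rewrite (_ : setT = \bigcup_l J l); last first.
    by rewrite predeqE => -[a b]; split => // _; exists a => //; exists b.
  rewrite esum_bigcupT /=; last 2 first.
    - apply/trivIsetP => i j _ _ ij.
      rewrite predeqE => -[n m] /=; split => //= -[] [_] _ [<-{n} _].
      by move=> [m' _] [] /esym/eqP; rewrite (negbTE ij).
    - by move=> /= nm; exact: g_ge0.
  rewrite -(image_id [set: nat]) -fun_true esum_pred_image//; last first.
    by move=> n _; exact: esum_ge0.
  apply: eq_eseriesr => /= j _.
  rewrite -(esum_pred_image g (pair j) predT)//=; last first.
    by move=> ? ? _ _; exact: (@can_inj _ _ _ snd).
  by congr esum; rewrite predeqE => -[a b]; split; move=> [i _ <-]; exists i.
apply: lee_nneseries => n *; last exact: (PG n).2.
by apply: nneseries_ge0 => j *; exact: hausdorff_gauge_ge0.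
Qed.

Lemma le_hausdorff_pre delta A B :
  A `<=` B -> hausdorff_pre delta A <= hausdorff_pre delta B.
Proof.
move=> AB; apply: ereal_inf_le_tmp => _ [U [BU dU] <-].
by exists U => //; split => //; exact: subset_trans BU.
Qed.

Lemma hausdorff0 : hausdorff set0 = 0.
Proof.
apply/eqP; rewrite eq_le; apply/andP; split; last first.
  apply: (le_trans (hausdorff_pre_ge0 1 set0)).
  by apply: ereal_sup_ubound; exists 1%R => //=.
apply: ge_ereal_sup => _ [delta _ <-].
apply: ereal_inf_lbound; exists (fun=> set0); first by split.
by rewrite eseries0// => i _ _; exact: hausdorff_gauge0.
Qed.

Lemma hausdorff_ge0 A : 0 <= hausdorff A.
Proof.
apply: (le_trans (hausdorff_pre_ge0 1 A)).
by apply: ereal_sup_ubound; exists 1%R => //=.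
Qed.

Lemma le_hausdorff : {homo hausdorff : A B / A `<=` B >-> A <= B}.
Proof.
move=> A B AB; apply: ge_ereal_sup => _ [delta d0 <-].
apply: (le_trans (le_hausdorff_pre delta AB)).
by apply: ereal_sup_ubound; exists delta.
Qed.

Lemma hausdorff_sigma_subadditive : sigma_subadditive hausdorff.
Proof.
move=> A; apply: ge_ereal_sup => _ [delta d0 <-].
apply: (le_trans (hausdorff_pre_sigma_subadditive delta A)).
apply: lee_nneseries => n *; first exact: hausdorff_pre_ge0.
by apply: ereal_sup_ubound; exists delta.
Qed.

HB.instance Definition _ := isOuterMeasure.Build R X hausdorff
  hausdorff0 hausdorff_ge0 le_hausdorff hausdorff_sigma_subadditive.

End hausdorff.

Section hausdorff_measure.
Context {R : realType} {d : nat}.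

Definition hausdorff_outer (k : nat) : {outer_measure set 'cV[R]_d -> \bar R} :=
  @hausdorff R d k.

Definition hmeasure (k : nat) :
    {measure set (caratheodory_type (hausdorff_outer k)) -> \bar R} :=
  hausdorff_outer k.

End hausdorff_measure.

Section function_spaces.
Context {R : realType} {d : nat}.
Local Notation X := 'cV[R]_d.

(* Scalar products of L^2(D), for D a k-dimensional subset of R^d. *)
Definition ip (k : nat) (D : set X) (f g : X -> R) : R :=
  \int[hmeasure k]_(x in D) (f x * g x).
Definition vip (k : nat) (D : set X) (u v : X -> X) : R :=
  \int[hmeasure k]_(x in D) dot (u x) (v x).
Definition l2norm (k : nat) (D : set X) (f : X -> R) : R := Num.sqrt (ip k D f f).
Definition vl2norm (k : nat) (D : set X) (u : X -> X) : R :=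
  Num.sqrt (vip k D u u).

Definition measurable_on (k : nat) (D : set X) (f : X -> R) : Prop :=
  measurable_fun (D : set (caratheodory_type (hausdorff_outer k))) f.

Definition L2 (k : nat) (D : set X) (f : X -> R) : Prop :=
  measurable_on k D f /\
  (\int[hmeasure k]_(x in D) ((f x ^+ 2)%:E) < +oo)%E.
Definition vL2 (k : nat) (D : set X) (u : X -> X) : Prop :=
  forall j, L2 k D (fun x => u x j 0).

Definition e_ (j : 'I_d) : X := delta_mx j 0.

Definition grad (f : X -> R) (x : X) : X := \col_j 'D_(e_ j) f x.

Definition divergence (v : X -> X) (x : X) : R := \sum_j 'D_(e_ j) (fun y => v y j 0) x.

Definition C1_on (U : set X) (f : X -> R) : Prop :=
  forall x, U x -> forall j,
    derivable f x (e_ j) /\ {for x, continuous (fun y => 'D_(e_ j) f y)}.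

Definition C2_on (U : set X) (f : X -> R) : Prop :=
  C1_on U f /\ forall j, C1_on U (fun y => 'D_(e_ j) f y).

(* C^1 functions with compact support in U. *)
Definition test_fun (U : set X) (phi : X -> R) : Prop :=
  [/\ C1_on setT phi, compact (closure [set x | phi x != 0]) &
      closure [set x | phi x != 0] `<=` U].

(* v has weak divergence g on the k-dimensional set D, relatively closed in U.
   For a hypersurface D and a tangential v, dot v (grad phi) only involves the
   tangential gradient of phi, and g is the tangential divergence. *)
Definition weak_div (U : set X) (k : nat) (D : set X) (v : X -> X) (g : X -> R) :=
  forall phi, test_fun U phi ->
    \int[hmeasure k]_(x in D) (dot (v x) (grad phi x) + g x * phi x) = 0.

Definition bdry (A : set X) : set X := closure A `\` interior A.

(* Tangent vectors (contingent cone) to A at x; for a C^1 submanifold this is the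
   tangent space. *)
Definition tangent (A : set X) (x w : X) : Prop :=
  forall eps : R, 0 < eps -> exists s y,
    [/\ 0 < s < eps, A y & enorm (y - x - s *: w) <= eps * s].

End function_spaces.

Section geometry.
Context {R : realType} {m : nat}.
Local Notation X := 'cV[R]_m.+1.

(* Near each boundary point, and in suitable orthonormal coordinates z, the set A
   is the strict epigraph of a Lipschitz function of the last m coordinates. *)
Definition lipschitz_boundary (A : set X) : Prop :=
  forall x, bdry A x ->
  exists (Q : 'M[R]_m.+1) (g : 'cV[R]_m -> R) (L r : R),
  [/\ Q^T *m Q = 1%:M, 0 < r,
      forall a b, `|g a - g b| <= L * enorm (a - b) &
      forall z : X, enorm z < r ->
        (A (x + Q *m z) <-> g (row' ord0 z) < z ord0 0)].

Definition C2_hypersurface (S : set X) : Prop :=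
  forall x, S x -> exists (U : set X) (g : X -> R),
  [/\ open U, U x, C2_on U g, forall y, U y -> grad g y != 0 &
      S `&` U = U `&` [set y | g y = 0]].

(* Omega = domain, Omega_i = subdom i, gamma = fracture; nrm i is the outward unit normal of
   Omega_i along gamma.  The columns of frame x are an orthonormal basis of the
   tangent space of gamma at x: it serves to express tangential vectors by their
   m components. *)
Record geometry := Geometry {
  domain : set X;
  subdom : 'I_2 -> set X;
  fracture : set X;
  nrm : 'I_2 -> X -> X;
  frame : X -> 'M[R]_(m.+1, m) }.

Definition geometry_ok (G : geometry) : Prop :=
  [/\ [/\ open (domain G), connected (domain G), bounded_set (domain G) &
          lipschitz_boundary (domain G)],
      [/\ forall i, [/\ open (subdom G i), connected (subdom G i) & subdom G i !=set0],
          domain G = subdom G ord0 `|` subdom G ord_max `|` fracture G,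
          subdom G ord0 `&` subdom G ord_max = set0 &
          fracture G = bdry (subdom G ord0) `&` bdry (subdom G ord_max) `&` domain G],
      C2_hypersurface (fracture G),
      (forall i,
         {within fracture G, continuous (nrm G i)} /\
         forall x, fracture G x ->
           [/\ enorm (nrm G i x) = 1,
               forall w, tangent (fracture G) x w -> dot (nrm G i x) w = 0 &
               exists2 eps : R, 0 < eps & forall s : R, 0 < s < eps ->
                 subdom G i (x - s *: nrm G i x) /\ ~ subdom G i (x + s *: nrm G i x)]) &
      (forall j l, measurable_on m (fracture G) (fun x => frame G x j l)) /\
      forall x, fracture G x ->
        (frame G x)^T *m frame G x = 1%:M /\
        forall w, tangent (fracture G) x w ->
          frame G x *m ((frame G x)^T *m w) = w].

End geometry.
Arguments geometry : clear implicits.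

Section mesh.
Context {R : realType} {m : nat}.
Local Notation X := 'cV[R]_m.+1.

(* The image of the reference simplex or of the reference cube of R^k under
   t |-> org + edg t. *)
Record cell (k : nat) := Cell {
  simplex : bool;
  org : X;
  edg : 'M[R]_(m.+1, k) }.

Definition cell_set k (c : cell k) : set X :=
  [set x | exists t : 'cV[R]_k,
    [/\ x = org c + edg c *m t, forall j, 0 <= t j 0 &
        if simplex c then (\sum_j t j 0 <= 1 : Prop) else forall j, t j 0 <= 1]].

(* Non-degenerate simplices, and rectangles (boxes with orthogonal edges). *)
Definition cell_ok k (c : cell k) : Prop :=
  \rank (edg c) = k /\ (~~ simplex c -> is_diag_mx ((edg c)^T *m edg c)).

(* The reference coordinates t of the orthogonal projection of x onto the affine
   span of the cell. *)
Definition loc k (c : cell k) (x : X) : 'cV[R]_k :=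
  invmx ((edg c)^T *m edg c) *m ((edg c)^T *m (x - org c)).

(* Lowest-order Raviart-Thomas-Nedelec fields, i.e. Piola images of the reference
   fields t |-> a + (b_j t_j)_j, where b is a multiple of (1,...,1) on a simplex.
   They are extended to R^d, constantly along the directions orthogonal to the
   cell: divergence then computes the tangential divergence when k < d. *)
Definition RT0 k (c : cell k) : set (X -> X) :=
  [set v | exists a b : 'cV[R]_k,
    (simplex c -> forall j l, b j 0 = b l 0) /\
    v = fun x => edg c *m (a + \col_j (b j 0 * loc c x j 0))].

Definition proper_face (F P : set X) : Prop :=
  F <> P /\ exists (n : X) (a : R),
    (forall x, P x -> dot n x <= a) /\ F = P `&` [set x | dot n x = a].

Record mesh := Mesh {
  ncell : 'I_2 -> nat;
  bcell : forall i, 'I_(ncell i) -> cell m.+1;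
  ngcell : nat;
  gcell : 'I_ngcell -> cell m }.

Variable Th : mesh.

(* Discrete fields are families of polynomials indexed by the cells.  Discrete
   scalars are constant on each cell. *)
Definition bvel (i : 'I_2) := 'I_(ncell Th i) -> X -> X.
Definition bpres (i : 'I_2) := 'I_(ncell Th i) -> R.
Definition gvel := 'I_(ngcell Th) -> X -> X.
Definition gpres := 'I_(ngcell Th) -> R.

(* The function on R^d given by such a family.  On the interfaces of the cells, a
   null set for the relevant measure, one of the cells is picked.  Along gamma
   only cells of the same side are considered, which yields one-sided traces. *)
Definition glue (N : nat) (c : 'I_N -> set X) (Y : zmodType) (v : 'I_N -> X -> Y)
    (x : X) : Y :=
  if [pick K | x \in c K] is Some K then v K x else 0.

Definition bev i (v : bvel i) : X -> X := glue (fun K => cell_set (bcell K)) v.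
Definition bdiv i (v : bvel i) : X -> R :=
  glue (fun K => cell_set (bcell K)) (fun K => divergence (v K)).
Definition bpev i (q : bpres i) : X -> R :=
  glue (fun K => cell_set (bcell K)) (fun K _ => q K).
Definition gev (v : gvel) : X -> X := glue (fun E => cell_set (gcell E)) v.
Definition gdiv (v : gvel) : X -> R :=
  glue (fun E => cell_set (gcell E)) (fun E => divergence (v E)).
Definition gpev (q : gpres) : X -> R :=
  glue (fun E => cell_set (gcell E)) (fun E _ => q E).

Variable G : geometry R m.

(* V_{h,i} in H(div, Omega_i) and V_{h,gamma} in H(div_tau, gamma). *)
Definition Vh (i : 'I_2) : set (bvel i) :=
  [set v | (forall K, RT0 (bcell K) (v K)) /\
           weak_div (subdom G i) m.+1 (subdom G i) (bev v) (bdiv v)].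
Definition Vg : set gvel :=
  [set v | (forall E, RT0 (gcell E) (v E)) /\
           weak_div (domain G) m (fracture G) (gev v) (gdiv v)].

Definition ntr (i : 'I_2) (u : X -> X) (x : X) : R := dot (u x) (nrm G i x).

(* w . n_i is the L^2(gamma)-projection of mu onto V_{h,i} . n_i. *)
Definition trace_proj (i : 'I_2) (mu : gpres) (w : bvel i) : Prop :=
  Vh w /\ forall v : bvel i, Vh v ->
    ip m (fracture G) (fun x => gpev mu x - ntr i (bev w) x) (ntr i (bev v)) = 0.

Definition mesh_ok : Prop :=
  [/\ [/\ forall i (K : 'I_(ncell Th i)), cell_ok (bcell K),
          forall i, \bigcup_(K in [set: 'I_(ncell Th i)]) cell_set (bcell K)
                    = closure (subdom G i) &
          forall i j (K : 'I_(ncell Th i)) (L : 'I_(ncell Th j)),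
            ~ (i = j /\ K = L :> nat) ->
            let F := cell_set (bcell K) `&` cell_set (bcell L) in
            proper_face F (cell_set (bcell K)) /\
            proper_face F (cell_set (bcell L))],
      [/\ forall E : 'I_(ngcell Th), cell_ok (gcell E),
          \bigcup_(E in [set: 'I_(ngcell Th)]) cell_set (gcell E)
            = closure (fracture G) &
          forall E E' : 'I_(ngcell Th), E <> E' ->
            let F := cell_set (gcell E) `&` cell_set (gcell E') in
            proper_face F (cell_set (gcell E)) /\
            proper_face F (cell_set (gcell E'))],
      (* the trace of the bulk mesh on gamma refines the mesh of gamma *)
      (forall i (K : 'I_(ncell Th i)) (F : set X),
        proper_face F (cell_set (bcell K)) -> F `<=` closure (fracture G) ->
        exists E : 'I_(ngcell Th), F `<=` cell_set (gcell E)) &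
      exists c : R, forall (mu : gpres) (w0 : bvel ord0) (w1 : bvel ord_max),
        trace_proj mu w0 -> trace_proj mu w1 ->
        l2norm m (fracture G) (gpev mu) <=
          c * (l2norm m (fracture G) (ntr ord0 (bev w0)) +
               l2norm m (fracture G) (ntr ord_max (bev w1)))].

End mesh.
Arguments mesh : clear implicits.

Section model.
Context {R : realType} {m : nat}.
Local Notation X := 'cV[R]_m.+1.
Variable G : geometry R m.
Local Notation Om i := (subdom G i).
Local Notation gam := (fracture G).

(* permg is expressed in the tangential frame. *)
Record coeffs := Coeffs {
  perm : X -> 'M[R]_m.+1;
  permg : X -> 'M[R]_m;
  alpha : R;
  xi : R -> R }.

Definition uniformly_elliptic (k n : nat) (D : set X) (K : X -> 'M[R]_n) (c C : R) :=
  [/\ forall j l, measurable_on k D (fun x => invmx (K x) j l),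
      0 < c &
      {ae @hmeasure R m.+1 k, forall x : X, D x ->
        K x \in unitmx /\
        forall z : 'cV[R]_n, c * enorm z ^+ 2 <= dot z (invmx (K x) *m z) /\
                            enorm (invmx (K x) *m z) <= C * enorm z}].

Variable C : coeffs.

(* xi acts on each component of a tangential field. *)
Definition xi_field (u : X -> X) (x : X) : X :=
  frame G x *m map_mx (xi C) ((frame G x)^T *m u x).
Definition permg_inv (u : X -> X) (x : X) : X :=
  frame G x *m (invmx (permg C x) *m ((frame G x)^T *m u x)).
Definition perm_inv (u : X -> X) (x : X) : X := invmx (perm C x) *m u x.

(* Data of the problem: Nsteps time steps of lengths tau 1, tau 2, etc; the source
   terms srcn n, srcgn n are the values of src, srcg during the n-th step. *)
Record data := Data {
  Tfinal : R;
  Nsteps : nat;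
  tau : nat -> R;
  init : 'I_2 -> X -> R;
  initg : X -> R;
  src : R -> 'I_2 -> X -> R;
  srcg : R -> X -> R;
  srcn : nat -> 'I_2 -> X -> R;
  srcgn : nat -> X -> R }.

Definition time (S : data) (n : nat) : R := \sum_(1 <= j < n.+1) tau S j.

Definition data_ok (S : data) : Prop :=
  [/\ [/\ 0 < Tfinal S, forall n, (1 <= n <= Nsteps S)%N -> 0 < tau S n &
          time S (Nsteps S) = Tfinal S],
      (forall i, L2 m.+1 (Om i) (init S i)) /\ L2 m gam (initg S) &
      forall n, (1 <= n <= Nsteps S)%N ->
        [/\ forall i, L2 m.+1 (Om i) (srcn S n i),
            L2 m gam (srcgn S n) &
            forall t, time S n.-1 < t < time S n ->
              (forall i x, Om i x -> src S t i x = srcn S n i x) /\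
              (forall x, gam x -> srcg S t x = srcgn S n x)]].

(* u in H(div, Omega_i) has divergence g and normal trace r in L^2(gamma). *)
Definition bulk_flux (i : 'I_2) (u : X -> X) (g r : X -> R) : Prop :=
  [/\ vL2 m.+1 (Om i) u, L2 m.+1 (Om i) g, L2 m gam r &
      forall phi, test_fun (domain G) phi ->
        \int[hmeasure m.+1]_(x in Om i) (dot (u x) (grad phi x) + g x * phi x)
        = ip m gam r phi].

(* u in H(div_tau, gamma) has tangential divergence g. *)
Definition frac_flux (u : X -> X) (g : X -> R) : Prop :=
  [/\ vL2 m gam u, L2 m gam g,
      forall x, gam x -> frame G x *m ((frame G x)^T *m u x) = u x &
      weak_div (domain G) m gam u g].

(* z is the (absolutely continuous) primitive of y on [0, Tfinal] with initial
   value z0. *)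
Definition primitive (T z0 : R) (z y : R -> R) : Prop :=
  lebesgue_measure.-integrable `]0, T[ (EFin \o y) /\
  forall t, 0 < t < T -> z t = z0 + \int[lebesgue_measure]_(s in `]0, t[) y s.

(* Mixed weak form of the continuous problem, with unknowns u_i, p_i, u_gamma,
   p_gamma.  The conditions p_i = 0 on Gamma_i and p_gamma = 0 on the boundary of
   gamma are natural; -u_i . n_i + alpha p_i = alpha p_gamma has been used to
   replace the trace of p_i on gamma. *)
Definition continuous_solution (S : data) (u : R -> 'I_2 -> X -> X)
    (p : R -> 'I_2 -> X -> R) (ug : R -> X -> X) (pg : R -> X -> R) : Prop :=
  exists (g r : R -> 'I_2 -> X -> R) (gg : R -> X -> R),
  [/\ {ae lebesgue_measure, forall t : R, 0 < t < Tfinal S ->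
        [/\ forall i, bulk_flux i (u t i) (g t i) (r t i) /\ L2 m.+1 (Om i) (p t i),
            frac_flux (ug t) (gg t) /\ L2 m gam (pg t),
            forall i v gv rv, bulk_flux i v gv rv ->
              vip m.+1 (Om i) (perm_inv (u t i)) v
                + (alpha C)^-1 * ip m gam (r t i) rv - ip m.+1 (Om i) gv (p t i)
              = - ip m gam (pg t) rv &
            forall v gv, frac_flux v gv ->
              vip m gam (fun x => xi_field (ug t) x + permg_inv (ug t) x) v
                - ip m gam gv (pg t) = 0]},
      forall i q, L2 m.+1 (Om i) q ->
        primitive (Tfinal S) (ip m.+1 (Om i) (init S i) q)
          (fun t => ip m.+1 (Om i) (p t i) q)
          (fun t => ip m.+1 (Om i) (fun x => src S t i x - g t i x) q) &
      forall mu, L2 m gam mu ->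
        primitive (Tfinal S) (ip m gam (initg S) mu)
          (fun t => ip m gam (pg t) mu)
          (fun t => ip m gam
             (fun x => srcg S t x + r t ord0 x + r t ord_max x - gg t x) mu)].

Definition flux_values (S : data) (u : R -> 'I_2 -> X -> X) (ug : R -> X -> X) :
    set R :=
  [set a | exists t x, 0 < t < Tfinal S /\
    ((exists2 i, Om i x & a = enorm (u t i x)) \/ (gam x /\ a = enorm (ug t x)))].

Definition xi_C1 : Prop :=
  (forall s, derivable (xi C) s 1) /\ continuous (derive1 (xi C)).

Definition xi_lipschitz (xim Lxi : R) : Prop :=
  [/\ xi_C1, {mono xi C : a b / a < b}, 0 < xim &
      forall s, xim <= derive1 (xi C) s <= Lxi].

Definition xi_bounded_flux (S : data) (xim Lxi Cxi : R) : Prop :=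
  [/\ xi_C1, forall s, 0 <= derive1 (xi C) s, xim = 0 &
      exists u p ug pg,
        [/\ continuous_solution S u p ug pg,
            has_ubound (flux_values S u ug),
            Cxi = sup (flux_values S u ug) &
            Lxi = sup [set derive1 (xi C) s | s in [set s | `|s| <= Cxi]]]].

Variable Th : mesh R m.

Definition a_ (i : 'I_2) (u v : bvel Th i) : R :=
  vip m.+1 (Om i) (perm_inv (bev u)) (bev v)
  + (alpha C)^-1 * ip m gam (ntr G i (bev u)) (ntr G i (bev v)).
Definition b_ (i : 'I_2) (u : bvel Th i) (q : bpres Th i) : R :=
  ip m.+1 (Om i) (bdiv u) (bpev q).
Definition c_ (i : 'I_2) (p q : bpres Th i) : R := ip m.+1 (Om i) (bpev p) (bpev q).
Definition ag (u v : gvel Th) : R := vip m gam (permg_inv (gev u)) (gev v).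
Definition bg (u : gvel Th) (mu : gpres Th) : R := ip m gam (gdiv u) (gpev mu).
Definition cg (la mu : gpres Th) : R := ip m gam (gpev la) (gpev mu).

(* (u^*_{h,i}(la), p^*_{h,i}(la)) *)
Definition star_problem (i : 'I_2) (dt : R) (la : gpres Th)
    (u : bvel Th i) (p : bpres Th i) : Prop :=
  Vh G u /\ forall (v : bvel Th i) (q : bpres Th i), Vh G v ->
    a_ u v - b_ v p = - ip m gam (gpev la) (ntr G i (bev v)) /\
    c_ p q + dt * b_ u q = 0.

(* (\bar u^n_{h,i}, \bar p^n_{h,i}), with f = f^n and pprev = p^{n-1}_{h,i} *)
Definition bar_problem (i : 'I_2) (dt : R) (f : X -> R) (pprev : bpres Th i)
    (u : bvel Th i) (p : bpres Th i) : Prop :=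
  Vh G u /\ forall (v : bvel Th i) (q : bpres Th i), Vh G v ->
    a_ u v - b_ v p = 0 /\
    c_ (p - pprev) q + dt * b_ u q = dt * ip m.+1 (Om i) f (bpev q).

Definition s_form (ustar : forall i, gpres Th -> bvel Th i) (la mu : gpres Th) : R :=
  - \sum_i ip m gam (ntr G i (bev (ustar i la))) (gpev mu).

(* Solutions of one time step of length dt of the reduced scheme, with interface
   form s, source rhs = f_gamma^n + g_gamma^n and laprev = lambda^{n-1}. *)
Definition reduced_scheme (dt : R) (s : gpres Th -> gpres Th -> R) (rhs : X -> R)
    (laprev : gpres Th) (u : gvel Th) (la : gpres Th) : Prop :=
  Vg G u /\ forall (v : gvel Th) (mu : gpres Th), Vg G v ->
    vip m gam (xi_field (gev u)) (gev v) + ag u v - bg v la = 0 /\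
    cg (la - laprev) mu + dt * bg u mu + dt * s la mu
      = dt * ip m gam rhs (gpev mu).

(* One iteration, from u^{n,k-1} = uprev to (u^{n,k}, lambda^{n,k}) = (u, la). *)
Definition moldd_step (Lg dt : R) (s : gpres Th -> gpres Th -> R) (rhs : X -> R)
    (laprev : gpres Th) (uprev u : gvel Th) (la : gpres Th) : Prop :=
  Vg G u /\ forall (v : gvel Th) (mu : gpres Th), Vg G v ->
    vip m gam (fun x => xi_field (gev uprev) x + Lg *: (gev u x - gev uprev x))
        (gev v) + ag u v - bg v la = 0 /\
    cg (la - laprev) mu + dt * bg u mu + dt * s la mu
      = dt * ip m gam rhs (gpev mu).

Definition norm_gamma (mu : gpres Th) : R := l2norm m gam (gpev mu).
Definition vnorm_gamma (v : gvel Th) : R := vl2norm m gam (gev v).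
Definition norm_s (s : gpres Th -> gpres Th -> R) (mu : gpres Th) : R :=
  Num.sqrt (s mu mu).

End model.
Arguments coeffs : clear implicits.
Arguments data : clear implicits.

(* Main.v *)
Require Import Defs.
From HB Require Import structures.
From mathcomp Require Import all_boot all_order all_algebra.
From mathcomp Require Import all_classical all_reals all_analysis.
From mathcomp Require Import measurable_realfun ring lra.

Set Implicit Arguments.
Unset Strict Implicit.
Unset Printing Implicit Defensive.
Import Order.TTheory GRing.Theory Num.Theory numFieldNormedType.Exports.
Local Open Scope classical_set_scope.
Local Open Scope ring_scope.

(** Why the iteration contracts. The difference of two consecutive steps, tested with
    the differences of the velocities and of the pressures, loses its coupling terms
    ([iteration_contraction]). The remaining term pairs the new velocity increment with
    Lg times the previous one, minus the increment of the nonlinear term. The discrete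
    velocities are tangential on the fracture, because the fracture contains short
    segments from each of its points towards the other points of a cell ([gcell_frame]).
    So in the orthonormal tangential frame this pairing is a sum over components of (Lg
    - D) d w, where D is a slope of xi. As D <= Lxi = 2 (1 - zeta) Lg, Young's
    inequality yields the constants Lg / 2 and Lg / 2 - zeta xim ([stabilization_young],
    [xi_form_key]).

    Why the iterates converge to the solution. Since Lg / 2 - zeta xim < Lg / 2 + cKg,
    the increments decay geometrically. The discrete spaces are finitely generated,
    hence complete for every semi-inner product, as one sees on a maximal orthonormal
    family ([fin_span_complete]). The limit must satisfy the scheme, but the norm of the
    velocities on the fracture does not directly control their divergences, which enter
    the coupling form. So that norm is augmented by finitely many values of the coupling
    form; these are Cauchy too, because the mass balance expresses them by the pressures
    ([constraint_geo], [iteration_cvg]). Uniqueness is the same cancellation combined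
    with the monotonicity of xi ([nonlinear_problem_unique]).

    The interface form is linear, nonnegative and bounded by the norm of the pressures:
    this is the energy identity for the problem on each side of the fracture
    ([steklov_linear], [steklov_ge0], [steklov_bounded]).

    These arguments need the integrals to be linear, hence integrands to be integrable.
    Hausdorff measures come from metric outer measures, so Borel sets are measurable
    ([closed_caratheodory]), and they are finite on cells of the right dimension
    ([hausdorff_cell_lt]). Consequently the class of essentially bounded functions
    contains all the integrands of the forms and is stable under sums and products
    ([ess_bounded]). The conforming spaces are vector spaces because test functions are
    Lipschitz, hence measurable and bounded ([test_fun_lipschitz], [weak_div_linear]). *)

(** * Finite-dimensional spaces with a semi-inner product *)

Section semi_inner_product.
Context {R : realType} {V : lmodType R}.
Implicit Types (S : set V) (B : V -> V -> R).

Definition is_subspace S :=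
  S 0 /\ forall (a : R) u v, S u -> S v -> S (a *: u + v).

Definition linear_on S (f : V -> R) :=
  forall (a : R) u v, S u -> S v -> f (a *: u + v) = a * f u + f v.

(** Null vectors are allowed: discrete fields are families of polynomials on whole
    cells, of which the integrals only see the values on the fracture. *)
Record semi_inner S B : Prop := SemiInner {
  semi_innerC : forall u v, S u -> S v -> B u v = B v u;
  semi_innerL : forall w, S w -> linear_on S (B^~ w);
  semi_inner_ge0 : forall u, S u -> 0 <= B u u }.

(** The spanning vectors need not belong to S: spaces of conforming fields sit inside
    an explicitly generated space of discontinuous ones. *)
Definition fin_span S := exists (I : finType) (w : I -> V),
  forall v, S v -> exists a : I -> R, v = \sum_i a i *: w i.

Lemma subspaceT : is_subspace [set: V].
Proof. by []. Qed.

Section closure.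
Variables (S : set V) (subS : is_subspace S).

Lemma subspaceD u v : S u -> S v -> S (u + v).
Proof. by move=> Su Sv; rewrite -(scale1r u); apply: subS.2. Qed.

Lemma subspaceZ a u : S u -> S (a *: u).
Proof. by move=> Su; rewrite -(addr0 (a *: u)); apply: subS.2 => //; exact: subS.1. Qed.

Lemma subspaceB u v : S u -> S v -> S (u - v).
Proof. by move=> Su Sv; apply: subspaceD => //; rewrite -scaleN1r; exact: subspaceZ. Qed.

Lemma subspace_sum (I : finType) (w : I -> V) :
  (forall i, S (w i)) -> S (\sum_i w i).
Proof.
by move=> Sw; elim/big_ind : _ => //; [exact: subS.1|exact: subspaceD].
Qed.

Variables (f : V -> R) (linf : linear_on S f).

Lemma linear_on0 : f 0 = 0.
Proof.
have S0 := subS.1.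
have := linf 1 S0 S0; rewrite scaler0 addr0 mul1r => /eqP.
by rewrite -subr_eq subrr => /eqP.
Qed.

Lemma linear_onD u v : S u -> S v -> f (u + v) = f u + f v.
Proof. by move=> Su Sv; rewrite -{1}(scale1r u) linf// mul1r. Qed.

Lemma linear_onZ a u : S u -> f (a *: u) = a * f u.
Proof.
by move=> Su; rewrite -(addr0 (a *: u)) linf// ?linear_on0 ?addr0//; exact: subS.1.
Qed.

Lemma linear_onB u v : S u -> S v -> f (u - v) = f u - f v.
Proof.
move=> Su Sv; rewrite linear_onD//; last by rewrite -scaleN1r; exact: subspaceZ.
by rewrite -scaleN1r linear_onZ// mulN1r.
Qed.

Lemma linear_on_sum (I : finType) (a : I -> R) (w : I -> V) :
  (forall i, S (w i)) -> f (\sum_i a i *: w i) = \sum_i a i * f (w i).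
Proof.
move=> Sw.
suff : S (\sum_i a i *: w i) /\ f (\sum_i a i *: w i) = \sum_i a i * f (w i) by case.
elim/big_rec2 : _ => [|i y x _ [Sx fx]]; first by split; [exact: subS.1|exact: linear_on0].
by split; [exact: subS.2|rewrite linf// fx].
Qed.

End closure.

Section inner.
Variables (S : set V) (B : V -> V -> R) (subS : is_subspace S) (hB : semi_inner S B).

Lemma semi_innerDZ u v t : S u -> S v ->
  B (t *: v + u) (t *: v + u) = B u u + t * (B u v + B u v) + t ^+ 2 * B v v.
Proof.
move=> Su Sv; have Sw : S (t *: v + u) by exact: subS.2.
rewrite (semi_innerL hB) // !(semi_innerC hB (v := t *: v + u)) //.
rewrite !(semi_innerL hB) // (semi_innerC hB (u := v) (v := u)) //; ring.
Qed.

Lemma cauchy_schwarz u v : S u -> S v -> B u v ^+ 2 <= B u u * B v v.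
Proof.
move=> Su Sv.
have Q t : 0 <= B u u + t * (B u v + B u v) + t ^+ 2 * B v v.
  by rewrite -semi_innerDZ//; apply: semi_inner_ge0 hB _ _; exact: subS.2.
(* for a null vector v the quadratic polynomial Q degenerates to an affine one *)
have := semi_inner_ge0 hB Sv; rewrite le_eqVlt => /predU1P[a0|a0].
  rewrite -a0 mulr0; have [->|b0] := eqVneq (B u v) 0; first by rewrite expr0n.
  have := Q (- (B u u + 1) / (B u v + B u v)).
  rewrite -a0 mulr0 addr0 divfK; last by rewrite -mulr2n mulrn_eq0.
  by rewrite opprD addrA subrr add0r oppr_ge0 ler10.
have := Q (- B u v / B v v).
suff -> : B u u + - B u v / B v v * (B u v + B u v) + (- B u v / B v v) ^+ 2 * B v v
  = (B u u * B v v - B u v ^+ 2) / B v v.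
  by rewrite pmulr_lge0 ?invr_gt0// subr_ge0.
by field; rewrite gt_eqF.
Qed.

Lemma semi_inner_eq0 u v : S u -> S v -> B u u = 0 -> B u v = 0.
Proof.
move=> Su Sv u0; have := cauchy_schwarz Su Sv; rewrite u0 mul0r => h.
by apply/eqP; rewrite -sqrf_eq0 eq_le h sqr_ge0.
Qed.

End inner.

Definition orthonormal S B (r : nat) (e : 'I_r -> V) :=
  (forall i, S (e i)) /\ forall i j, B (e i) (e j) = (i == j)%:R.

(** A linear relation between the coordinate rows is one between the vectors, and
    pairing it with each of them shows that it is trivial. *)
Lemma orthonormal_size S B r (e : 'I_r -> V) (I : finType) (w : I -> V) :
  is_subspace S -> semi_inner S B ->
  (forall v, S v -> exists a : I -> R, v = \sum_i a i *: w i) ->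
  orthonormal S B e -> (r <= #|I|)%N.
Proof.
move=> subS hB span [Se oe].
have [a ha] := choice (fun i => span _ (Se i)).
pose M : 'M[R]_(r, #|I|) := \matrix_(i, j) a i (enum_val j).
suff : row_free M by move=> /eqP <-; exact: rank_leq_col.
rewrite -kermx_eq0; apply/eqP/row_matrixP => l; rewrite row0.
set x := row l _; have xM : x *m M = 0.
  by rewrite /x -row_mul mulmx_ker row0.
apply/rowP => j; rewrite [RHS]mxE.
have /= := linear_on_sum subS (semi_innerL hB (Se j)) (x 0) Se.
rewrite (_ : \sum_i _ = 0); last first.
  under eq_bigr do rewrite ha scaler_sumr.
  rewrite exchange_big /= big1// => i _.
  under eq_bigr do rewrite scalerA.
  rewrite -scaler_suml; have := congr1 (fun y : 'rV_ _ => y 0 (enum_rank i)) xM.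
  rewrite [X in X = _]mxE [X in _ = X]mxE => h.
  rewrite (_ : \sum_i0 _ = 0) ?scale0r// -[RHS]h.
  by apply: eq_bigr => i0 _; rewrite /M !mxE enum_rankK.
rewrite (linear_on0 subS (semi_innerL hB (Se j))) (bigD1 j)//= big1; last first.
  by move=> i ij; rewrite oe (negbTE ij) mulr0.
by rewrite oe eqxx mulr1 addr0 => /esym.
Qed.

(** A family of maximal size spans the space up to null vectors: otherwise the
    residual of some vector could be normalised and added to the family. *)
Lemma orthonormal_basis S B : is_subspace S -> semi_inner S B -> fin_span S ->
  exists r (e : 'I_r -> V), orthonormal S B e /\
    forall v, S v -> let w := v - \sum_i B v (e i) *: e i in B w w = 0.
Proof.
move=> subS hB [I [w span]].
pose P r := `[< exists e : 'I_r -> V, orthonormal S B e >].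
have P0 : exists r, P r.
  by exists 0%N; apply/asboolP; exists (fun=> 0); split => [[]|[]].
have Pb r : P r -> (r <= #|I|)%N.
  by move=> /asboolP[e] /(orthonormal_size subS hB span).
case: (ex_maxnP P0 Pb) => r /asboolP[e [Se oe]] rmax.
exists r, e; split => // v Sv; set z := v - _ => /=.
have Ssum : S (\sum_i B v (e i) *: e i).
  by apply: subspace_sum => // i; exact: subspaceZ.
have Sz : S z by exact: subspaceB.
have ze j : B z (e j) = 0.
  rewrite (linear_onB subS (semi_innerL hB (Se j)))//.
  rewrite (linear_on_sum subS (semi_innerL hB (Se j)))// (bigD1 j)//= big1.
    by rewrite oe eqxx mulr1 addr0 subrr.
  by move=> i ij; rewrite oe (negbTE ij) mulr0.
apply/eqP/negPn/negP => z0.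
have {}z0 : 0 < B z z by rewrite lt_neqAle eq_sym z0 (semi_inner_ge0 hB).
pose y := (Num.sqrt (B z z))^-1 *: z.
have Sy : S y by exact: subspaceZ.
have ye j : B y (e j) = 0.
  by rewrite (linear_onZ subS (semi_innerL hB (Se j)))// ze mulr0.
have yy : B y y = 1.
  rewrite /y (linear_onZ subS (semi_innerL hB Sy))// (semi_innerC hB)//.
  rewrite (linear_onZ subS (semi_innerL hB Sz))// mulrA -expr2 exprVn.
  by rewrite sqr_sqrtr ?(ltW z0)// mulVf// gt_eqF.
suff : P r.+1 by move=> /rmax; rewrite ltnn.
apply/asboolP; exists (fun i => if unlift ord_max i is Some j then e j else y).
split => [i|i j]; first by case: unliftP.
case: unliftP => [i' ->|->]; case: unliftP => [j' ->|->].
- by rewrite oe (inj_eq lift_inj).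
- by rewrite (semi_innerC hB)// ye eq_sym (negbTE (neq_lift _ _)).
- by rewrite ye (negbTE (neq_lift _ _)).
- by rewrite yy eqxx.
Qed.

End semi_inner_product.

Lemma sqr_cvg {R : realType} (x : nat -> R) (l M : R) (e : nat -> R) :
  (forall k, (x k - l) ^+ 2 <= M * e k) -> e @ \oo --> (0 : R) -> x @ \oo --> l.
Proof.
move=> xe e0; apply/(@subr_cvg0 R R^o).
have h : (fun k => `|x k - l|) @ \oo --> (0 : R).
  have h1 : (fun k => Num.sqrt (M * e k)) @ \oo --> (0 : R).
    rewrite -[X in _ --> X](sqrtr0 R).
    apply: continuous_cvg; first exact: sqrt_continuous.
    by rewrite -(mulr0 M); apply: cvgMl_tmp.
  apply: (@squeeze_cvgr _ _ _ _ (fun=> 0) (fun k => Num.sqrt (M * e k))) => //.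
    by apply: nearW => k; rewrite normr_ge0/= -sqrtr_sqr ler_wsqrtr.
  exact: cvg_cst.
by apply/(@norm_cvg0P R R^o).
Qed.

Lemma seq_cvgD {R : realType} (x y : nat -> R) (a b : R) :
  x @ \oo --> a -> y @ \oo --> b -> (fun k => x k + y k) @ \oo --> a + b.
Proof. by move=> xa yb; apply: (@cvgD R R^o). Qed.

Lemma seq_cvgB {R : realType} (x y : nat -> R) (a b : R) :
  x @ \oo --> a -> y @ \oo --> b -> (fun k => x k - y k) @ \oo --> a - b.
Proof. by move=> xa yb; apply: (@cvgB R R^o). Qed.

Lemma cvg_cst_eq {R : realType} (x : nat -> R) (l a : R) :
  x @ \oo --> l -> (forall k, x k = a) -> l = a.
Proof.
move=> xl xa; apply: (cvg_unique (@Rhausdorff R) xl).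
by rewrite (_ : x = fun=> a); [exact: cvg_cst|exact/funext].
Qed.

Lemma le_cvg0 {R : realType} (x e : nat -> R) : e @ \oo --> (0 : R) ->
  (forall k, 0 <= x k <= e k) -> x @ \oo --> (0 : R).
Proof.
move=> e0 xe; apply: (@squeeze_cvgr _ _ _ _ (fun=> 0) e) => //; last exact: cvg_cst.
by apply: nearW => k; exact: xe.
Qed.

Lemma geometric_cauchy {R : realType} (x : nat -> R) (K q : R) : 0 <= q < 1 ->
  (forall k, (x k.+1 - x k) ^+ 2 <= K * q ^+ k) -> exists l : R, x @ \oo --> l.
Proof.
move=> /andP[q0 q1] hx.
have K0 : 0 <= K by have := hx 0%N; rewrite expr0 mulr1; apply: le_trans; exact: sqr_ge0.
pose r := Num.sqrt q; have r0 : 0 <= r by exact: sqrtr_ge0.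
have r1 : r < 1 by rewrite -sqrtr1 ltr_sqrt.
have dx k : `|x k.+1 - x k| <= geometric (Num.sqrt K) r k.
  rewrite /= -sqrtr_sqr (le_trans (ler_wsqrtr (hx k)))// sqrtrM//.
  rewrite ler_wpM2l ?sqrtr_ge0//.
  rewrite -[leRHS]ger0_norm ?exprn_ge0// -sqrtr_sqr ler_wsqrtr//.
  by rewrite -exprM mulnC exprM sqr_sqrtr.
have cv : cvgn (series (fun k => x k.+1 - x k)).
  apply: normed_cvg; apply: (series_le_cvg _ _ dx) => [k|k|] /=.
  - exact: normr_ge0.
  - by rewrite mulr_ge0 ?sqrtr_ge0 ?exprn_ge0.
  - by apply: is_cvg_geometric_series; rewrite ger0_norm.
exists (x 0%N + limn (series (fun k => x k.+1 - x k))).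
have xE : x = (fun n => x 0%N + series (fun k => x k.+1 - x k) n).
  apply/funext => n /=; rewrite /series /= telescope_sumr//.
  by rewrite addrC subrK.
rewrite [X in X @ _]xE.
by apply: (@cvgD R R^o _ _ _ (fun=> x 0%N)); [exact: cvg_cst|exact: cv].
Qed.

Lemma sum_cvg0 {R : realType} (I : finType) (x : I -> nat -> R) :
  (forall i, x i @ \oo --> (0 : R)) -> (fun k => \sum_i x i k) @ \oo --> (0 : R).
Proof.
move=> x0; elim: (index_enum I) => [|i r IH].
  by under eq_fun do rewrite big_nil; exact: cvg_cst.
under eq_fun do rewrite big_cons.
have := @cvgD R R^o _ _ _ (x i) _ 0 0 (x0 i) IH; rewrite (_ : 0 + 0 = 0) ?addr0//; exact.
Qed.

Section completeness.
Context {R : realType} {V : lmodType R}.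

(** Along an orthonormal basis the square norm is, up to null vectors, the sum of
    the squared coordinates, and each coordinate sequence converges. *)
Lemma fin_span_complete (S : set V) (B : V -> V -> R) (u : nat -> V) (K q : R) :
  is_subspace S -> semi_inner S B -> fin_span S -> (forall k, S (u k)) ->
  0 <= q < 1 -> (forall k, B (u k.+1 - u k) (u k.+1 - u k) <= K * q ^+ k) ->
  exists2 l, S l & (fun k => B (u k - l) (u k - l)) @ \oo --> (0 : R).
Proof.
move=> subS hB fS Su q01 hu.
have [r [e [[Se oe] be]]] := orthonormal_basis subS hB fS.
have [c hc] : {c : 'I_r -> R & forall i, (fun k => B (u k) (e i)) @ \oo --> c i}.
  apply: (@choice _ _ (fun i c => (fun k => B (u k) (e i)) @ \oo --> c)) => i.
  apply: (@geometric_cauchy _ _ K q) => // k.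
  rewrite -(linear_onB subS (semi_innerL hB (Se i)))//.
  apply: (le_trans _ (hu k)).
  apply: (le_trans (cauchy_schwarz subS hB (subspaceB subS (Su _) (Su _)) (Se i))).
  by rewrite oe eqxx mulr1.
have Sl : S (\sum_i c i *: e i) by apply: subspace_sum => // i; exact: subspaceZ.
exists (\sum_i c i *: e i) => //.
have -> : (fun k => B (u k - \sum_i c i *: e i) (u k - \sum_i c i *: e i)) =
          (fun k => \sum_i (B (u k) (e i) - c i) ^+ 2).
  apply/funext => k; pose d i := B (u k) (e i) - c i.
  pose z := \sum_i d i *: e i; pose w := u k - \sum_i B (u k) (e i) *: e i.
  have -> : u k - \sum_i c i *: e i = 1 *: z + w.
    rewrite scale1r /z /w /d; under [in RHS]eq_bigr do rewrite scalerBl.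
    by rewrite sumrB [RHS]addrC addrA subrK.
  have Sz : S z by apply: subspace_sum => // i; exact: subspaceZ.
  have Sw : S w.
    by apply: subspaceB => //; apply: subspace_sum => // i; exact: subspaceZ.
  have w0 : B w w = 0 by exact: be.
  rewrite (semi_innerDZ subS hB)// w0 (semi_inner_eq0 subS hB Sw Sz w0).
  rewrite addr0 mulr0 add0r add0r expr1n mul1r.
  rewrite {1}/z (linear_on_sum subS (semi_innerL hB Sz))//.
  apply: eq_bigr => i _; rewrite (semi_innerC hB)// /z.
  rewrite (linear_on_sum subS (semi_innerL hB (Se i)))// (bigD1 i)//= big1.
    by rewrite oe eqxx mulr1 addr0 expr2.
  by move=> j ji; rewrite oe (negbTE ji) mulr0.
apply: sum_cvg0 => i.
have h : (fun k => B (u k) (e i) - c i) @ \oo --> (0 : R) by apply/(@subr_cvg0 R R^o).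
have := cvgM h h; rewrite (_ : 0 * 0 = 0) ?mulr0//; exact.
Qed.

End completeness.

(** * The linearised iteration *)

(** Abstract form of the scheme: S carries the velocities, W the pressures, B and c are
    the scalar products, A is the resistance, X the nonlinear term, b the coupling, s the
    interface form and F the right-hand side. *)
Section linearised_iteration.
Context {R : realType} {V W : lmodType R}.
Variables (S : set V) (B A X : V -> V -> R) (b : V -> W -> R) (c s : W -> W -> R).
Variables (F : W -> R) (lap : W) (dt Lg q cK : R).
Hypotheses (subS : is_subspace S) (finS : fin_span S) (finW : fin_span [set: W]).
Hypotheses (hB : semi_inner S B) (hc : semi_inner setT c).
Hypotheses (Alin : forall v, S v -> linear_on S (A^~ v))
  (Acoer : forall v, S v -> cK * B v v <= A v v)
  (Abd : exists M, forall u v, S u -> S v -> A u v ^+ 2 <= M * (B u u * B v v)).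
Hypotheses (blinl : forall mu, linear_on S (b^~ mu))
  (blinr : forall v, S v -> linear_on setT (b v))
  (bbd : forall v, S v -> exists M, forall mu, b v mu ^+ 2 <= M * c mu mu).
Hypotheses (slin : forall mu, linear_on setT (s^~ mu)) (s_ge0 : forall mu, 0 <= s mu mu)
  (sbd : exists M, forall la mu, s la mu ^+ 2 <= M * (c la la * c mu mu)).
Hypotheses (Xmono : forall u v, S u -> S v -> 0 <= X u (u - v) - X v (u - v)).
Hypotheses (dt_gt0 : 0 < dt) (q_ge0 : 0 <= q) (cK_gt0 : 0 < cK) (qLg : q <= Lg / 2).

Definition nonlinear_problem (u : V) (la : W) :=
  S u /\ forall v mu, S v ->
    X u v + A u v - b v la = 0 /\
    c (la - lap) mu + dt * b u mu + dt * s la mu = F mu.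

Definition linearised_problem (up u : V) (la : W) :=
  S u /\ forall v mu, S v ->
    X up v + Lg * B (u - up) v + A u v - b v la = 0 /\
    c (la - lap) mu + dt * b u mu + dt * s la mu = F mu.

Let subW : is_subspace [set: W] := subspaceT.

Lemma constraint_diff (u u' : V) (la la' mu : W) : S u -> S u' ->
  c (la - lap) mu + dt * b u mu + dt * s la mu = F mu ->
  c (la' - lap) mu + dt * b u' mu + dt * s la' mu = F mu ->
  c (la' - la) mu + dt * b (u' - u) mu + dt * s (la' - la) mu = 0.
Proof.
move=> Su Su' e e'.
rewrite (linear_onB subS (blinl mu))// (linear_onB subW (slin mu))//.
have -> : la' - la = (la' - lap) - (la - lap) by rewrite opprB addrA subrK.
rewrite (linear_onB subW (semi_innerL hc (w := mu) I))//; lra.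
Qed.

(** Testing with the differences of velocities and of pressures makes the
    coupling terms cancel. *)
Lemma iteration_contraction (u0 u1 u2 : V) (la1 la2 : W) : S u0 ->
  linearised_problem u0 u1 la1 -> linearised_problem u1 u2 la2 ->
  (forall v, S v -> Lg * B (u1 - u0) v - (X u1 v - X u0 v) <=
     Lg / 2 * B v v + q * B (u1 - u0) (u1 - u0)) ->
  c (la2 - la1) (la2 - la1) + dt * s (la2 - la1) (la2 - la1)
    + (Lg / 2 + cK) * dt * B (u2 - u1) (u2 - u1)
    <= q * dt * B (u1 - u0) (u1 - u0).
Proof.
move=> Su0 [Su1 h1] [Su2 h2] key.
have Sd : S (u2 - u1) by exact: subspaceB.
have [e1 f1] := h1 (u2 - u1) (la2 - la1) Sd.
have [e2 f2] := h2 (u2 - u1) (la2 - la1) Sd.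
have := constraint_diff Su1 Su2 f1 f2.
set bd := b (u2 - u1) (la2 - la1) => f.
have bE : b (u2 - u1) la2 - b (u2 - u1) la1 = bd.
  by rewrite -(linear_onB subW (blinr Sd)).
have AE : A u2 (u2 - u1) - A u1 (u2 - u1) = A (u2 - u1) (u2 - u1).
  by rewrite -(linear_onB subS (Alin Sd)).
have Ac := Acoer Sd; have k := key _ Sd.
have H : bd >= (Lg / 2 + cK) * B (u2 - u1) (u2 - u1) - q * B (u1 - u0) (u1 - u0).
  by lra.
have : dt * bd >= dt * ((Lg / 2 + cK) * B (u2 - u1) (u2 - u1) - q * B (u1 - u0) (u1 - u0)).
  by rewrite ler_pM2l.
lra.
Qed.

(** Same cancellation as for the iteration; monotonicity replaces the stabilization. *)
Lemma nonlinear_problem_unique (u u' : V) (la la' : W) :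
  nonlinear_problem u la -> nonlinear_problem u' la' ->
  B (u' - u) (u' - u) = 0 /\ c (la' - la) (la' - la) = 0.
Proof.
move=> [Su h] [Su' h']; have Sd : S (u' - u) by exact: subspaceB.
have [e f] := h (u' - u) (la' - la) Sd.
have [e' f'] := h' (u' - u) (la' - la) Sd.
have := constraint_diff Su Su' f f'.
set bd := b (u' - u) (la' - la) => g.
have bE : b (u' - u) la' - b (u' - u) la = bd.
  by rewrite -(linear_onB subW (blinr Sd)).
have AE : A u' (u' - u) - A u (u' - u) = A (u' - u) (u' - u).
  by rewrite -(linear_onB subS (Alin Sd)).
have Ac := Acoer Sd; have Xm := Xmono Su' Su.
have c0 := semi_inner_ge0 hc (u := la' - la) I; have s0 := s_ge0 (la' - la).
have B0 := semi_inner_ge0 hB Sd.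
have cB0 : 0 <= cK * B (u' - u) (u' - u) by rewrite mulr_ge0// ltW.
have bd0 : cK * B (u' - u) (u' - u) <= bd by lra.
have : dt * (cK * B (u' - u) (u' - u)) <= dt * bd by rewrite ler_pM2l.
have : 0 <= dt * (cK * B (u' - u) (u' - u)) by rewrite mulr_ge0// ltW.
have : 0 <= dt * s (la' - la) (la' - la) by rewrite mulr_ge0// ltW.
move=> x1 x2 x3.
have : dt * (cK * B (u' - u) (u' - u)) = 0 by lra.
move=> /eqP; rewrite !mulf_eq0 (gt_eqF dt_gt0) (gt_eqF cK_gt0) /= => /eqP ->; split => //; lra.
Qed.

Section convergence.
Variables (u : nat -> V) (la : nat -> W).
Hypotheses (Su0 : S (u 0%N)) (hu : forall k, linearised_problem (u k) (u k.+1) (la k)).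
Hypothesis Xkey : forall k v, S v ->
  Lg * B (u k.+1 - u k) v - (X (u k.+1) v - X (u k) v) <=
     Lg / 2 * B v v + q * B (u k.+1 - u k) (u k.+1 - u k).
Hypothesis Xcont : forall w v, S w -> S v -> exists M, forall k,
  (X (u k) v - X w v) ^+ 2 <= M * B (u k - w) (u k - w).

Let Su k : S (u k). Proof. by case: k => // k; case: (hu k). Qed.

Let rho := q / (Lg / 2 + cK).
Let E k := B (u k.+1 - u k) (u k.+1 - u k).

Let D_gt0 : 0 < Lg / 2 + cK.
Proof. by rewrite ltr_wpDl// (le_trans q_ge0). Qed.

Let rho01 : 0 <= rho < 1.
Proof.
rewrite /rho divr_ge0 ?(ltW D_gt0)//= ltr_pdivrMr// mul1r -[ltLHS]addr0 ler_ltD//.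
Qed.

Let E_ge0 k : 0 <= E k.
Proof. by apply: (semi_inner_ge0 hB); exact: subspaceB. Qed.

Let step k : c (la k.+1 - la k) (la k.+1 - la k)
    + dt * s (la k.+1 - la k) (la k.+1 - la k) + (Lg / 2 + cK) * dt * E k.+1
    <= q * dt * E k.
Proof. by apply: iteration_contraction => //; exact: Xkey. Qed.

Let E_geo k : E k <= E 0%N * rho ^+ k.
Proof.
elim: k => [|k IH]; first by rewrite mulr1.
rewrite exprS mulrCA (le_trans _ (ler_wpM2l _ IH)) //; last by case/andP: rho01.
rewrite /rho mulrAC ler_pdivlMr// mulrC -(ler_pM2l dt_gt0).
have := step k; have := semi_inner_ge0 hc (u := la k.+1 - la k) I.
have : 0 <= dt * s (la k.+1 - la k) (la k.+1 - la k) by rewrite mulr_ge0// ltW.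
lra.
Qed.

Let c_geo k : c (la k.+1 - la k) (la k.+1 - la k) <= (q * dt * E 0%N) * rho ^+ k.
Proof.
have qd : 0 <= q * dt by rewrite mulr_ge0// ltW.
have := ler_wpM2l qd (E_geo k); rewrite mulrA; apply: le_trans.
apply: (le_trans _ (step k)); rewrite -addrA lerDl addr_ge0//.
  by rewrite mulr_ge0// ltW.
by rewrite mulr_ge0// mulr_ge0// ltW.
Qed.

(** The constraint equation expresses the coupling form of a velocity increment by the
    pressure increment. *)
Lemma constraint_geo mu : exists K, forall k,
  b (u k.+2 - u k.+1) mu ^+ 2 <= K * rho ^+ k.
Proof.
have [M sM] := sbd.
have M0 : 0 <= `|M| by exact: normr_ge0.
exists (2 * ((dt^-1) ^+ 2 + `|M|) * c mu mu * (q * dt * E 0%N)) => k.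
have [_ f1] := (hu k).2 0 mu subS.1; have [_ f2] := (hu k.+1).2 0 mu subS.1.
have := constraint_diff (Su _) (Su _) f1 f2.
set d := la k.+1 - la k; set x := b _ _; set y := c d mu; set z := s d mu => e.
have -> : x = - (dt^-1 * y + z).
  apply: (mulfI (lt0r_neq0 dt_gt0)); rewrite mulrN mulrDr mulrA mulfV ?lt0r_neq0//.
  by rewrite mul1r; lra.
have cm := semi_inner_ge0 hc (u := mu) I; have cd := semi_inner_ge0 hc (u := d) I.
have y2 : y ^+ 2 <= c d d * c mu mu by exact: (cauchy_schwarz subW hc).
have z2 : z ^+ 2 <= `|M| * (c d d * c mu mu).
  by apply: le_trans (sM d mu) _; rewrite ler_wpM2r ?mulr_ge0// ler_norm.
apply: (@le_trans _ _ (2 * ((dt^-1) ^+ 2 + `|M|) * c mu mu * c d d)).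
  have t2 : (dt^-1 * y) ^+ 2 <= (dt^-1) ^+ 2 * (c d d * c mu mu).
    by rewrite exprMn ler_wpM2l// sqr_ge0.
  have : 0 <= (dt^-1 * y - z) ^+ 2 by exact: sqr_ge0.
  rewrite sqrrN; nra.
rewrite -!mulrA !ler_wpM2l//; first by rewrite addr_ge0// sqr_ge0.
by have := c_geo k; rewrite -!mulrA.
Qed.

(** The velocities are Cauchy for the norm augmented by finitely many values of
    the coupling form, which the constraint equation bounds by the pressures; so
    the limit can be taken in the coupling form, which the plain norm need not
    control. *)
Lemma iteration_cvg : exists ul ll, [/\ nonlinear_problem ul ll,
  (fun k => B (u k - ul) (u k - ul)) @ \oo --> (0 : R) &
  (fun k => c (la k - ll) (la k - ll)) @ \oo --> (0 : R)].
Proof.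
have [J [w span]] := finW.
have [a ha] := choice (fun mu => span mu I).
pose B' x y := B x y + \sum_i b x (w i) * b y (w i).
have hB' : semi_inner S B'.
  split => [x y Sx Sy|y Sy t x1 x2 S1 S2|x Sx].
  - rewrite /B' (semi_innerC hB)//; congr (_ + _).
    by apply: eq_bigr => i _; rewrite mulrC.
  - rewrite /B' (semi_innerL hB)// mulrDr addrACA; congr (_ + _).
    rewrite mulr_sumr -big_split/=; apply: eq_bigr => i _.
    by rewrite blinl// mulrDl mulrA.
  - rewrite /B' addr_ge0 ?(semi_inner_ge0 hB)// sumr_ge0// => i _.
    by rewrite -expr2 sqr_ge0.
have [K hK] := choice (fun i => constraint_geo (w i)).
have [ul Sul ulB'] : exists2 l, S l &
    (fun k => B' (u k.+1 - l) (u k.+1 - l)) @ \oo --> (0 : R).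
  apply: (@fin_span_complete _ _ S B' (fun k => u k.+1) (E 0%N * rho + \sum_i K i) rho)
    => // k.
  rewrite mulrDl lerD//; first by rewrite -mulrA -exprS; exact: E_geo.
  rewrite mulr_suml ler_sum// => i _.
  by rewrite -expr2; exact: hK.
have [ll _ lc] : exists2 l, setT l & (fun k => c (la k - l) (la k - l)) @ \oo --> (0 : R).
  by apply: (@fin_span_complete _ _ setT c la (q * dt * E 0%N) rho).
have Bul : (fun k => B (u k.+1 - ul) (u k.+1 - ul)) @ \oo --> (0 : R).
  apply: (@le_cvg0 _ _ _ ulB') => k; apply/andP; split.
    by apply: (semi_inner_ge0 hB); exact: subspaceB.
  by rewrite lerDl; apply: sumr_ge0 => i _; rewrite -expr2 sqr_ge0.
have bul i : (fun k => b (u k.+1) (w i)) @ \oo --> b ul (w i).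
  apply: (@sqr_cvg _ _ _ 1 _ _ ulB') => k; rewrite mul1r -(linear_onB subS (blinl _))//.
  rewrite /B' (bigD1 i)//= -expr2 addrCA lerDl addr_ge0//.
    by apply: (semi_inner_ge0 hB); exact: subspaceB.
  by apply: sumr_ge0 => j _; rewrite -expr2 sqr_ge0.
have Bu0 : (fun k => B (u k - ul) (u k - ul)) @ \oo --> (0 : R).
  by rewrite -(cvg_shiftS (fun k => B (u k - ul) (u k - ul))).
exists ul, ll; split => //.
split => // v mu Sv; split.
  have [MX hX] := Xcont Sul Sv; have [MA hA] := Abd; have [Mb hb] := bbd Sv.
  have l1 : (fun k => X (u k) v) @ \oo --> X ul v.
    by apply: (@sqr_cvg _ _ _ MX (fun k => B (u k - ul) (u k - ul)));
      [exact: hX|exact: Bu0].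
  have l2 : (fun k => Lg * B (u k.+1 - u k) v) @ \oo --> Lg * 0.
    apply: cvgMl_tmp.
    apply: (@sqr_cvg _ _ _ (B v v * E 0%N) (fun k => rho ^+ k)) => [k|].
      rewrite subr0; apply: (le_trans (cauchy_schwarz subS hB (subspaceB subS (Su _) (Su _)) Sv)).
      rewrite mulrC -mulrA ler_wpM2l ?(semi_inner_ge0 hB)//; exact: E_geo.
    by apply: cvg_expr; case/andP: rho01 => r0 r1; rewrite ger0_norm.
  have l3 : (fun k => A (u k.+1) v) @ \oo --> A ul v.
    apply: (@sqr_cvg _ _ _ (MA * B v v) _ _ Bul) => k.
    rewrite -(linear_onB subS (Alin Sv))//.
    apply: (le_trans (hA _ _ (subspaceB subS (Su _) Sul) Sv)).
    by rewrite -mulrA [X in _ * X]mulrC.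
  have l4 : (fun k => b v (la k)) @ \oo --> b v ll.
    by apply: (@sqr_cvg _ _ _ Mb _ _ lc) => k; rewrite -(linear_onB subW (blinr Sv)).
  have l12 := seq_cvgD l1 l2.
  have l123 := seq_cvgD l12 l3.
  have lim := seq_cvgB l123 l4.
  rewrite (_ : X ul v + A ul v - b v ll = X ul v + Lg * 0 + A ul v - b v ll);
    last by rewrite mulr0 addr0.
  by apply: (cvg_cst_eq lim) => k /=; have [] := (hu k).2 v 0 Sv.
have [Ms hs] := sbd.
have c0 := semi_inner_ge0 hc (u := mu) I.
have l1 : (fun k => c (la k - lap) mu) @ \oo --> c (ll - lap) mu.
  apply: (@sqr_cvg _ _ _ (c mu mu) _ _ lc) => k.
  rewrite -(linear_onB subW (semi_innerL hc (w := mu) I))//.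
  rewrite opprB addrA subrK mulrC; exact: (cauchy_schwarz subW hc).
have l2 : (fun k => dt * b (u k.+1) mu) @ \oo --> dt * b ul mu.
  apply: cvgMl_tmp; rewrite (ha mu).
  have bE x : S x -> b x (\sum_i a mu i *: w i) = \sum_i a mu i * b x (w i).
    by move=> Sx; rewrite (linear_on_sum subW (blinr Sx)).
  apply/(@subr_cvg0 R R^o).
  rewrite (_ : (fun k => _) = fun k => \sum_i a mu i * (b (u k.+1) (w i) - b ul (w i))).
    apply: sum_cvg0 => i; rewrite -(mulr0 (a mu i)); apply: cvgMl_tmp.
    by apply/(@subr_cvg0 R R^o).
  apply/funext => k; rewrite !bE// -sumrB; apply: eq_bigr => i _.
  by rewrite mulrBr.
have l3 : (fun k => dt * s (la k) mu) @ \oo --> dt * s ll mu.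
  apply: cvgMl_tmp; apply: (@sqr_cvg _ _ _ (Ms * c mu mu) _ _ lc) => k.
  rewrite -(linear_onB subW (slin mu))//; apply: (le_trans (hs _ _)).
  by rewrite -mulrA [X in _ * X]mulrC.
have l12 := seq_cvgD l1 l2.
have lim := seq_cvgD l12 l3.
by apply: (cvg_cst_eq lim) => k /=; have [] := (hu k).2 0 mu subS.1.
Qed.

End convergence.
End linearised_iteration.

(** * Hausdorff measures of Borel sets and of cells *)

Section euclidean_norm.
Context {R : realType} {d : nat}.
Implicit Types x y z : 'cV[R]_d.

Lemma dotC x y : dot x y = dot y x.
Proof. by apply: eq_bigr => i _; rewrite mulrC. Qed.

Lemma dotL a x y z : dot (a *: x + y) z = a * dot x z + dot y z.
Proof.
rewrite /dot mulr_sumr -big_split/=; apply: eq_bigr => i _.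
by rewrite !mxE mulrDl mulrA.
Qed.

Lemma dot_ge0 x : 0 <= dot x x.
Proof. by apply: sumr_ge0 => i _; rewrite -expr2 sqr_ge0. Qed.

Lemma dot_semi_inner : semi_inner setT (@dot R d).
Proof.
split => [x y _ _|z _ a x y _ _|x _]; [exact: dotC|exact: dotL|exact: dot_ge0].
Qed.

Lemma enorm_ge0 x : 0 <= enorm x. Proof. exact: sqrtr_ge0. Qed.

Lemma enorm_sqr x : enorm x ^+ 2 = dot x x.
Proof. by rewrite sqr_sqrtr// dot_ge0. Qed.

Lemma dot_le x y : `|dot x y| <= enorm x * enorm y.
Proof.
rewrite -sqrtr_sqr -sqrtrM ?dot_ge0//; apply: ler_wsqrtr.
exact: (cauchy_schwarz subspaceT dot_semi_inner).
Qed.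

Lemma enormD x y : enorm (x + y) <= enorm x + enorm y.
Proof.
rewrite -(@ler_pXn2r _ 2)// ?nnegrE ?addr_ge0 ?enorm_ge0//.
rewrite enorm_sqr sqrrD !enorm_sqr -{1 2}(scale1r x).
rewrite dotL dotC dotL (dotC y (_ + _)) dotL !mul1r (dotC y x).
have := ler_norm (dot x y); have := dot_le x y; lra.
Qed.

Lemma enormN x : enorm (- x) = enorm x.
Proof.
by rewrite /enorm; congr Num.sqrt; apply: eq_bigr => i _; rewrite !mxE mulrNN.
Qed.

Lemma enorm_distC x y : enorm (x - y) = enorm (y - x).
Proof. by rewrite -enormN opprB. Qed.

Lemma enormZ a x : enorm (a *: x) = `|a| * enorm x.
Proof.
rewrite -sqrtr_sqr -sqrtrM ?sqr_ge0//; congr Num.sqrt.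
by rewrite /dot mulr_sumr; apply: eq_bigr => i _; rewrite !mxE; ring.
Qed.

Lemma enorm0 : enorm (0 : 'cV[R]_d) = 0.
Proof. by rewrite -(scale0r 0) enormZ normr0 mul0r. Qed.

Lemma enorm_coord x i : `|x i 0| <= enorm x.
Proof.
rewrite -sqrtr_sqr; apply: ler_wsqrtr.
rewrite /dot (bigD1 i)//= -expr2 lerDl sumr_ge0// => j _.
by rewrite -expr2 sqr_ge0.
Qed.

Lemma enorm_le_sum x : enorm x <= \sum_i `|x i 0|.
Proof.
rewrite -(@ler_pXn2r _ 2)// ?nnegrE ?enorm_ge0 ?sumr_ge0//.
rewrite enorm_sqr /dot expr2 mulr_suml; apply: ler_sum => i _.
rewrite (le_trans (ler_norm _))// normrM ler_wpM2l//.
by rewrite (bigD1 i)//= lerDl sumr_ge0.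
Qed.

End euclidean_norm.

Section enorm_topology.
Context {R : realType} {n : nat}.
Implicit Types x y : 'cV[R]_n.+1.

(** The topology is that of the max norm, the Hausdorff measures use the Euclidean one. *)
Lemma normr_le_enorm x : `|x| <= enorm x.
Proof.
rewrite [leLHS]mx_normrE; apply: bigmax_le => [|[i j] _]; first exact: enorm_ge0.
by rewrite /= ord1 enorm_coord.
Qed.

Lemma open_enorm (U : set 'cV[R]_n.+1) x : open U -> U x ->
  exists2 e : R, 0 < e & forall y, enorm (x - y) < e -> U y.
Proof.
move=> oU Ux; have /nbhs_normP[e /= e0 eU] := open_nbhs_nbhs (conj oU Ux).
by exists e => // y xy; apply: eU; rewrite /= (le_lt_trans (normr_le_enorm _)).
Qed.

End enorm_topology.

Section metric_outer_measure.
Context {R : realType} {d : nat} (k : nat).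
Local Notation X := 'cV[R]_d.
Local Open Scope ereal_scope.

Lemma hausdorff_pre_anti (d1 d2 : R) (A : set X) : (d1 <= d2)%R ->
  hausdorff_pre k d2 A <= hausdorff_pre k d1 A.
Proof.
move=> d12; apply: ereal_inf_le_tmp => _ [U [AU dU] <-]; exists U => //; split => //.
by move=> j x y Ux Uy; exact: le_trans (dU _ _ _ Ux Uy) d12.
Qed.

(** A set of diameter less than the distance of A and B cannot meet both, so a fine
    cover of the union splits into a cover of A and a cover of B. *)
Lemma hausdorff_pre_separated (e delta : R) (A B : set X) : (delta < e)%R ->
  (forall x y, A x -> B y -> (e <= enorm (x - y))%R) ->
  hausdorff_pre k delta A + hausdorff_pre k delta B <= hausdorff_pre k delta (A `|` B).
Proof.
move=> de sep; apply: le_ereal_inf_tmp => _ [U [ABU dU] <-].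
pose P (C : set X) j := if `[< (C `&` U j) !=set0 >] then U j else set0.
have cP (C : set X) : C `<=` A `|` B -> fine_cover delta C (P C).
  move=> CAB; split.
    move=> x Cx; have [j _ Ujx] := ABU _ (CAB _ Cx); exists j => //.
    by rewrite /P asboolT//; exists x.
  by move=> j x y; rewrite /P; case: ifP => // _; exact: dU.
apply: (@le_trans _ _ (\sum_(j <oo) hausdorff_gauge k (P A j) +
                       \sum_(j <oo) hausdorff_gauge k (P B j))).
  by apply: leeD; apply: ereal_inf_lbound;
    [exists (P A)|exists (P B)] => //; apply: cP; [exact: subsetUl|exact: subsetUr].
rewrite -nneseriesD; try by move=> *; exact: hausdorff_gauge_ge0.
apply: lee_nneseries => [j _ _|j _].
  by rewrite adde_ge0 ?hausdorff_gauge_ge0.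
rewrite /P; case: asboolP => [[x [Ax Ux]]|_]; case: asboolP => [[y [By Uy]]|_].
- have := dU _ _ _ Ux Uy; have := sep _ _ Ax By => h1 h2.
  by have := lt_le_trans de (le_trans h1 h2); rewrite ltxx.
- by rewrite hausdorff_gauge0 adde0.
- by rewrite hausdorff_gauge0 add0e.
- by rewrite hausdorff_gauge0 add0e hausdorff_gauge_ge0.
Qed.

Lemma hausdorff_separated (e : R) (A B : set X) : (0 < e)%R ->
  (forall x y, A x -> B y -> (e <= enorm (x - y))%R) ->
  hausdorff k A + hausdorff k B <= hausdorff k (A `|` B).
Proof.
move=> e0 sep.
have H (d1 d2 : R) : (0 < d1)%R -> (0 < d2)%R ->
    hausdorff_pre k d1 A + hausdorff_pre k d2 B <= hausdorff k (A `|` B).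
  move=> d10 d20; pose dl := (Num.min (e / 2) (Num.min d1 d2))%R.
  have dl0 : (0 < dl)%R by rewrite !lt_min d10 d20 divr_gt0.
  apply: (@le_trans _ _ (hausdorff_pre k dl (A `|` B))); last first.
    by apply: ereal_sup_ubound; exists dl.
  apply: le_trans (@hausdorff_pre_separated e dl A B _ sep); last first.
    by rewrite gt_min ltr_pdivrMr// ltr_pMr// ltrDl ltr01.
  by apply: leeD; apply: hausdorff_pre_anti; rewrite !ge_min lexx ?orbT.
have [->|fin] := eqVneq (hausdorff k (A `|` B)) +oo; first by rewrite leey.
have finU : hausdorff k (A `|` B) \is a fin_num.
  by rewrite ge0_fin_numE ?hausdorff_ge0// ltey.
have pre_fin (dl : R) (C : set X) : (0 < dl)%R -> C `<=` A `|` B ->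
    hausdorff_pre k dl C \is a fin_num.
  move=> dl0 CAB; rewrite ge0_fin_numE ?hausdorff_pre_ge0//.
  apply: (@le_lt_trans _ _ (hausdorff k (A `|` B))); last by rewrite ltey.
  by apply: (le_trans (le_hausdorff_pre k dl CAB)); apply: ereal_sup_ubound; exists dl.
have finA : hausdorff k A \is a fin_num.
  rewrite ge0_fin_numE ?hausdorff_ge0// (@le_lt_trans _ _ (hausdorff k (A `|` B)))//.
    by apply: le_hausdorff; exact: subsetUl.
  by rewrite ltey.
rewrite addeC -leeBrDr//; apply: ge_ereal_sup => _ [d2 d20 <-].
have finB : hausdorff_pre k d2 B \is a fin_num by apply: pre_fin => //; exact: subsetUr.
rewrite leeBrDr// addeC -leeBrDr//.
by apply: ge_ereal_sup => _ [d1 d10 <-]; rewrite leeBrDr// H.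
Qed.

Let far (A F : set X) (n : nat) : set X :=
  A `&` [set x | forall y, F y -> (n.+1%:R^-1 <= enorm (x - y))%R].

Let far_sub A F n : far A F n `<=` far A F n.+1.
Proof.
move=> x [Ax h]; split => // y Fy; apply: le_trans (h _ Fy).
by rewrite lef_pV2 ?posrE// ler_nat.
Qed.

(* the layer between the n-th and the next set is at positive distance from the
   (n-1)-st set *)
Let far_ring A F n :
  hausdorff k (far A F n.+2 `\` far A F n.+1) + hausdorff k (far A F n)
    <= hausdorff k (far A F n.+2).
Proof.
apply: (@le_trans _ _ (hausdorff k ((far A F n.+2 `\` far A F n.+1) `|` far A F n))).
  apply: (@hausdorff_separated (n.+1%:R^-1 - n.+2%:R^-1)).
    by rewrite subr_gt0 ltf_pV2 ?posrE// ltr_nat.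
  move=> x z [[Ax _] nx] [Az hz].
  have [y Fy xy] : exists2 y, F y & (enorm (x - y) < n.+2%:R^-1)%R.
    apply: contrapT => h; apply: nx; split => // y Fy.
    by rewrite leNgt; apply/negP => xy; apply: h; exists y.
  have h1 : (n.+1%:R^-1 <= enorm (z - y))%R by exact: hz.
  have h2 : (enorm (z - y) <= enorm (x - z) + enorm (x - y))%R.
    by rewrite (enorm_distC x z); have := enormD (z - x) (x - y); rewrite addrA subrK.
  by rewrite lerBlDr (le_trans h1)// (le_trans h2)// lerD2l ltW.
apply: le_hausdorff; rewrite subUset; split; first exact: subDsetl.
by apply: subset_trans; [exact: far_sub|exact: far_sub].
Qed.

(** Carathéodory's criterion. The set A minus F is exhausted by the points of A at
    distance at least 1/n of F; the layers between these sets have summable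
    measures, because each one is at positive distance from all
    but the last of the preceding ones. *)
Lemma closed_caratheodory (F : set X) :
  (forall x, ~ F x -> exists2 e : R, (0 < e)%R & forall y, F y -> (e <= enorm (x - y))%R) ->
  (hausdorff_outer k).-caratheodory F.
Proof.
move=> cF; apply: le_caratheodory_measurable => A.
rewrite /hausdorff_outer /=.
have [->|Afin] := eqVneq (hausdorff k A) +oo; first by rewrite leey.
have Alt : hausdorff k A < +oo by rewrite ltey.
have farA n : hausdorff k (far A F n) <= hausdorff k A.
  by apply: le_hausdorff; exact: subIsetl.
pose r n := hausdorff k (far A F n.+1 `\` far A F n).
have r_ge0 n : 0 <= r n by exact: hausdorff_ge0.
have rsum n : \sum_(0 <= j < n) r j.+1 <=
    hausdorff k (far A F n) + hausdorff k (far A F n.+1).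
  elim: n => [|n IH].
    by rewrite big_geq// adde_ge0 ?hausdorff_ge0.
  rewrite big_nat_recr//=; apply: (le_trans (leeD2r _ IH)).
  rewrite addeAC addeC; apply: leeD => //.
  by rewrite addeC; exact: far_ring.
have rfin : \sum_(0 <= j <oo) r j.+1 < +oo.
  apply: (@le_lt_trans _ _ (hausdorff k A + hausdorff k A)).
    apply: lime_le; first by apply: is_cvg_nneseries.
    by apply: nearW => n; apply: (le_trans (rsum n)); exact: leeD.
  by rewrite lte_add_pinfty.
have key n : hausdorff k (A `&` F) + hausdorff k (A `&` ~` F) <=
    hausdorff k A + \sum_(n <= j <oo) r j.+1.
  pose B j := if (n <= j)%N then far A F j.+2 `\` far A F j.+1 else set0.
  have -> : \sum_(n <= j <oo) r j.+1 = \sum_(0 <= j <oo) hausdorff k (B j).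
    rewrite eseries_cond eseries_mkcond; apply: eq_eseriesr => j _ /=.
    by rewrite /B; case: ifP => // _; rewrite hausdorff0.
  apply: (@le_trans _ _ (hausdorff k (A `&` F) + (hausdorff k (far A F n.+1) +
      \sum_(0 <= j <oo) hausdorff k (B j)))).
    apply: leeD => //.
    apply: (@le_trans _ _ (hausdorff k (far A F n.+1 `|` \bigcup_j B j))).
      apply: le_hausdorff => x [Ax nFx].
      have [e e0 he] := cF _ nFx.
      have [N hN] : exists N, far A F N x.
        have [N _ hN] := near_infty_natSinv_lt (PosNum e0).
        exists N; split => // y Fy; apply: le_trans (he _ Fy).
        by apply: ltW; apply: hN => /=.
      have [nN|] := boolP (`[< far A F n.+1 x >]); first by left; exact/asboolP.
      move=> /asboolP nx; right.
      have [j [nj]] : exists j, [/\ (n <= j)%N, far A F j.+2 x & ~ far A F j.+1 x].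
        pose Q j := `[< far A F (n.+1 + j) x >].
        have Q0 : exists j, Q j.
          exists N; apply/asboolP.
          have mono i l : far A F i x -> far A F (i + l)%N x.
            by move=> h; elim: l => [|l IH]; rewrite ?addn0// addnS; exact: far_sub.
          by rewrite addnC; exact: mono.
        case: (ex_minnP Q0) => -[|j] /asboolP Qj jmin.
          by exfalso; apply: nx; rewrite addn0 in Qj.
        exists (n + j)%N; split; first exact: leq_addr.
          by move: Qj; rewrite addSn addnS.
        move=> h; have := jmin j; rewrite ltnn => /(_ _)/negP; apply => //.
        by apply/asboolP; rewrite addSn.
      by move=> h1 h2; exists j => //; rewrite /B nj.
    have := outer_measure_sigma_subadditive (hausdorff_outer k) B.
    move=> sB; apply: (le_trans (outer_measureU2 (hausdorff_outer k) _ _)).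
    exact: leeD.
  rewrite addeA leeD2r//.
  apply: (@le_trans _ _ (hausdorff k ((A `&` F) `|` far A F n.+1))).
    apply: (@hausdorff_separated (n.+2%:R^-1)) => [|y x [_ Fy] [_ hx]].
      by rewrite invr_gt0.
    by rewrite enorm_distC; exact: hx.
  by apply: le_hausdorff; rewrite subUset; split; exact: subIsetl.
have tail : \sum_(n <= j <oo) r j.+1 @[n --> \oo] --> 0 by exact: nneseries_tail_cvg.
have lim : hausdorff k A + \sum_(n <= j <oo) r j.+1 @[n --> \oo] --> hausdorff k A + 0.
  apply: cvgeD => //; last exact: cvg_cst.
  by rewrite fin_num_adde_defl.
rewrite adde0 in lim.
rewrite -(cvg_lim _ lim)//; apply: lime_ge; first by apply: cvgP lim.
by apply: nearW.
Qed.

End metric_outer_measure.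

Section cell_measure.
Context {R : realType} {m : nat}.
Local Notation X := 'cV[R]_m.+1.

Lemma ball_volume_ge0 k : 0 <= ball_volume k :> R.
Proof.
suff : 0 <= ball_volume k :> R /\ 0 <= ball_volume k.+1 :> R by case.
elim: k => [|k [h1 h2]]; first by split.
split => //; rewrite [ball_volume k.+2]/=.
by rewrite !mulr_ge0 ?invr_ge0 ?pi_ge0.
Qed.

Lemma subdivision (N : nat) (t : R) : 0 <= t <= 1 ->
  exists i : 'I_N.+1, i%:R / N.+1%:R <= t <= i.+1%:R / N.+1%:R.
Proof.
move=> /andP[t0 t1].
have N0 : 0 < N.+1%:R :> R by rewrite ltr0n.
have [/eqP t1'|t1'] := boolP (t == 1).
  by exists ord_max => /=; rewrite t1' ler_pdivrMr// ler_pdivlMr// !mul1r ler_nat leqnSn lexx.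
have tN0 : 0 <= t * N.+1%:R by rewrite mulr_ge0.
have /andP[h1 h2] := truncn_itv tN0.
have iN : (Num.truncn (t * N.+1%:R) < N.+1)%N.
  rewrite -(ltr_nat R); apply: (le_lt_trans h1).
  by rewrite gtr_pMl// lt_neqAle t1' t1.
exists (Ordinal iN) => /=.
by rewrite ler_pdivrMr// ler_pdivlMr// h1 ltW.
Qed.

Lemma enorm_mulmx_le k (E : 'M[R]_(m.+1, k)) (s : 'cV[R]_k) (e : R) :
  (forall j, `|s j 0| <= e) -> enorm (E *m s) <= (\sum_i \sum_j `|E i j|) * e.
Proof.
move=> se; apply: (le_trans (enorm_le_sum _)); rewrite mulr_suml.
apply: ler_sum => i _; rewrite mxE (le_trans (ler_norm_sum _ _ _))// mulr_suml.
by apply: ler_sum => j _; rewrite normrM ler_wpM2l.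
Qed.

Lemma cell_param_unit k (c : @cell R m k) (t : 'cV[R]_k) :
  (forall j, 0 <= t j 0) ->
  (if simplex c then (\sum_j t j 0 <= 1 : Prop) else forall j, t j 0 <= 1) ->
  forall j, 0 <= t j 0 <= 1.
Proof.
move=> t0 t1 j; rewrite t0/=; move: t1; case: simplex => // t1.
by apply: le_trans t1; rewrite (bigD1 j)//= lerDl sumr_ge0.
Qed.

Local Open Scope ereal_scope.

(** Subdividing the parameters into N^k cubes gives covers of mesh O(1/N) and of
    bounded total gauge. *)
Lemma hausdorff_cell_lt k (c : @cell R m k) : hausdorff k (cell_set c) < +oo.
Proof.
pose L := (\sum_i \sum_j `|edg c i j|)%R.
have L0 : (0 <= L)%R by apply: sumr_ge0 => i _; exact: sumr_ge0.
pose V := (ball_volume k * (L / 2) ^+ k)%R : R.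
apply: (@le_lt_trans _ _ V%:E); last by rewrite ltry.
apply: ge_ereal_sup => _ [delta /= d0 <-].
have [N hN] : exists N, (L / N.+1%:R <= delta)%R.
  exists (Num.truncn (L / delta)); rewrite ler_pdivrMr ?ltr0n// mulrC -ler_pdivrMr//.
  by have /andP[_ /ltW] := truncn_itv (divr_ge0 L0 (ltW d0)).
have N0 : (0 < N.+1%:R :> R)%R by rewrite ltr0n.
pose T := {ffun 'I_k -> 'I_N.+1}.
pose U (f : T) := [set x : X | exists t : 'cV[R]_k, x = (org c + edg c *m t)%R /\
  forall j, ((f j)%:R / N.+1%:R <= t j 0 <= (f j).+1%:R / N.+1%:R)%R].
pose U' j := if insub j is Some i then U (enum_val (i : 'I_#|T|)) else set0.
have dU f x y : U f x -> U f y -> (enorm (x - y) <= L / N.+1%:R)%R.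
  move=> [t [-> ht]] [s [-> hs]].
  rewrite opprD addrACA subrr add0r -mulmxBr; apply: enorm_mulmx_le => j.
  have /andP[t1 t2] := ht j; have /andP[s1 s2] := hs j.
  rewrite !mxE ler_norml; move: t1 t2 s1 s2; rewrite -[(f j).+1%:R%R]natr1 mulrDl mul1r.
  move: (_ / _)%R => a; move: (_^-1)%R => h t1 t2 s1 s2; apply/andP; split; lra.
have gU f : hausdorff_gauge k (U f) <= (ball_volume k * (L / N.+1%:R / 2) ^+ k)%R%:E.
  apply: ge_ereal_sup => e [->|[x [y [Ux Uy ->]]]].
    by rewrite lee_fin mulr_ge0 ?ball_volume_ge0 ?exprn_ge0 ?divr_ge0// ltW.
  rewrite lee_fin ler_wpM2l ?ball_volume_ge0// lerXn2r ?nnegrE//.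
  - by rewrite divr_ge0 ?enorm_ge0.
  - by rewrite divr_ge0// divr_ge0// ltW.
  - by rewrite ler_pM2r ?invr_gt0//; exact: dU Ux Uy.
apply: (@le_trans _ _ (\sum_(j <oo) hausdorff_gauge k (U' j))).
  apply: ereal_inf_lbound; exists U' => //; split.
    move=> x [t [-> t0 t1]]; have tu := cell_param_unit t0 t1.
    have [f hf] := choice (fun j => subdivision N (tu j)).
    exists (enum_rank [ffun j => f j]) => //.
    rewrite /U' insubT/= => [|lt]; first exact: ltn_ord.
    rewrite (_ : Sub _ _ = enum_rank [ffun j => f j]); last exact: val_inj.
    rewrite enum_rankK; exists t; split => // j; rewrite ffunE; exact: hf.
  move=> j x y; rewrite /U'; case: insubP => // i _ _ Ux Uy.
  by apply: le_trans hN; exact: dU Ux Uy.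
rewrite (@nneseries_split _ _ 0%N #|T|)//; last by move=> *; exact: hausdorff_gauge_ge0.
rewrite add0n [X in _ + X]eseries0 ?adde0; last first.
  move=> j Tj _; rewrite /U' insubF ?hausdorff_gauge0//.
  by apply/negbTE; rewrite -leqNgt.
apply: (@le_trans _ _ (\sum_(0 <= j < #|T|) (ball_volume k * (L / N.+1%:R / 2) ^+ k)%R%:E)).
  apply: lee_sum => j _; rewrite /U'; case: insubP => [i _ _|_]; first exact: gU.
  by rewrite hausdorff_gauge0 lee_fin mulr_ge0 ?ball_volume_ge0 ?exprn_ge0 ?divr_ge0// ltW.
rewrite sumEFin lee_fin sumr_const_nat subn0 card_ffun !card_ord.
rewrite -[leLHS]mulr_natr natrX /V -[leLHS]mulrA ler_wpM2l ?ball_volume_ge0//.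
rewrite -exprMn; have -> : (L / N.+1%:R / 2 * N.+1%:R = L / 2)%R by field; rewrite gt_eqF.
by [].
Qed.

End cell_measure.

Section borel_sets.
Context {R : realType} {n : nat} (k : nat).
Local Notation X := 'cV[R]_n.+1.
Local Notation cX := (caratheodory_type (@hausdorff_outer R n.+1 k)).

Lemma closed_hmeasurable (F : set X) : closed F -> measurable (F : set cX).
Proof.
move=> cF; apply: closed_caratheodory => x nFx.
have [e e0 he] := open_enorm (closed_openC cF) nFx.
by exists e => // y Fy; rewrite leNgt; apply/negP => /he; exact.
Qed.

Lemma open_hmeasurable (U : set X) : open U -> measurable (U : set cX).
Proof.
move=> oU; rewrite -(setCK U); apply: (@measurableC _ cX).
by apply: closed_hmeasurable; exact: open_closedC.
Qed.

Lemma within_continuous_hmeasurable (D : set X) (f : X -> R) :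
  measurable (D : set cX) -> {within D, continuous f} -> measurable_on k D f.
Proof.
move=> mD /continuousP cf; apply: (measurability _ (RGenOpens.measurableE R)).
move=> _ [_ [a [b ->] <-]].
have /open_subspaceP[V oV VD] : open (f @^-1` `]a, b[ : set (subspace D)).
  by apply: cf; exact: interval_open.
rewrite setIC -VD; apply: (@measurableI _ cX) => //; exact: open_hmeasurable.
Qed.

Lemma continuous_hmeasurable (D : set X) (f : X -> R) :
  measurable (D : set cX) -> continuous f -> measurable_on k D f.
Proof.
by move=> mD cf; apply: within_continuous_hmeasurable => //; exact: continuous_subspaceT.
Qed.

End borel_sets.

(** * Integration of essentially bounded functions *)

Section almost_everywhere.
Context {d : measure_display} {T : measurableType d} {R : realType}.
Variables (mu : {measure set T -> \bar R}).

Lemma ae_imply (D D' : set T) (P Q : T -> Prop) : D' `<=` D ->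
  {ae mu, forall x, D x -> P x} -> (forall x, D' x -> P x -> Q x) ->
  {ae mu, forall x, D' x -> Q x}.
Proof. by move=> DD hP PQ; apply: filterS hP => x h D'x; apply: PQ => //; exact/h/DD. Qed.

End almost_everywhere.

Section essentially_bounded.
Context {d : measure_display} {T : measurableType d} {R : realType}.
Variables (mu : {measure set T -> \bar R}) (D : set T).
Implicit Types f g : T -> R.

(** On a set of finite measure these functions are integrable and, unlike the integrable
    ones, stable under products: the integrands of all the forms belong to this
    class. *)
Definition ess_bounded f := measurable_fun D f /\
  exists M, {ae mu, forall x, D x -> `|f x| <= M}.

Lemma bounded_ess_bounded f M : measurable_fun D f ->
  (forall x, D x -> `|f x| <= M) -> ess_bounded f.
Proof. by move=> mf fM; split => //; exists M; apply: aeW. Qed.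

Lemma ess_bounded_cst r : ess_bounded (fun=> r).
Proof. by apply: (@bounded_ess_bounded _ `|r|) => //; exact: measurable_cst. Qed.

Lemma eq_ess_bounded f g : measurable D -> (forall x, D x -> f x = g x) ->
  ess_bounded f -> ess_bounded g.
Proof.
move=> mD fg [mf [M fM]]; split.
  by apply: eq_measurable_fun mf => x; rewrite inE => Dx; rewrite fg.
by exists M; apply: filterS fM => x h Dx; rewrite -fg//; exact: h.
Qed.

Lemma ess_boundedD f g : ess_bounded f -> ess_bounded g ->
  ess_bounded (fun x => f x + g x).
Proof.
move=> [mf [M fM]] [mg [N gN]]; split; first exact: measurable_funD.
exists (M + N); apply: filterS2 fM gN => x fM gN Dx.
by rewrite (le_trans (ler_normD _ _))// lerD ?fM ?gN.
Qed.

Lemma ess_boundedM f g : ess_bounded f -> ess_bounded g ->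
  ess_bounded (fun x => f x * g x).
Proof.
move=> [mf [M fM]] [mg [N gN]]; split; first exact: measurable_funM.
exists (M * N); apply: filterS2 fM gN => x fM gN Dx.
by rewrite normrM ler_pM ?fM ?gN.
Qed.

Lemma ess_boundedZ a f : ess_bounded f -> ess_bounded (fun x => a * f x).
Proof. by move=> bf; apply: ess_boundedM => //; exact: ess_bounded_cst. Qed.

Lemma ess_boundedB f g : ess_bounded f -> ess_bounded g ->
  ess_bounded (fun x => f x - g x).
Proof.
move=> bf bg; have := ess_boundedD bf (ess_boundedZ (-1) bg).
by under eq_fun do rewrite mulN1r.
Qed.

Lemma ess_bounded_sum (I : Type) (r : seq I) (f : I -> T -> R) :
  (forall i, ess_bounded (f i)) -> ess_bounded (fun x => \sum_(i <- r) f i x).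
Proof.
move=> bf; elim: r => [|i r IH].
  by under eq_fun do rewrite big_nil; exact: ess_bounded_cst.
by under eq_fun do rewrite big_cons; exact: ess_boundedD.
Qed.

Hypotheses (mD : measurable D) (muD : (mu D < +oo)%E).

Lemma ess_bounded_integrable f : ess_bounded f -> mu.-integrable D (EFin \o f).
Proof.
move=> [mf [M fM]]; apply/integrableP; split; first exact/measurable_EFinP.
apply: (@le_lt_trans _ _ (`|M|%:E * mu D)%E).
  apply: integral_le_bound => //; first exact/measurable_EFinP.
  apply: filterS fM => x h Dx /=; rewrite lee_fin (le_trans (h Dx))//; exact: ler_norm.
by apply: lte_mul_pinfty => //; rewrite lee_fin.
Qed.

Lemma Rintegral_linear a f g : ess_bounded f -> ess_bounded g ->
  \int[mu]_(x in D) (a * f x + g x) =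
  a * \int[mu]_(x in D) f x + \int[mu]_(x in D) g x.
Proof.
move=> bf bg; rewrite RintegralD//; try by apply: ess_bounded_integrable => //; exact: ess_boundedZ.
by rewrite RintegralZl//; exact: ess_bounded_integrable.
Qed.

(** Such a function coincides almost everywhere with its absolute value. *)
Lemma Rintegral_ge0_ae f : ess_bounded f -> {ae mu, forall x, D x -> 0 <= f x} ->
  0 <= \int[mu]_(x in D) f x.
Proof.
move=> [mf _] f0.
have -> : \int[mu]_(x in D) f x = \int[mu]_(x in D) `|f x|.
  rewrite /Rintegral; congr fine; apply: ae_eq_integral => //.
  - exact/measurable_EFinP.
  - by apply/measurable_EFinP; exact: measurableT_comp.
  - by apply: filterS f0 => x h Dx /=; rewrite ger0_norm// h.
by apply: Rintegral_ge0.
Qed.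

Lemma le_Rintegral_ae f g : ess_bounded f -> ess_bounded g ->
  {ae mu, forall x, D x -> f x <= g x} ->
  \int[mu]_(x in D) f x <= \int[mu]_(x in D) g x.
Proof.
move=> bf bg fg; rewrite -subr_ge0 -RintegralB//; try exact: ess_bounded_integrable.
apply: Rintegral_ge0_ae; first exact: ess_boundedB.
by apply: filterS fg => x h Dx; rewrite subr_ge0 h.
Qed.

End essentially_bounded.

Section scalar_products.
Context {R : realType} {n : nat} (k : nat).
Local Notation X := 'cV[R]_n.+1.
Local Notation cX := (caratheodory_type (@hausdorff_outer R n.+1 k)).
Variable D : set X.

Definition ebd (f : X -> R) := @ess_bounded _ cX R (hmeasure k) D f.
Definition vebd (u : X -> X) := forall j, ebd (fun x => u x j 0).

Hypotheses (mD : measurable (D : set cX)) (fD : (hausdorff k D < +oo)%E).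

Definition hmeasure_int_linear := @Rintegral_linear _ cX R (hmeasure k) D mD fD.
Definition hmeasure_int_ge0 := @Rintegral_ge0_ae _ cX R (hmeasure k) D mD.
Definition le_hmeasure_int := @le_Rintegral_ae _ cX R (hmeasure k) D mD fD.

Lemma hmeasure_int_scale a f : ebd f ->
  \int[hmeasure k]_(x in D) (a * f x) = a * \int[hmeasure k]_(x in D) f x.
Proof.
move=> bf; apply: (@RintegralZl _ cX R (hmeasure k) D f a mD).
exact: (@ess_bounded_integrable _ cX R (hmeasure k) D mD fD).
Qed.

Lemma ebd_subspace : is_subspace (ebd : set (X -> R^o)).
Proof.
split; first exact: ess_bounded_cst.
by move=> a u v bu bv; apply: ess_boundedD => //; exact: ess_boundedZ.
Qed.

Lemma vebd_subspace : is_subspace (vebd : set (X -> X)).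
Proof.
split => [j|a u v bu bv j].
  have : ebd (fun=> 0) by exact: ess_bounded_cst.
  by apply: eq_ess_bounded => // x _; rewrite (_ : (0 : X -> X) x = 0)// mxE.
have : ebd (fun x => a * u x j 0 + v x j 0).
  by apply: ess_boundedD; [apply: ess_boundedZ; exact: bu|exact: bv].
by apply: eq_ess_bounded => // x _; rewrite (_ : (_ + _) x = a *: u x + v x)// !mxE.
Qed.

Lemma ebd_dot u v : vebd u -> vebd v -> ebd (fun x => dot (u x) (v x)).
Proof.
move=> bu bv; apply: ess_bounded_sum => i.
by apply: ess_boundedM; [exact: bu|exact: bv].
Qed.

Lemma ip_semi_inner : semi_inner (ebd : set (X -> R^o)) (ip k D).
Proof.
split => [f g _ _|h bh a f g bf bg|f bf].
- by apply: eq_Rintegral => x _; rewrite mulrC.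
- apply: (etrans _ (hmeasure_int_linear a (ess_boundedM bf bh) (ess_boundedM bg bh))).
  by apply: eq_Rintegral => x _; rewrite mulrA -mulrDl.
- by apply: Rintegral_ge0 => x _; rewrite -expr2 sqr_ge0.
Qed.

Lemma vip_semi_inner : semi_inner (vebd : set (X -> X)) (vip k D).
Proof.
split => [f g _ _|h bh a f g bf bg|f bf].
- by apply: eq_Rintegral => x _; rewrite dotC.
- apply: (etrans _ (hmeasure_int_linear a (ebd_dot bf bh) (ebd_dot bg bh))).
  by apply: eq_Rintegral => x _; rewrite -dotL.
- by apply: Rintegral_ge0 => x _; exact: dot_ge0.
Qed.

Lemma vip_bilinear (M : (X -> X) -> X -> X) w :
  (forall a u v x, D x -> M (a *: u + v) x = a *: M u x + M v x) ->
  (forall u, vebd u -> vebd (M u)) -> vebd w ->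
  linear_on (vebd : set (X -> X)) (fun u => vip k D (M u) w).
Proof.
move=> Mlin Mb bw a u v bu bv.
apply: (etrans _ (hmeasure_int_linear a (ebd_dot (Mb _ bu) bw) (ebd_dot (Mb _ bv) bw))).
by apply: eq_Rintegral => x; rewrite inE => Dx; rewrite Mlin// dotL.
Qed.

End scalar_products.

(** * Raviart-Thomas fields *)

Section linear_derivative.
Context {R : realType} {n : nat}.

Lemma derive_affine (f : 'cV[R]_n.+1 -> R) (x w : 'cV[R]_n.+1) (l : R) :
  (forall h, f (h *: w + x) = h * l + f x) -> 'D_w f x = l.
Proof.
move=> fl; rewrite /derive; apply: cvg_lim => //.
apply: cvg_near_cst; near=> h => /=.
have h0 : h != 0 by near: h; exact: nbhs_dnbhs_neq.
by rewrite fl addrK /GRing.scale/= mulrA mulVf// mul1r.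
Unshelve. all: by end_near. Qed.

End linear_derivative.

Section raviart_thomas.
Context {R : realType} {m k : nat}.
Local Notation X := 'cV[R]_m.+1.
Implicit Types (c : @cell R m k) (a b : 'cV[R]_k) (x : X).

(** The element of the local space RT0 with parameters a and b. *)
Definition rt c a b (x : X) : X := edg c *m (a + \col_j (b j 0 * loc c x j 0)).

(* the reference coordinates of a direction *)
Definition locdir c (w : X) : 'cV[R]_k :=
  invmx ((edg c)^T *m edg c) *m ((edg c)^T *m w).

(** The divergence of rt c a b, a constant. *)
Definition rtdiv c b : R :=
  \sum_j (edg c *m \col_l (b l 0 * locdir c (e_ j) l 0)) j 0.

Lemma locD c h w x : loc c (h *: w + x) = h *: locdir c w + loc c x.
Proof.
by rewrite /loc /locdir -addrA mulmxDr -!scalemxAr mulmxDr -scalemxAr.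
Qed.

Lemma rt_shift c a b h w x :
  rt c a b (h *: w + x) = h *: (edg c *m \col_l (b l 0 * locdir c w l 0)) + rt c a b x.
Proof.
rewrite /rt locD [in RHS]scalemxAr -mulmxDr; congr (_ *m _).
by apply/colP => l; rewrite !mxE; ring.
Qed.

Lemma divergence_rt c a b x : divergence (rt c a b) x = rtdiv c b.
Proof.
apply: eq_bigr => j _; apply: derive_affine => h.
by rewrite rt_shift !mxE.
Qed.

Lemma rt_linear c t a1 b1 a2 b2 :
  t *: rt c a1 b1 + rt c a2 b2 = rt c (t *: a1 + a2) (t *: b1 + b2).
Proof.
apply/funext => x; rewrite (_ : (_ + _) x = t *: rt c a1 b1 x + rt c a2 b2 x)//.
rewrite /rt scalemxAr -mulmxDr; congr (_ *m _).
by apply/colP => l; rewrite !mxE; ring.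
Qed.

Lemma rtdiv_linear c t b1 b2 : rtdiv c (t *: b1 + b2) = t * rtdiv c b1 + rtdiv c b2.
Proof.
rewrite /rtdiv mulr_sumr -big_split/=; apply: eq_bigr => j _.
rewrite !mxE mulr_sumr -big_split/=; apply: eq_bigr => l _.
by rewrite !mxE; ring.
Qed.

(** The parameters in the canonical basis: the local space is finitely generated. *)
Lemma rt_span c a b : rt c a b = \sum_(s : 'I_k + 'I_k)
  (match s with inl j => a j 0 | inr j => b j 0 end) *:
  (match s with inl j => rt c (delta_mx j 0) 0 | inr j => rt c 0 (delta_mx j 0) end).
Proof.
have rt0 : rt c 0 0 = 0.
  apply/funext => x; rewrite /rt (_ : _ + _ = 0) ?mulmx0//.
  by apply/colP => l; rewrite !mxE mul0r addr0.
have rtZ t a1 b1 : t *: rt c a1 b1 = rt c (t *: a1) (t *: b1).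
  by rewrite -[LHS]addr0 -rt0 rt_linear !addr0.
have rtD a1 b1 a2 b2 : rt c a1 b1 + rt c a2 b2 = rt c (a1 + a2) (b1 + b2).
  by rewrite -[in LHS](scale1r (rt c a1 b1)) rt_linear !scale1r.
have rt_sum (F G : 'I_k -> 'cV[R]_k) :
    \sum_j rt c (F j) (G j) = rt c (\sum_j F j) (\sum_j G j).
  by elim/big_rec3 : _ => // j x y z _ ->; rewrite rtD.
have h0 (z : 'cV[R]_k) : \sum_j z j 0 *: (0 : 'cV[R]_k) = 0.
  by rewrite big1// => j _; rewrite scaler0.
have hd (z : 'cV[R]_k) : \sum_j z j 0 *: (delta_mx j 0 : 'cV[R]_k) = z.
  apply/colP => l; rewrite summxE (bigD1 l)//= !mxE !eqxx mulr1 big1 ?addr0// => j jl.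
  by rewrite !mxE eq_sym (negbTE jl) mulr0.
rewrite big_sumType/=; under eq_bigr do rewrite rtZ.
under [X in _ + X]eq_bigr do rewrite rtZ.
by rewrite !rt_sum rtD !h0 !hd addr0 add0r.
Qed.

Lemma RT0_subspace c : is_subspace (RT0 c).
Proof.
split.
  exists 0, 0; split; first by move=> _ j l; rewrite !mxE.
  apply/funext => x; rewrite (_ : _ + _ = 0) ?mulmx0//.
  by apply/colP => l; rewrite !mxE mul0r addr0.
move=> t u v [a1 [b1 [h1 ->]]] [a2 [b2 [h2 ->]]].
exists (t *: a1 + a2), (t *: b1 + b2); split; last exact: rt_linear.
by move=> sc j l; rewrite !mxE (h1 sc j l) (h2 sc j l).
Qed.

Lemma divergence_linear c t u v x : RT0 c u -> RT0 c v ->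
  divergence (t *: u + v) x = t * divergence u x + divergence v x.
Proof.
move=> [a1 [b1 [_ ->]]] [a2 [b2 [_ ->]]].
by rewrite -!/(rt _ _ _) rt_linear !divergence_rt rtdiv_linear.
Qed.

End raviart_thomas.

Section ess_bounded_fields.
Context {R : realType} {n : nat} (k : nat).
Local Notation X := 'cV[R]_n.+1.
Local Notation cX := (caratheodory_type (@hausdorff_outer R n.+1 k)).
Variable D : set X.
Hypotheses (mD : measurable (D : set cX)) (bD : bounded_set D).

Lemma coord_continuous_cV (j : 'I_n.+1) : continuous (fun x : X => x j 0).
Proof. exact: coord_continuous. Qed.

Lemma bounded_bound : exists2 M : R, 0 <= M & forall x, D x -> `|x| <= M.
Proof.
have [M [_ hM]] := bD; exists (`|M| + 1); first by rewrite addr_ge0.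
by move=> x Dx; apply: (hM (`|M| + 1)) => //; rewrite ltr_pwDr// ler_norm.
Qed.

Lemma vebd_id : vebd k D (fun x => x).
Proof.
move=> j; have [M M0 hM] := bounded_bound.
apply: (@bounded_ess_bounded _ _ _ _ _ _ M).
  by apply: continuous_hmeasurable => //; exact: coord_continuous_cV.
move=> x /hM; apply: le_trans; rewrite [leRHS]mx_normrE.
exact: (le_bigmax _ (fun ij : 'I_n.+1 * 'I_1 => `|x ij.1 ij.2|) (j, 0)).
Qed.

Lemma ebd_mulmx p q (M : X -> 'M[R]_(p, q)) (u : X -> 'cV[R]_q) i :
  (forall j, ebd k D (fun x => M x i j)) -> (forall j, ebd k D (fun x => u x j 0)) ->
  ebd k D (fun x => (M x *m u x) i 0).
Proof.
move=> bM bu; have : ebd k D (fun x => \sum_j M x i j * u x j 0).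
  by apply: ess_bounded_sum => j; apply: ess_boundedM; [exact: bM|exact: bu].
by apply: eq_ess_bounded => // x _; rewrite mxE.
Qed.

Lemma ebd_cmulmx p q (M : 'M[R]_(p, q)) (u : X -> 'cV[R]_q) i :
  (forall j, ebd k D (fun x => u x j 0)) -> ebd k D (fun x => (M *m u x) i 0).
Proof. by move=> bu; apply: ebd_mulmx => // j; exact: ess_bounded_cst. Qed.

Lemma vebd_rt l (c : @cell R n l) a b : vebd k D (rt c a b).
Proof.
move=> i; apply: ebd_cmulmx => j.
have : ebd k D (fun x => a j 0 + b j 0 * loc c x j 0).
  apply: ess_boundedD; first exact: ess_bounded_cst.
  apply: ess_boundedZ; apply: ebd_cmulmx => j'; apply: ebd_cmulmx => i'.
  have : ebd k D (fun x => x i' 0 - org c i' 0).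
    by apply: ess_boundedB; [exact: vebd_id|exact: ess_bounded_cst].
  by apply: eq_ess_bounded => // x _; rewrite !mxE.
by apply: eq_ess_bounded => // x _; rewrite !mxE.
Qed.

(** Unfolds the choice of a cell as the first one in the enumeration, which allows an
    induction on the cells. *)
Lemma glue_seqE N (c : 'I_N -> set X) (Y : zmodType) (v : 'I_N -> X -> Y) x :
  Defs.glue c v x = if ohead [seq K <- Finite.enum 'I_N | x \in c K] is Some K
               then v K x else 0.
Proof. by rewrite /Defs.glue /pick /enum_mem. Qed.

Lemma ebd_glue N (c : 'I_N -> set X) (v : 'I_N -> X -> R) :
  (forall K, measurable (c K : set cX)) -> (forall K, ebd k D (v K)) ->
  ebd k D (Defs.glue c v).
Proof.
move=> mc bv; suff : ebd k D (fun x => if ohead [seq K <- Finite.enum 'I_N | x \in c K]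
    is Some K then v K x else 0).
  by apply: eq_ess_bounded => // x _; rewrite glue_seqE.
elim: (Finite.enum 'I_N) => [|K r IH]; first exact: ess_bounded_cst.
have b1 : ebd k D (\1_(c K)).
  apply: (@bounded_ess_bounded _ _ _ _ _ _ 1); first exact: (@measurable_indic _ cX).
  by move=> x _; rewrite indicE; case: (_ \in _); rewrite ?normr1 ?normr0.
have := ess_boundedD (ess_boundedM b1 (bv K))
  (ess_boundedM (ess_boundedB (ess_bounded_cst _ _ 1) b1) IH).
apply: eq_ess_bounded => // x _; rewrite indicE /=; case: (x \in c K) => /=.
  by rewrite mul1r subrr mul0r addr0.
by rewrite mul0r subr0 mul1r add0r.
Qed.

End ess_bounded_fields.

Section gluing.
Context {R : realType} {n : nat}.
Local Notation X := 'cV[R]_n.+1.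

Lemma glue_comp N (c : 'I_N -> set X) (Y Z : zmodType) (f : Y -> Z)
  (v : 'I_N -> X -> Y) x : f 0 = 0 ->
  f (Defs.glue c v x) = Defs.glue c (fun K y => f (v K y)) x.
Proof. by move=> f0; rewrite /Defs.glue; case: pickP. Qed.

Lemma glue_linear N (c : 'I_N -> set X) (Y : lmodType R) (t : R)
  (u v w : 'I_N -> X -> Y) x : (forall K, w K x = t *: u K x + v K x) ->
  Defs.glue c w x = t *: Defs.glue c u x + Defs.glue c v x.
Proof.
by move=> h; rewrite /Defs.glue; case: pickP => [K _|_]; rewrite ?h// scaler0 addr0.
Qed.

End gluing.

(** * Test functions and weak divergences *)

Section test_functions.
Context {R : realType} {n : nat}.
Local Notation X := 'cV[R]_n.+1.

Lemma is_derive_line (phi : X -> R) (x w : X) (h : R) :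
  derivable phi (h *: w + x) w ->
  is_derive h (1 : R) (fun s => phi (s *: w + x)) ('D_w phi (h *: w + x)).
Proof.
move=> dphi.
have E : (fun t : R => t^-1 *: (((fun s => phi (s *: w + x)) \o shift h) (t *: (1 : R))
      - phi (h *: w + x)))
    = (fun t : R => t^-1 *: ((phi \o shift (h *: w + x)) (t *: w) - phi (h *: w + x))).
  apply/funext => t /=; congr (_ *: (phi _ - _)).
  by rewrite addrA scalerDl -[t *: 1]/(t * 1) mulr1.
by apply: DeriveDef; [rewrite /derivable E|rewrite /derive E].
Qed.

Variables (U : set X) (phi : X -> R).
Hypothesis hphi : test_fun U phi.

Lemma test_fun_derivable x j : derivable phi x (e_ j).
Proof. by have [C1 _ _] := hphi; have [] := C1 x I j. Qed.

Lemma test_fun_partial_continuous j : continuous (fun x => 'D_(e_ j) phi x).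
Proof. by move=> x; have [C1 _ _] := hphi; have [_] := C1 x I j. Qed.

(** The partial derivatives vanish outside of the compact support. *)
Lemma test_fun_partial_bounded :
  exists2 M, 0 <= M & forall x j, `|'D_(e_ j) phi x| <= M.
Proof.
have [_ K _] := hphi; set S := [set x | phi x != 0] in K.
have [M hM] : {M : 'I_n.+1 -> R & forall j x, `|'D_(e_ j) phi x| <= M j}.
  apply: (@choice _ _ (fun j M => forall x, `|'D_(e_ j) phi x| <= M)) => j.
  have cK : compact ((fun x => 'D_(e_ j) phi x) @` closure S).
    by apply: continuous_compact K; exact/continuous_subspaceT/test_fun_partial_continuous.
  have [M [_ hM]] := @compact_bounded R R^o _ cK.
  exists (`|M| + 1) => x.
  have [clx|nclx] := pselect (closure S x).
    by apply: (hM (`|M| + 1)); [rewrite ltr_pwDr// ler_norm|exists x].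
  rewrite (@near_eq_derive _ _ _ phi (cst 0)) ?derive_cst ?normr0 ?addr_ge0//.
  have oC : open (~` closure S) by apply: closed_openC; exact: closed_closure.
  have := open_nbhs_nbhs (conj oC nclx); apply: filterS => y ny.
  apply/eqP/negPn/negP => y0; apply: ny; exact: subset_closure.
exists (\sum_j `|M j|); first by apply: sumr_ge0.
move=> x j; apply: (le_trans (hM j x)); apply: (le_trans (ler_norm _)).
by rewrite (bigD1 j)//= lerDl sumr_ge0.
Qed.

(** The coordinates are changed one at a time, with the mean value theorem along each
    axis. *)
Lemma test_fun_lipschitz :
  exists2 M, 0 <= M & forall x y, `|phi y - phi x| <= M * `|y - x|.
Proof.
have [M M0 hM] := test_fun_partial_bounded.
have step x j h : `|phi (h *: e_ j + x) - phi x| <= M * `|h|.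
  pose g s := phi (s *: e_ j + x).
  have dg s : is_derive s (1 : R) g ('D_(e_ j) phi (s *: e_ j + x)).
    by apply: is_derive_line; exact: test_fun_derivable.
  have cg a b : {within `[a, b], continuous g}.
    by apply: derivable_within_continuous => s _; exact: ex_derive.
  have -> : phi x = g 0 by rewrite /g scale0r add0r.
  rewrite -/(g h); have [h0|h0] := leP 0 h.
    have [c _ ->] := MVT_segment h0 (fun s _ => dg s) (cg _ _).
    by rewrite normrM subr0 ler_wpM2r.
  have [c _ E] := MVT_segment (ltW h0) (fun s _ => dg s) (cg _ _).
  by rewrite distrC E normrM sub0r normrN ler_wpM2r.
exists (n.+1%:R * M); first by rewrite mulr_ge0.
(* z k has the first k coordinates of y and the remaining ones of x *)
move=> x y; pose z k : X := \col_j (if (j < k)%N then y j 0 else x j 0).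
have z0 : z 0%N = x by apply/colP => j; rewrite mxE.
have zn : z n.+1 = y by apply/colP => j; rewrite mxE ltn_ord.
have zS (j : 'I_n.+1) : z j.+1 = (y j 0 - x j 0) *: e_ j + z j.
  apply/colP => i; rewrite !mxE eqxx andbT ltnS leq_eqVlt.
  have [->|ij] /= := eqVneq i j; first by rewrite eqxx ltnn/= mulr1 subrK.
  by move: ij; rewrite -val_eqE /= => /negbTE ->; rewrite mulr0 add0r.
have xy j : `|y j 0 - x j 0| <= `|y - x|.
  rewrite [leRHS]mx_normrE.
  have := (le_bigmax 0 (fun ij : 'I_n.+1 * 'I_1 => `|(y - x) ij.1 ij.2|) (j, 0)).
  by rewrite /= !mxE.
have H k : (k <= n.+1)%N -> `|phi (z k) - phi x| <= k%:R * M * `|y - x|.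
  elim: k => [|k IH] kn; first by rewrite z0 subrr normr0 !mul0r.
  have := zS (Ordinal kn) => /= ->; set v := z k.
  have -> : phi ((y (Ordinal kn) 0 - x (Ordinal kn) 0) *: e_ (Ordinal kn) + v) - phi x =
    (phi ((y (Ordinal kn) 0 - x (Ordinal kn) 0) *: e_ (Ordinal kn) + v) - phi v)
      + (phi v - phi x) by rewrite addrA subrK.
  rewrite (le_trans (ler_normD _ _))// -natr1 !mulrDl mul1r addrC lerD//.
    exact/IH/ltnW.
  by rewrite (le_trans (step _ _ _))// ler_wpM2l.
by have := H n.+1 (leqnn _); rewrite zn.
Qed.

Lemma test_fun_continuous : continuous phi.
Proof.
have [M M0 hM] := test_fun_lipschitz.
move=> x; apply: (iffRL (@cvgrPdist_le R R^o X (nbhs x) (nbhs_filter x) phi (phi x))) => e e0.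
have M1 : 0 < M + 1 by rewrite ltr_wpDl.
have xn : nbhs x [set y | `|x - y| < e / (M + 1)].
  by apply/(@nbhs_normP R X); exists (e / (M + 1)); first exact: divr_gt0.
apply: filterS xn => y /= /ltW; rewrite ler_pdivlMr// mulrDr mulr1 mulrC => xy.
by apply: (le_trans (hM _ _)); apply: le_trans xy; rewrite lerDl.
Qed.

Lemma test_fun_bounded (D : set X) : bounded_set D ->
  exists M, forall x, D x -> `|phi x| <= M.
Proof.
move=> bD; have [M M0 hM] := test_fun_lipschitz.
have [N N0 hN] := bounded_bound bD.
exists (M * N + `|phi 0|) => x Dx.
rewrite -(subrK (phi 0) (phi x)) (le_trans (ler_normD _ _))// lerD2r.
by rewrite (le_trans (hM _ _))// subr0 ler_wpM2l// hN.
Qed.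

End test_functions.

Section weak_divergence.
Context {R : realType} {n : nat} (k : nat).
Local Notation X := 'cV[R]_n.+1.
Local Notation cX := (caratheodory_type (@hausdorff_outer R n.+1 k)).
Variable D : set X.
Hypotheses (mD : measurable (D : set cX)) (bD : bounded_set D)
  (fD : (hausdorff k D < +oo)%E).

(** An integral is additive only on integrable functions, hence the boundedness
    assumptions; test functions and their gradients are bounded on bounded sets. *)
Lemma weak_div_linear U (v1 v2 v : X -> X) (g1 g2 g : X -> R) (t : R) :
  vebd k D v1 -> vebd k D v2 -> ebd k D g1 -> ebd k D g2 ->
  (forall x, v x = t *: v1 x + v2 x) -> (forall x, g x = t * g1 x + g2 x) ->
  weak_div U k D v1 g1 -> weak_div U k D v2 g2 -> weak_div U k D v g.
Proof.
move=> bv1 bv2 bg1 bg2 vE gE w1 w2 phi hphi.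
have bphi : ebd k D phi.
  have [M hM] := test_fun_bounded hphi bD.
  apply: (@bounded_ess_bounded _ _ _ _ _ _ M) => //.
  by apply: continuous_hmeasurable => //; exact: test_fun_continuous hphi.
have bgrad : vebd k D (grad phi).
  move=> j; have [M _ hM] := test_fun_partial_bounded hphi.
  have : ebd k D (fun x => 'D_(e_ j) phi x).
    have c := @test_fun_partial_continuous R n U phi hphi j.
    apply: (@bounded_ess_bounded _ cX R _ _ _ M); last by move=> x _; exact: hM.
    exact: (continuous_hmeasurable mD c).
  by apply: eq_ess_bounded => // x _; rewrite mxE.
have b u h : vebd k D u -> ebd k D h ->
    ebd k D (fun x => dot (u x) (grad phi x) + h x * phi x).
  by move=> bu bh; apply: ess_boundedD; [exact: ebd_dot|exact: ess_boundedM].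
have := hmeasure_int_linear mD fD t (b _ _ bv1 bg1) (b _ _ bv2 bg2).
rewrite (w1 _ hphi) (w2 _ hphi) mulr0 addr0 => E; rewrite -[RHS]E.
apply: eq_Rintegral => x _; rewrite vE gE dotL; ring.
Qed.

End weak_divergence.

(** * Geometry of the fracture and of its mesh *)

Section cell_measurability.
Context {R : realType} {m : nat}.
Local Notation X := 'cV[R]_m.+1.

(** If v E^T E = 0 then v E^T has square norm 0. *)
Lemma gram_unit p q (E : 'M[R]_(p, q)) : \rank E = q -> E^T *m E \in unitmx.
Proof.
move=> rE; rewrite -row_free_unit -kermx_eq0; apply/eqP/row_matrixP => i.
rewrite row0; set v := row i _.
have v0 : v *m (E^T *m E) = 0 by rewrite /v -row_mul mulmx_ker row0.
have rfE : row_free E^T by rewrite /row_free mxrank_tr rE.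
apply/eqP; rewrite -(mulmx_free_eq0 _ rfE); set y := v *m E^T.
have y0 : dot y^T y^T = 0.
  have : y *m y^T = 0 by rewrite /y trmx_mul trmxK !mulmxA -(mulmxA v) v0 mul0mx.
  move=> /matrixP/(_ 0 0); rewrite !mxE => h; rewrite -[RHS]h.
  by apply: eq_bigr => j _; rewrite !mxE.
apply/eqP/rowP => j; rewrite [RHS]mxE; apply/eqP; rewrite -normr_le0.
have := enorm_coord y^T j; rewrite mxE => /le_trans; apply.
by rewrite /enorm y0 sqrtr0.
Qed.

Lemma locK k (c : @cell R m k) (t : 'cV[R]_k) : \rank (edg c) = k ->
  loc c (org c + edg c *m t) = t.
Proof.
move=> rc; rewrite /loc addrAC subrr add0r !mulmxA -(mulmxA (invmx _)).
by rewrite mulVmx ?gram_unit// mul1mx.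
Qed.

(** A non-degenerate cell is cut out by finitely many conditions on the reference
    coordinates, which are affine functions of the point. *)
Lemma cell_setE k (c : @cell R m k) : \rank (edg c) = k ->
  cell_set c = [set x | [/\ forall i, (org c + edg c *m loc c x - x) i 0 = 0,
     forall j, 0 <= loc c x j 0 &
     if simplex c then (\sum_j loc c x j 0 <= 1 : Prop)
     else forall j, loc c x j 0 <= 1]].
Proof.
move=> rc; apply/seteqP; split => x.
  move=> [t [-> t0 t1]]; rewrite /= locK//; split => // i.
  by rewrite subrr mxE.
move=> [E t0 t1]; exists (loc c x); split => //.
by apply/eqP; rewrite eq_sym -subr_eq0; apply/eqP/colP => i; rewrite E mxE.
Qed.

Variable l : nat.
Local Notation cX := (caratheodory_type (@hausdorff_outer R m.+1 l)).

Let meas (f : X -> R) := measurable_on l setT f.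

Let meas_mulmx p q (M : 'M[R]_(p, q)) (u : X -> 'cV[R]_q) i :
  (forall j, meas (fun x => u x j 0)) -> meas (fun x => (M *m u x) i 0).
Proof.
move=> mu.
have : meas (fun x => \sum_j M i j * u x j 0).
  apply: (@measurable_sum _ cX R setT _ _ (fun j x => M i j * u x j 0)) => j.
  by apply: (@measurable_funM _ cX); [exact: measurable_cst|exact: mu].
by apply: eq_measurable_fun => x _; rewrite mxE.
Qed.

Let meas_coord j : meas (fun x => x j 0).
Proof.
apply: continuous_hmeasurable; first exact: (@measurableT _ cX).
exact: coord_continuous_cV.
Qed.

Let meas_loc k (c : @cell R m k) j : meas (fun x => loc c x j 0).
Proof.
apply: meas_mulmx => i; apply: meas_mulmx => i'.
have : meas (fun x => x i' 0 - org c i' 0).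
  by apply: (@measurable_funB _ cX); [exact: meas_coord|exact: measurable_cst].
by apply: eq_measurable_fun => x _; rewrite !mxE.
Qed.

Let meas_le (f : X -> R) (I : interval R) : meas f ->
  measurable ([set x | f x \in I] : set cX).
Proof.
by move=> mf; have := mf measurableT _ (measurable_itv I); rewrite setTI.
Qed.

Let meas_forall q (P : 'I_q -> set X) : (forall j, measurable (P j : set cX)) ->
  measurable ([set x | forall j, P j x] : set cX).
Proof.
move=> mP; rewrite (_ : [set x | _] = \bigcap_(j in [set: 'I_q]) P j).
  by apply: (@fin_bigcap_measurable _ cX) => //; exact: finite_finset.
by apply/seteqP; split => x h j //; exact: h.
Qed.

Lemma cell_measurable k (c : @cell R m k) : cell_ok c ->
  measurable (cell_set c : set cX).
Proof.
move=> [rc _]; rewrite cell_setE//.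
have m1 i : measurable ([set x | (org c + edg c *m loc c x - x) i 0 = 0] : set cX).
  rewrite (_ : [set x | _] = [set x : X | (org c + edg c *m loc c x - x) i 0 \in `[0, 0]]).
    apply: meas_le.
    have : meas (fun x => org c i 0 + (edg c *m loc c x) i 0 - x i 0).
      apply: (@measurable_funB _ cX); last exact: meas_coord.
      apply: (@measurable_funD _ cX); first exact: measurable_cst.
      by apply: meas_mulmx; exact: meas_loc.
    by apply: eq_measurable_fun => x _; rewrite !mxE.
  apply/seteqP; split => x /=; rewrite in_itv/=; first by move=> ->; rewrite lexx.
  by move=> h; apply/eqP; rewrite eq_le andbC.
have m2 j : measurable ([set x : X | 0 <= loc c x j 0] : set cX).
  rewrite (_ : [set x | _] = [set x : X | loc c x j 0 \in `[0, +oo[]).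
    exact/meas_le/meas_loc.
  by apply/seteqP; split => x /=; rewrite in_itv/= andbT.
have m3 : measurable ([set x : X | if simplex c then (\sum_j loc c x j 0 <= 1 : Prop)
     else forall j, loc c x j 0 <= 1] : set cX).
  case: simplex.
    rewrite (_ : [set x | _] = [set x : X | \sum_j loc c x j 0 \in `]-oo, 1]]).
      have ms : meas (fun x => \sum_j loc c x j 0).
        apply: (@measurable_sum _ cX R setT _ _ (fun j x => loc c x j 0)) => j.
        exact: meas_loc.
      exact: (meas_le _ ms).
    by apply/seteqP; split => x /=; rewrite in_itv.
  have m3 j : measurable ([set x : X | loc c x j 0 <= 1] : set cX).
    rewrite (_ : [set x | _] = [set x : X | loc c x j 0 \in `]-oo, 1]]).
      exact/meas_le/meas_loc.
    by apply/seteqP; split => x /=; rewrite in_itv.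
  exact: (meas_forall m3).
have := @measurableI _ cX _ _ (meas_forall m1) (@measurableI _ cX _ _ (meas_forall m2) m3).
congr measurable; apply/seteqP; split => x /=; first by move=> [? []].
by move=> [].
Qed.

End cell_measurability.

Section finite_unions.
Context {R : realType} {n : nat} (k : nat).
Local Notation X := 'cV[R]_n.+1.
Local Open Scope ereal_scope.

Lemma hausdorff_fin_bigcup_lt (N : nat) (A : 'I_N -> set X) (D : set X) :
  D `<=` \bigcup_(K in [set: 'I_N]) A K -> (forall K, hausdorff k (A K) < +oo) ->
  hausdorff k D < +oo.
Proof.
move=> DA fA; pose A' j := if insub j is Some K then A K else set0.
apply: (@le_lt_trans _ _ (\sum_(j <oo) hausdorff k (A' j))).
  apply: (le_trans _ (outer_measure_sigma_subadditive (hausdorff_outer k) A')).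
  apply: le_hausdorff => x /DA[K _ AKx]; exists (K : nat) => //.
  by rewrite /A' valK.
rewrite (@nneseries_split _ _ 0%N N)//; last by move=> *; exact: hausdorff_ge0.
rewrite add0n [X in _ + X]eseries0 ?adde0; last first.
  by move=> j Nj _; rewrite /A' insubF ?hausdorff0// ltnNge Nj.
apply: lte_sum_pinfty => j _; rewrite /A'; case: insubP => [K _ _|_]; first exact: fA.
by rewrite hausdorff0.
Qed.

End finite_unions.

Section geometry_facts.
Context {R : realType} {m : nat}.
Local Notation X := 'cV[R]_m.+1.
Variables (G : geometry R m) (hG : geometry_ok G).

Lemma closed_bdry (A : set X) : closed (bdry A).
Proof.
rewrite /bdry setDE; apply: closedI; first exact: closed_closure.
by apply: open_closedC; exact: open_interior.
Qed.

Lemma open_domain : open (domain G). Proof. by have [[? ? ? ?] _ _ _ _] := hG. Qed.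

Lemma bounded_domain : bounded_set (domain G).
Proof. by have [[? ? ? ?] _ _ _ _] := hG. Qed.

Lemma fractureE :
  fracture G = bdry (subdom G ord0) `&` bdry (subdom G ord_max) `&` domain G.
Proof. by have [_ [_ _ _ ?] _ _ _] := hG. Qed.

Lemma fracture_domain : fracture G `<=` domain G.
Proof. by rewrite fractureE => x []. Qed.

(** The fracture is the trace on the domain of a closed set, the common boundary of the
    subdomains. *)
Lemma fracture_closed : closure (fracture G) `&` domain G `<=` fracture G.
Proof.
move=> x [cx dx]; rewrite fractureE; split => //.
have cB : closed (bdry (subdom G ord0) `&` bdry (subdom G ord_max)).
  by apply: closedI; exact: closed_bdry.
apply: (cB); apply: closureS cx; rewrite fractureE; exact: subIsetl.
Qed.

Lemma I2P (i : 'I_2) : i = ord0 \/ i = ord_max.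
Proof. by case: i => -[|[|//]] ?; [left|right]; exact: val_inj. Qed.

Lemma open_subdom i : open (subdom G i).
Proof. by have [_ [h _ _ _] _ _ _] := hG; have [] := h i. Qed.

Lemma subdom_domain i : subdom G i `<=` domain G.
Proof.
have [_ [_ -> _ _] _ _ _] := hG; move=> x h; left.
by have [E|E] := I2P i; rewrite E in h; [left|right].
Qed.

Lemma bounded_subset (A B : set X) : A `<=` B -> bounded_set B -> bounded_set A.
Proof. by move=> AB [M [Mr hM]]; exists M; split => // e Me x /AB; exact: hM. Qed.

Lemma bounded_fracture : bounded_set (fracture G).
Proof. exact: bounded_subset fracture_domain bounded_domain. Qed.

Lemma bounded_subdom i : bounded_set (subdom G i).
Proof. exact: bounded_subset (@subdom_domain i) bounded_domain. Qed.

Lemma fracture_measurable k :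
  measurable (fracture G : set (caratheodory_type (@hausdorff_outer R m.+1 k))).
Proof.
rewrite fractureE; apply: (@measurableI _ (caratheodory_type (@hausdorff_outer R m.+1 k))).
  by apply: closed_hmeasurable; apply: closedI; exact: closed_bdry.
exact/open_hmeasurable/open_domain.
Qed.

Lemma subdom_measurable i k :
  measurable (subdom G i : set (caratheodory_type (@hausdorff_outer R m.+1 k))).
Proof. exact/open_hmeasurable/open_subdom. Qed.

Lemma frame_orthonormal x : fracture G x -> (frame G x)^T *m frame G x = 1%:M.
Proof. by move=> gx; have [_ _ _ _ [_ h]] := hG; have [] := h x gx. Qed.

Lemma frame_tangent x w : fracture G x -> tangent (fracture G) x w ->
  frame G x *m ((frame G x)^T *m w) = w.
Proof. by move=> gx; have [_ _ _ _ [_ h]] := hG; have [_] := h x gx; exact. Qed.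

Lemma frame_ebd j l : ebd m (fracture G) (fun x => frame G x j l).
Proof.
apply: (@bounded_ess_bounded _ _ _ _ _ _ 1).
  by have [_ _ _ _ [h _]] := hG; exact: h.
move=> x gx; have /matrixP/(_ l l) := frame_orthonormal gx.
rewrite !mxE eqxx => h; rewrite -(@ler_pXn2r _ 2)// ?nnegrE// expr1n.
rewrite real_normK ?num_real// -[leRHS]/(true%:R) -h (bigD1 j)//= mxE -expr2 lerDl.
by apply: sumr_ge0 => i _; rewrite mxE -expr2 sqr_ge0.
Qed.

Lemma nrm_ebd i : vebd m (fracture G) (nrm G i).
Proof.
move=> j; have [_ _ _ h _] := hG; have [cn hn] := h i.
apply: (@bounded_ess_bounded _ _ _ _ _ _ 1).
  apply: within_continuous_hmeasurable; first exact: fracture_measurable.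
  move=> x; apply: (@continuous_comp _ _ _ (nrm G i : subspace (fracture G) -> X)
    (fun y : X => y j 0)); [exact: cn|exact: coord_continuous_cV].
move=> x gx; have [<- _ _] := hn _ gx; exact: enorm_coord.
Qed.

Lemma frame_isometry x u v : frame G x *m ((frame G x)^T *m v) = v ->
  dot ((frame G x)^T *m u) ((frame G x)^T *m v) = dot u v.
Proof.
move=> tv; rewrite -{2}tv.
have dotE p (y z : 'cV[R]_p) : dot y z = (y^T *m z) 0 0.
  by rewrite mxE; apply: eq_bigr => i _; rewrite mxE.
by rewrite !dotE trmx_mul trmxK -mulmxA.
Qed.

(** The columns of the frame are orthonormal, so that applying its transpose amounts to
    an orthogonal projection. *)
Lemma enorm_frame_le x u : fracture G x -> enorm ((frame G x)^T *m u) <= enorm u.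
Proof.
move=> gx; set F := frame G x; set y := F^T *m u.
have Fy : F *m (F^T *m (F *m y)) = F *m y.
  by rewrite (mulmxA F^T) frame_orthonormal// mul1mx.
have E : dot y y = dot u (F *m y).
  by rewrite -(frame_isometry _ Fy) -/y (mulmxA F^T) frame_orthonormal// mul1mx.
have E2 : dot (F *m y) (F *m y) = dot y y.
  by rewrite -(frame_isometry _ Fy) !(mulmxA F^T) frame_orthonormal// mul1mx.
have := dot_le u (F *m y); rewrite -E.
have -> : enorm (F *m y) = enorm y by rewrite /enorm E2.
rewrite ger0_norm ?dot_ge0// -enorm_sqr expr2.
have := enorm_ge0 y; rewrite le_eqVlt => /predU1P[<- _|y0]; first exact: enorm_ge0.
by rewrite ler_pM2r.
Qed.

Variables (Th : mesh R m) (hTh : mesh_ok Th G).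

Lemma bcell_ok i (K : 'I_(ncell Th i)) : cell_ok (bcell K).
Proof. by have [[h _ _] _ _ _] := hTh; exact: h. Qed.

Lemma gcell_ok (E : 'I_(ngcell Th)) : cell_ok (gcell E).
Proof. by have [_ [h _ _] _ _] := hTh; exact: h. Qed.

Lemma gcell_cover : \bigcup_(E in [set: 'I_(ngcell Th)]) cell_set (gcell E)
            = closure (fracture G).
Proof. by have [_ [_ h _] _ _] := hTh. Qed.

Lemma fracture_hausdorff : (hausdorff m (fracture G) < +oo)%E.
Proof.
apply: (@hausdorff_fin_bigcup_lt _ _ _ _ (fun E : 'I_(ngcell Th) => cell_set (gcell E))).
  by rewrite gcell_cover; exact: subset_closure.
by move=> E; exact: hausdorff_cell_lt.
Qed.

Lemma subdom_hausdorff i : (hausdorff m.+1 (subdom G i) < +oo)%E.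
Proof.
apply: (@hausdorff_fin_bigcup_lt _ _ _ _ (fun K : 'I_(ncell Th i) => cell_set (bcell K))).
  by have [[_ h _] _ _ _] := hTh; rewrite h; exact: subset_closure.
by move=> E; exact: hausdorff_cell_lt.
Qed.

(** From a point of a cell, the segments towards the other points of the cell start
    inside the domain, hence on the fracture: the differences of two such directions
    span the tangent plane of the cell. *)
Lemma gcell_frame (E : 'I_(ngcell Th)) x : fracture G x -> cell_set (gcell E) x ->
  frame G x *m ((frame G x)^T *m edg (gcell E)) = edg (gcell E).
Proof.
move=> gx [t [xE t0 t1]]; set c := gcell E in xE t1 *.
pose ref (t' : 'cV[R]_m) := (forall j, 0 <= t' j 0) /\
  if simplex c then (\sum_j t' j 0 <= 1 : Prop) else forall j, t' j 0 <= 1.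
have dir t' : ref t' -> frame G x *m ((frame G x)^T *m (edg c *m (t' - t))) = edg c *m (t' - t).
  move=> [t'0 t'1]; apply: frame_tangent => //.
  have [e e0 he] := open_enorm open_domain (fracture_domain gx).
  move=> eps eps0; set w := edg c *m (t' - t).
  have w1 : 0 < enorm w + 1 by rewrite ltr_wpDl ?enorm_ge0.
  (* short enough for x + s w to stay in the cell and in the domain *)
  pose s := Num.min (eps / 2) (Num.min 1 (e / 2 / (enorm w + 1))).
  have s0 : 0 < s by rewrite !lt_min ltr01 !divr_gt0.
  have s1 : s <= 1 by rewrite !ge_min lexx orbT.
  exists s, (x + s *: w); split.
  - by rewrite s0 gt_min ltr_pdivrMr// ltr_pMr// ltr1n.
  - apply: fracture_closed; split.
      rewrite -gcell_cover; exists E => //; exists (t + s *: (t' - t)).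
      have cv (a b : R) : a + s * (b - a) = (1 - s) * a + s * b by ring.
      have s1' : 0 <= 1 - s by rewrite subr_ge0.
      split.
      + by rewrite xE -addrA mulmxDr -scalemxAr.
      + by move=> j; rewrite !mxE cv addr_ge0// mulr_ge0// ltW.
      + rewrite -/c; move: t1 t'1; case: (simplex c) => t1 t'1.
          have -> : \sum_j (t + s *: (t' - t)) j 0 = (1 - s) * \sum_j t j 0 + s * \sum_j t' j 0.
            by rewrite !mulr_sumr -big_split; apply: eq_bigr => j _; rewrite !mxE cv.
          rewrite -[leRHS](subrK s) lerD//.
            by rewrite -[leRHS]mulr1 ler_wpM2l.
          by rewrite -[leRHS]mulr1 ler_wpM2l// ltW.
        move=> j; rewrite !mxE cv -[leRHS](subrK s) lerD//.
          by rewrite -[leRHS]mulr1 ler_wpM2l.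
        by rewrite -[leRHS]mulr1 ler_wpM2l// ltW.
    apply: he; rewrite opprD addrA subrr add0r enormN enormZ ger0_norm ?(ltW s0)//.
    apply: (@le_lt_trans _ _ (s * (enorm w + 1))); first by rewrite ler_pM2l// lerDl.
    rewrite -ltr_pdivlMr//; apply: (@le_lt_trans _ _ (e / 2 / (enorm w + 1))).
      by rewrite !ge_min lexx !orbT.
    by rewrite ltr_pM2r ?invr_gt0// ltr_pdivrMr// ltr_pMr// ltr1n.
  - by rewrite [x + _]addrC addrK subrr enorm0 mulr_ge0// ltW.
have ref0 : ref 0.
  split; first by move=> j; rewrite mxE.
  case: simplex; first by rewrite big1// => j _; rewrite mxE.
  by move=> j; rewrite mxE.
have refe j : ref (delta_mx j 0).
  have d01 i : 0 <= (delta_mx j 0 : 'cV[R]_m) i 0 <= 1.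
    by rewrite mxE ler0n lern1 leq_b1.
  split; first by move=> i; have /andP[] := d01 i.
  case: simplex; last by move=> i; have /andP[] := d01 i.
  rewrite (bigD1 j)//= mxE !eqxx big1 ?addr0// => i ij.
  by rewrite mxE (negbTE ij).
apply/matrixP => i j.
have colE' (A : 'M[R]_(m.+1, m)) : A i j = (A *m (delta_mx j 0 : 'cV[R]_m)) i 0.
  by rewrite -colE mxE.
rewrite !colE'; congr (fun_of_matrix _ i 0); rewrite -!mulmxA.
(* 0 and the j-th basis vector are vertices of the reference cell *)
have -> : (delta_mx j 0 : 'cV[R]_m) = (delta_mx j 0 - t) - (0 - t).
  by rewrite sub0r opprK subrK.
by rewrite !mulmxBr -![edg c *m _ - edg c *m _]mulmxBr;
  have := dir _ (refe j); have := dir _ ref0; rewrite !mulmxBr => -> ->.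
Qed.

End geometry_facts.

(** * The interface operator *)

(** Abstract form of the problem on one side of the fracture: a is the resistance with
    the interface term, N the scalar product of normal traces, which alpha a dominates,
    and d the pairing of the interface data with normal traces. The operator sends the
    data la to minus the normal trace of the solution u la. *)
Section steklov_operator.
Context {R : realType} {V Q L : lmodType R}.
Variables (S : set V) (a N : V -> V -> R) (b : V -> Q -> R) (c : Q -> Q -> R)
  (d : L -> V -> R) (e : L -> L -> R) (dt alpha : R) (u : L -> V) (p : L -> Q).
Hypotheses (subS : is_subspace S) (hN : semi_inner S N) (hc : semi_inner setT c)
  (he : semi_inner setT e).
Hypotheses (alin : forall v, S v -> linear_on S (a^~ v))
  (acoer : forall v, S v -> alpha^-1 * N v v <= a v v).
Hypotheses (blinl : forall q, linear_on S (b^~ q))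
  (blinr : forall v, S v -> linear_on setT (b v)).
Hypotheses (dlinl : forall v, S v -> linear_on setT (d^~ v))
  (dlinr : forall la, linear_on S (d la))
  (dbd : forall la v, S v -> d la v ^+ 2 <= e la la * N v v).
Hypotheses (dt_gt0 : 0 < dt) (alpha_gt0 : 0 < alpha).
Hypothesis hu : forall la, S (u la) /\ forall v q, S v ->
  a (u la) v - b v (p la) = - d la v /\ c (p la) q + dt * b (u la) q = 0.

Let Su la : S (u la). Proof. by case: (hu la). Qed.

Let subQ : is_subspace [set: Q] := subspaceT.

Let b_le0 x r : S x -> c r r + dt * b x r = 0 -> b x r <= 0.
Proof.
move=> Sx h; rewrite -(ler_pM2l dt_gt0) mulr0.
have := semi_inner_ge0 hc (u := r) I; lra.
Qed.

Lemma steklov_ge0 la : 0 <= - d la (u la).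
Proof.
have [_ /(_ (u la) (p la) (Su la)) [h1 /(b_le0 (Su la)) h2]] := hu la.
have := acoer (Su la); have : 0 <= alpha^-1 * N (u la) (u la).
  by rewrite mulr_ge0 ?invr_ge0 ?(ltW alpha_gt0) ?(semi_inner_ge0 hN).
lra.
Qed.

(** Energy estimate: the trace term is controlled by its own pairing with the data. *)
Lemma steklov_trace_le la : N (u la) (u la) <= alpha ^+ 2 * e la la.
Proof.
have [_ /(_ (u la) (p la) (Su la)) [h1 /(b_le0 (Su la)) h2]] := hu la.
have ac := acoer (Su la); set n := N _ _ in ac *.
have n0 : 0 <= n by exact: (semi_inner_ge0 hN).
have e0 : 0 <= e la la by exact: (semi_inner_ge0 he).
have nd : alpha^-1 * n <= - d la (u la) by lra.
have := dbd la (Su la); rewrite -/n -sqrrN => sq.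
have {sq}: (alpha^-1 * n) ^+ 2 <= e la la * n.
  apply: le_trans sq; rewrite lerXn2r ?nnegrE//; last exact: steklov_ge0.
  by rewrite mulr_ge0// invr_ge0 ltW.
move: n0; rewrite le_eqVlt => /predU1P[<- _|n0].
  by rewrite mulr_ge0// sqr_ge0.
rewrite exprMn expr2 mulrA ler_pM2r// -expr2 => h.
have := ler_wpM2l (sqr_ge0 alpha) h; rewrite mulrA exprVn mulfV ?mul1r//.
by rewrite expf_neq0// gt_eqF.
Qed.

Lemma steklov_bounded la mu : (- d mu (u la)) ^+ 2 <= alpha ^+ 2 * (e la la * e mu mu).
Proof.
rewrite sqrrN; apply: (le_trans (dbd mu (Su la))).
rewrite mulrA [X in _ <= X]mulrC ler_wpM2l ?(semi_inner_ge0 he)//.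
exact: steklov_trace_le.
Qed.

(** The solution map itself need not be linear, but by uniqueness the normal traces
    of its values are. *)
Lemma steklov_linear mu : linear_on setT (fun la => - d mu (u la)).
Proof.
move=> t l1 l2 _ _; pose w := u (t *: l1 + l2) - (t *: u l1 + u l2).
pose r := p (t *: l1 + l2) - (t *: p l1 + p l2).
have S12 : S (t *: u l1 + u l2) by exact: subS.2.
have Sw : S w by exact: subspaceB.
have [_ /(_ w r Sw) [a0 c0]] := hu (t *: l1 + l2).
have [_ /(_ w r Sw) [a1 c1]] := hu l1.
have [_ /(_ w r Sw) [a2 c2]] := hu l2.
have dE : d (t *: l1 + l2) w = t * d l1 w + d l2 w by exact: dlinl.
have aE : a w w = a (u (t *: l1 + l2)) w - (t * a (u l1) w + a (u l2) w).
  by rewrite {1}/w (linear_onB subS (alin Sw))// alin.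
have brE : b w r = b w (p (t *: l1 + l2)) - (t * b w (p l1) + b w (p l2)).
  by rewrite {1}/r (linear_onB subQ (blinr Sw))// blinr.
have bwE : b w r = b (u (t *: l1 + l2)) r - (t * b (u l1) r + b (u l2) r).
  by rewrite {1}/w (linear_onB subS (blinl r))// blinl.
have cE : c r r = c (p (t *: l1 + l2)) r - (t * c (p l1) r + c (p l2) r).
  have cl := semi_innerL hc (w := r) I.
  by rewrite {1}/r (linear_onB subQ cl)// cl.
have b0 : b w r <= 0.
  apply: (b_le0 Sw); rewrite cE bwE.
  have -> : c (p (t *: l1 + l2)) r - (t * c (p l1) r + c (p l2) r) +
    dt * (b (u (t *: l1 + l2)) r - (t * b (u l1) r + b (u l2) r)) =
    (c (p (t *: l1 + l2)) r + dt * b (u (t *: l1 + l2)) r)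
    - t * (c (p l1) r + dt * b (u l1) r) - (c (p l2) r + dt * b (u l2) r) by ring.
  by rewrite c0 c1 c2; ring.
have aw : a w w = b w r.
  have e0 : a (u (t *: l1 + l2)) w = b w (p (t *: l1 + l2)) - d (t *: l1 + l2) w
    by rewrite -a0; ring.
  have e1 : a (u l1) w = b w (p l1) - d l1 w by rewrite -a1; ring.
  have e2 : a (u l2) w = b w (p l2) - d l2 w by rewrite -a2; ring.
  by rewrite aE brE e0 e1 e2 dE; ring.
have N0 : N w w = 0.
  apply/eqP; rewrite eq_le (semi_inner_ge0 hN)// andbT.
  have ac := acoer Sw; have : alpha^-1 * N w w <= 0 by lra.
  by rewrite pmulr_rle0 ?invr_gt0.
have d0 : d mu w = 0.
  apply/eqP; rewrite -sqrf_eq0 eq_le sqr_ge0 andbT.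
  by apply: (le_trans (dbd mu Sw)); rewrite N0 mulr0.
move: d0; rewrite /w (linear_onB subS (dlinr mu))// dlinr// => d0; lra.
Qed.

End steklov_operator.

(** * Spaces of piecewise Raviart-Thomas fields *)

Lemma semi_inner_comp {R : realType} {V V' : lmodType R} (S : set V) (S' : set V')
    (B : V' -> V' -> R) (T : V -> V') :
  (forall u, S u -> S' (T u)) ->
  (forall a u v, S u -> S v -> T (a *: u + v) = a *: T u + T v) ->
  semi_inner S' B -> semi_inner S (fun u v => B (T u) (T v)).
Proof.
move=> TS Tl hB; split => [u v Su Sv|w Sw a u v Su Sv|u Su].
- by apply: (semi_innerC hB); exact: TS.
- by rewrite Tl// (semi_innerL hB) //; exact: TS.
- by apply: (semi_inner_ge0 hB); exact: TS.
Qed.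

Lemma linear_on_comp {R : realType} {V V' : lmodType R} (S : set V) (S' : set V')
    (f : V' -> R) (T : V -> V') :
  (forall u, S u -> S' (T u)) ->
  (forall a u v, S u -> S v -> T (a *: u + v) = a *: T u + T v) ->
  linear_on S' f -> linear_on S (fun u => f (T u)).
Proof. by move=> TS Tl lf a u v Su Sv; rewrite Tl// lf//; exact: TS. Qed.

Section piecewise_fields.
Context {R : realType} {m N k : nat}.
Local Notation X := 'cV[R]_m.+1.
Variable c : 'I_N -> @cell R m k.

(** With the cells of one side these three are convertible to bev, bdiv and bpev, with
    those of the fracture to gev, gdiv and gpev. *)
Definition pw_field (v : 'I_N -> X -> X) : X -> X :=
  Defs.glue (fun K => cell_set (c K)) v.
Definition pw_div (v : 'I_N -> X -> X) : X -> R :=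
  Defs.glue (fun K => cell_set (c K)) (fun K => divergence (v K)).
Definition pw_const (q : 'I_N -> R) : X -> R :=
  Defs.glue (fun K => cell_set (c K)) (fun K _ => q K).

(** No continuity of the normal components between cells is imposed. *)
Definition broken_RT : set ('I_N -> X -> X) := [set v | forall K, RT0 (c K) (v K)].

(** With the cells of one side, or those of the fracture, this is a global
    H(div)-conforming space. *)
Definition conforming_RT (U : set X) (l : nat) (D : set X) : set ('I_N -> X -> X) :=
  [set v | (forall K, RT0 (c K) (v K)) /\ weak_div U l D (pw_field v) (pw_div v)].

Lemma pw_field_linear (t : R) (u v : 'I_N -> X -> X) :
  pw_field (t *: u + v) = t *: pw_field u + pw_field v.
Proof. by apply/funext => x; apply: glue_linear. Qed.

Lemma pw_div_linear (t : R) (u v : 'I_N -> X -> X) : broken_RT u -> broken_RT v ->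
  pw_div (t *: u + v) = (t *: (pw_div u : X -> R^o) + pw_div v : X -> R^o).
Proof.
move=> hu hv; apply/funext => x.
apply: (@glue_linear R m N _ R^o t (fun K => divergence (u K)) (fun K => divergence (v K))).
by move=> K; exact: divergence_linear.
Qed.

Lemma pw_const_linear (t : R) (q r : 'I_N -> R^o) :
  pw_const (t *: q + r) = (t *: (pw_const q : X -> R^o) + pw_const r : X -> R^o).
Proof.
apply/funext => x.
by apply: (@glue_linear R m N _ R^o t (fun K _ => q K) (fun K _ => r K)).
Qed.

Lemma broken_RT_subspace : is_subspace broken_RT.
Proof.
split => [K|t u v hu hv K]; first exact: (RT0_subspace (c K)).1.
exact: (RT0_subspace (c K)).2.
Qed.

Lemma broken_RT_fin_span (S : set ('I_N -> X -> X)) :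
  S `<=` broken_RT -> fin_span S.
Proof.
move=> SRT.
pose base K (s : 'I_k + 'I_k) := match s with
  | inl j => rt (c K) (delta_mx j 0) 0 | inr j => rt (c K) 0 (delta_mx j 0) end.
pose w (i : 'I_N * ('I_k + 'I_k)) : 'I_N -> X -> X :=
  fun K => if K == i.1 then base i.1 i.2 else 0.
exists ('I_N * ('I_k + 'I_k))%type, w => v Sv.
have /choice [a ha] : forall K, exists ab : 'cV[R]_k * 'cV[R]_k, v K = rt (c K) ab.1 ab.2.
  by move=> K; have [a [b [_ E]]] := SRT _ Sv K; exists (a, b).
exists (fun i => match i.2 with inl j => (a i.1).1 j 0 | inr j => (a i.1).2 j 0 end).
apply/funext => K; rewrite ha rt_span.
have -> : (\sum_i match i.2 with inl j => (a i.1).1 j 0 | inr j => (a i.1).2 j 0 end *: w i) K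
  = \sum_i match i.2 with inl j => (a i.1).1 j 0 | inr j => (a i.1).2 j 0 end *: w i K.
  by elim/big_rec2 : _ => // i x y _ <-.
rewrite -(pair_bigA _ (fun K' s => match s with inl j => (a K').1 j 0
  | inr j => (a K').2 j 0 end *: w (K', s) K))/=.
rewrite (bigD1 K)//= [X in _ + X]big1 ?addr0; last first.
  by move=> K' K'K; rewrite big1// => s _; rewrite /w/= eq_sym (negbTE K'K) scaler0.
by apply: eq_bigr => s _; rewrite /w/= eqxx; case: s.
Qed.

Lemma pw_const_fin_span : fin_span [set: 'I_N -> R^o].
Proof.
exists 'I_N, (fun K L => (K == L)%:R) => v _; exists v.
apply/funext => K.
have -> : (\sum_i v i *: (fun L => (i == L)%:R : R^o)) K
    = \sum_i v i *: ((i == K)%:R : R^o).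
  by elim/big_rec2 : _ => // i x y _ <-.
rewrite (bigD1 K)//= eqxx big1 ?addr0; first by rewrite /GRing.scale/= mulr1.
by move=> i iK; rewrite (negbTE iK) scaler0.
Qed.

Variables (l : nat) (D : set X).
Local Notation cX := (caratheodory_type (@hausdorff_outer R m.+1 l)).
Hypotheses (mD : measurable (D : set cX)) (bD : bounded_set D)
  (hc : forall K, cell_ok (c K)).

Let mc K : measurable (cell_set (c K) : set cX).
Proof. exact: cell_measurable. Qed.

Lemma vebd_pw_field v : broken_RT v -> vebd l D (pw_field v).
Proof.
move=> hv j.
have : ebd l D (Defs.glue (fun K => cell_set (c K)) (fun K x => v K x j 0)).
  have bv K : ebd l D (fun x => v K x j 0).
    by have [a [b [_ ->]]] := hv K; exact: (vebd_rt mD bD).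
  exact: (ebd_glue mD mc bv).
apply: eq_ess_bounded => // x _.
by rewrite /pw_field (@glue_comp R m N _ _ _ (fun y : X => y j 0))// mxE.
Qed.

Lemma ebd_pw_div v : broken_RT v -> ebd l D (pw_div v).
Proof.
move=> hv; apply: (ebd_glue mD mc) => K.
have [a [b [_ ->]]] := hv K.
apply: (@eq_ess_bounded _ _ _ _ _ (fun=> rtdiv (c K) b)) => //; last exact: ess_bounded_cst.
by move=> x _; exact: (esym (divergence_rt (c K) a b x)).
Qed.

Lemma ebd_pw_const q : ebd l D (pw_const q).
Proof.
by apply: (ebd_glue mD mc) => K; exact: ess_bounded_cst.
Qed.

Lemma conforming_RT_subspace U : (hausdorff l D < +oo)%E ->
  is_subspace (conforming_RT U l D).
Proof.
move=> fD.
have lin t u v : conforming_RT U l D u -> conforming_RT U l D v ->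
    conforming_RT U l D (t *: u + v).
  move=> [hu wu] [hv wv]; split; first exact: broken_RT_subspace.2.
  have e1 x : pw_field (t *: u + v) x = t *: pw_field u x + pw_field v x.
    by rewrite pw_field_linear.
  have e2 x : pw_div (t *: u + v) x = t * pw_div u x + pw_div v x.
    by rewrite pw_div_linear.
  exact: (weak_div_linear mD bD fD (vebd_pw_field hu) (vebd_pw_field hv)
    (ebd_pw_div hu) (ebd_pw_div hv) e1 e2 wu wv).
split => //; split; first exact: broken_RT_subspace.1.
move=> phi _; under eq_Rintegral => x _.
  rewrite (_ : pw_field 0 x = 0); last by rewrite /pw_field /Defs.glue; case: pickP.
  rewrite (_ : pw_div 0 x = 0).
    rewrite (_ : dot 0 _ = 0); last by rewrite /dot big1// => i _; rewrite mxE mul0r.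
    rewrite mul0r addr0; over.
  rewrite /pw_div /Defs.glue; case: pickP => // K _.
  apply: big1 => j _; apply: derive_affine => h.
  by rewrite (_ : (0 : 'I_N -> X -> X) K = fun=> 0)// !mxE mulr0 addr0.
by rewrite Rintegral_cst// mul0r.
Qed.

End piecewise_fields.

(** * Coefficients *)

Section coefficients.
Context {R : realType}.

Lemma dot_mulmx p q (A : 'M[R]_(p, q)) (y : 'cV[R]_q) (z : 'cV[R]_p) :
  dot (A *m y) z = dot y (A^T *m z).
Proof.
have dotE n (u v : 'cV[R]_n) : dot u v = (u^T *m v) 0 0.
  by rewrite mxE; apply: eq_bigr => i _; rewrite mxE.
by rewrite !dotE trmx_mul mulmxA.
Qed.

Lemma elliptic_ebd n k p (D : set 'cV[R]_n.+1) (K : 'cV[R]_n.+1 -> 'M[R]_p) (c C : R) :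
  uniformly_elliptic k D K c C -> forall j l, ebd k D (fun x => invmx (K x) j l).
Proof.
move=> [mK c0 hK] j l; split; first exact: mK.
exists (C * enorm (delta_mx l 0 : 'cV[R]_p)).
pose cX := caratheodory_type (@hausdorff_outer R n.+1 k).
apply: (@ae_imply _ cX R (hmeasure k) D D _ _ (@subset_refl _ D) hK)
  => x Dx [_ /(_ (delta_mx l 0)) [_]].
apply: le_trans.
have -> : invmx (K x) j l = (invmx (K x) *m (delta_mx l 0 : 'cV[R]_p)) j 0.
  by rewrite -colE mxE.
exact: enorm_coord.
Qed.

Section nonlinearity.
Variable xi : R -> R.
Hypotheses (dxi : forall s, derivable xi s 1) (cxi' : continuous (derive1 xi)).

Lemma derivable_continuous_fun : continuous xi.
Proof. by move=> s; apply/differentiable_continuous/derivable1_diffP. Qed.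

(** The mean value theorem on an interval P, with the point of the slope in P. *)
Lemma difference_quotient (P : R -> Prop) (a b : R) :
  (forall s t r, P s -> P t -> s <= r <= t -> P r) -> P a -> P b ->
  exists2 D, (exists2 s, P s & D = derive1 xi s) & xi b - xi a = D * (b - a).
Proof.
move=> cvx Pa Pb.
have H s t : s <= t -> P s -> P t ->
    exists2 D, (exists2 s, P s & D = derive1 xi s) & xi t - xi s = D * (t - s).
  move=> st Ps Pt.
  have [] := @MVT_segment R xi (derive1 xi) s t st.
  - by move=> x _; rewrite derive1E; exact: derivableP.
  - by apply: continuous_subspaceT; exact: derivable_continuous_fun.
  move=> r rst E; exists (derive1 xi r) => //; exists r => //.
  by apply: (cvx s t) => //; rewrite in_itv/= in rst.
have [ab|/ltW ba] := leP a b; first exact: H.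
have [D hD E] := H _ _ ba Pb Pa; exists D => //.
by rewrite -opprB E -mulrN opprB.
Qed.

Lemma locally_lipschitz (M : R) : exists2 La, 0 <= La & forall a b,
  `|a| <= M -> `|b| <= M -> `|xi a - xi b| <= La * `|a - b|.
Proof.
have cK : compact ((derive1 xi) @` `[- M, M]%classic).
  apply: continuous_compact; first exact: continuous_subspaceT.
  exact: segment_compact.
have [La [_ hLa]] := @compact_bounded R R^o _ cK.
exists (`|La| + 1); first by rewrite addr_ge0.
move=> a b aM bM.
have cvx s t r : `|s| <= M -> `|t| <= M -> s <= r <= t -> `|r| <= M.
  rewrite !ler_norml => /andP[s1 s2] /andP[t1 t2] /andP[r1 r2].
  by rewrite (le_trans s1 r1) (le_trans r2 t2).
have [D [s sM ->] ->] := difference_quotient cvx bM aM.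
rewrite normrM ler_wpM2r//; apply: (hLa (`|La| + 1)).
  by rewrite ltr_pwDr// ler_norm.
by exists s => //; rewrite /= in_itv/= -ler_norml.
Qed.

Lemma ess_bounded_continuous_comp d (T : measurableType d) (mu : {measure set T -> \bar R})
    (D : set T) (f : T -> R) :
  ess_bounded mu D f -> ess_bounded mu D (fun x => xi (f x)).
Proof.
move=> [mf [M fM]]; split.
  apply: (measurableT_comp _ mf); apply: continuous_measurable_fun.
  exact: derivable_continuous_fun.
have [La La0 hLa] := locally_lipschitz `|M|.
exists (La * `|M| + `|xi 0|); apply: filterS fM => x h Dx.
have fx : `|f x| <= `|M| by apply: le_trans (h Dx) _; exact: ler_norm.
rewrite -[xi (f x)](subrK (xi 0)) (le_trans (ler_normD _ _))// lerD2r.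
apply: (le_trans (hLa _ 0 fx _)); first by rewrite normr0.
by rewrite subr0 ler_wpM2l.
Qed.

End nonlinearity.

(** The square of Lg w - (Lg - D) d is nonnegative, and D (2 Lg - D) >= 2 Lg zeta D
    because D <= Lxi = 2 (1 - zeta) Lg. *)
Lemma stabilization_young (Lg D d w zeta xim : R) : 0 < Lg -> 0 <= zeta ->
  0 <= D -> xim <= D -> D <= 2 * (1 - zeta) * Lg ->
  Lg * (d * w) - D * d * w <= Lg / 2 * (w * w) + (Lg / 2 - zeta * xim) * (d * d).
Proof.
move=> L0 z0 D0 Dm DM; rewrite -subr_ge0.
have : 0 <= (Lg * w - (Lg - D) * d) ^+ 2 + d ^+ 2 * (2 * Lg * zeta * (D - xim)
    + D * (2 * (1 - zeta) * Lg - D)).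
  rewrite addr_ge0 ?sqr_ge0// mulr_ge0 ?sqr_ge0// addr_ge0//.
    by rewrite !mulr_ge0 ?subr_ge0// ltW.
  by rewrite mulr_ge0// subr_ge0.
have -> : (Lg * w - (Lg - D) * d) ^+ 2 + d ^+ 2 * (2 * Lg * zeta * (D - xim)
    + D * (2 * (1 - zeta) * Lg - D)) = (2 * Lg) *
  (Lg / 2 * (w * w) + (Lg / 2 - zeta * xim) * (d * d) - (Lg * (d * w) - D * d * w)).
  by field.
by rewrite pmulr_rge0// mulr_gt0.
Qed.

End coefficients.

(** * The forms on the fracture *)

Section fracture_forms.
Context {R : realType} {m : nat}.
Local Notation X := 'cV[R]_m.+1.
Variables (G : geometry R m) (hG : geometry_ok G) (Th : mesh R m) (hTh : mesh_ok Th G).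
Local Notation gam := (fracture G).
Local Notation V := ('I_(ngcell Th) -> X -> X)%type.
Local Notation W := ('I_(ngcell Th) -> R^o)%type.
Local Notation SV := (Vg G : set V).
Local Notation F := (frame G).

Let mgam := fracture_measurable hG m.
Let bgam := bounded_fracture hG.
Let fgam := fracture_hausdorff hTh.
Let okg := @gcell_ok R m G Th hTh.

Lemma Vg_subspace : is_subspace SV.
Proof. exact: (conforming_RT_subspace mgam bgam okg (domain G) fgam). Qed.

Let Vg_broken (v : V) : Vg G v -> broken_RT (@gcell R m Th) v.
Proof. by case. Qed.

Lemma Vg_fin_span : fin_span SV.
Proof. exact: (broken_RT_fin_span Vg_broken). Qed.

Lemma gev_linear t (u v : V) :
  @gev R m Th (t *: u + v) = t *: @gev R m Th u + @gev R m Th v.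
Proof. exact: pw_field_linear. Qed.

Lemma vebd_gev (v : V) : Vg G v -> vebd m gam (@gev R m Th v).
Proof. by move=> hv; exact: (vebd_pw_field mgam bgam okg (Vg_broken hv)). Qed.

(** The frame times its transpose is the orthogonal projection onto the tangent space,
    which contains the edges of the cell. *)
Lemma gev_frame (v : V) x : Vg G v -> gam x ->
  F x *m ((F x)^T *m @gev R m Th v x) = @gev R m Th v x.
Proof.
move=> hv gx; rewrite /gev /Defs.glue; case: pickP => [E xE|_]; last by rewrite !mulmx0.
have [a [b [_ ->]]] := Vg_broken hv E.
have h := gcell_frame hG hTh gx (set_mem xE).
by rewrite !mulmxA in h *; rewrite h.
Qed.

Lemma gev_semi_inner :
  semi_inner SV (fun u v => vip m gam (@gev R m Th u) (@gev R m Th v)).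
Proof.
apply: (semi_inner_comp vebd_gev _ (vip_semi_inner mgam fgam)) => t u v _ _.
exact: gev_linear.
Qed.

Lemma cg_semi_inner : semi_inner ([set: W]) (@cg R m G Th).
Proof.
apply: (@semi_inner_comp R W (X -> R^o) setT (ebd m gam) (ip m gam) (fun q => pw_const (@gcell R m Th) q)).
- by move=> q _; exact: (ebd_pw_const mgam okg).
- by move=> t u v _ _; exact: pw_const_linear.
- exact: (ip_semi_inner mgam fgam).
Qed.

Let ebd_gdiv (v : V) : Vg G v -> ebd m gam (@gdiv R m Th v).
Proof. by move=> hv; exact: (ebd_pw_div mgam okg (Vg_broken hv)). Qed.

Let ebd_gpev (q : W) : ebd m gam (@gpev R m Th q).
Proof. exact: (ebd_pw_const mgam okg). Qed.

Lemma bg_linear_l (mu : W) : linear_on SV (fun v => @bg R m G Th v mu).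
Proof.
apply: (@linear_on_comp R V (X -> R^o) SV (ebd m gam) (fun f => ip m gam f (@gpev R m Th mu))
  (fun v => @gdiv R m Th v) ebd_gdiv).
  by move=> t u v hu hv; apply: pw_div_linear; exact: Vg_broken.
exact: (semi_innerL (ip_semi_inner mgam fgam) (ebd_gpev mu)).
Qed.

Lemma ip_linear_r (f : X -> R) : ebd m gam f ->
  linear_on [set: W] (fun mu => ip m gam f (@gpev R m Th mu)).
Proof.
move=> bf; have hip := ip_semi_inner mgam fgam.
have := @linear_on_comp R W (X -> R^o) setT (ebd m gam) (fun h => ip m gam h f)
  (fun q => pw_const (@gcell R m Th) q) (fun q _ => ebd_gpev q)
  (fun t u v _ _ => pw_const_linear (@gcell R m Th) t u v) (semi_innerL hip bf).
move=> lin t u v Su Sv; have := lin t u v Su Sv.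
by rewrite !(semi_innerC hip _ bf) //; exact: ebd_gpev.
Qed.

Lemma bg_linear_r (v : V) : Vg G v -> linear_on [set: W] (@bg R m G Th v).
Proof. by move=> hv; apply: ip_linear_r; exact: ebd_gdiv. Qed.

Lemma bg_bounded (v : V) : Vg G v -> exists M, forall mu : W,
  @bg R m G Th v mu ^+ 2 <= M * @cg R m G Th mu mu.
Proof.
move=> hv; exists (ip m gam (@gdiv R m Th v) (@gdiv R m Th v)) => mu.
apply: (cauchy_schwarz (ebd_subspace m gam) (ip_semi_inner mgam fgam)).
  exact: ebd_gdiv.
exact: ebd_gpev.
Qed.

Section permeability.
Variables (C : coeffs R m) (cKg CKg : R).
Hypothesis hKg : uniformly_elliptic m gam (permg C) cKg CKg.

Let vebd_permg_inv u : vebd m gam u -> vebd m gam (permg_inv G C u).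
Proof.
move=> bu j; apply: (ebd_mulmx mgam) => [l|l]; first exact: (frame_ebd hG).
apply: (ebd_mulmx mgam) => [l'|l']; first exact: (elliptic_ebd hKg).
apply: (ebd_mulmx mgam) => [i|i]; last exact: bu.
have := frame_ebd hG i l'; apply: (eq_ess_bounded mgam) => x _.
by rewrite mxE.
Qed.

Lemma ag_linear (v : V) : Vg G v -> linear_on SV (fun u => @ag R m G C Th u v).
Proof.
move=> hv; apply: (@linear_on_comp R V (X -> X) SV (vebd m gam)
  (fun u => vip m gam (permg_inv G C u) (@gev R m Th v)) (fun u => @gev R m Th u) vebd_gev).
  by move=> t u w _ _; exact: gev_linear.
have lin a (u w : X -> X) x : gam x -> permg_inv G C (a *: u + w) x =
    a *: permg_inv G C u x + permg_inv G C w x.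
  by move=> _; rewrite /permg_inv (_ : (_ + _) x = a *: u x + w x)// !mulmxDr -!scalemxAr.
exact: (vip_bilinear mgam fgam lin vebd_permg_inv (vebd_gev hv)).
Qed.

(** Tangential vectors have the same norm as their components in the frame, in which
    the permeability is elliptic. *)
Lemma ag_coercive (v : V) : Vg G v ->
  cKg * vip m gam (@gev R m Th v) (@gev R m Th v) <= @ag R m G C Th v v.
Proof.
move=> hv; have bv := vebd_gev hv; have [_ _ hae] := hKg.
have bd := ebd_dot bv bv; have bP := ebd_dot (vebd_permg_inv bv) bv.
rewrite /ag /vip; have <- := hmeasure_int_scale mgam fgam cKg bd.
apply: (le_hmeasure_int mgam fgam (ess_boundedZ cKg bd) bP).
apply: (@ae_imply _ _ R (hmeasure m) gam gam _ _ (@subset_refl _ gam) hae) => x gx [_ h].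
have [h1 _] := h ((F x)^T *m @gev R m Th v x).
rewrite /permg_inv dot_mulmx dotC; apply: le_trans h1.
by rewrite enorm_sqr frame_isometry//; exact: gev_frame.
Qed.

Lemma ag_bounded : exists M, forall u v : V, Vg G u -> Vg G v ->
  @ag R m G C Th u v ^+ 2 <= M * (vip m gam (@gev R m Th u) (@gev R m Th u) *
    vip m gam (@gev R m Th v) (@gev R m Th v)).
Proof.
exists (CKg ^+ 2) => u v hu hv; have bu := vebd_gev hu; have bv := vebd_gev hv.
have hvip := vip_semi_inner mgam fgam.
have bPu := vebd_permg_inv bu.
apply: (le_trans (cauchy_schwarz (vebd_subspace mgam) hvip bPu bv)).
rewrite mulrA ler_wpM2r ?(semi_inner_ge0 hvip)//.
have bd := ebd_dot bu bu; have bP := ebd_dot bPu bPu.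
rewrite /vip; have <- := hmeasure_int_scale mgam fgam (CKg ^+ 2) bd.
apply: (le_hmeasure_int mgam fgam bP (ess_boundedZ (CKg ^+ 2) bd)).
have [_ _ hae] := hKg.
apply: (@ae_imply _ _ R (hmeasure m) gam gam _ _ (@subset_refl _ gam) hae) => x gx [_ h].
have [_ h2] := h ((F x)^T *m @gev R m Th u x).
rewrite /permg_inv dot_mulmx mulmxA (frame_orthonormal hG gx) mul1mx -enorm_sqr.
rewrite -[dot (@gev R m Th u x) _](frame_isometry _ (gev_frame hu gx)).
rewrite -[dot ((F x)^T *m _) _]enorm_sqr -exprMn lerXn2r ?nnegrE ?enorm_ge0//.
by apply: le_trans h2; exact: enorm_ge0.
Qed.

End permeability.
End fracture_forms.

Lemma map_mxB_entry {R : realType} n (f : R -> R) (y z : 'cV[R]_n) j :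
  (map_mx f y - map_mx f z) j 0 = f (y j 0) - f (z j 0).
Proof. by rewrite !mxE. Qed.

Section nonlinear_form.
Context {R : realType} {m : nat}.
Local Notation X := 'cV[R]_m.+1.
Variables (G : geometry R m) (hG : geometry_ok G) (Th : mesh R m) (hTh : mesh_ok Th G).
Local Notation gam := (fracture G).
Local Notation V := ('I_(ngcell Th) -> X -> X)%type.
Local Notation F := (frame G).
Local Notation gv := (@gev R m Th).
Variable C : coeffs R m.
Hypotheses (hxi : xi_C1 C) (xi'_ge0 : forall s, 0 <= derive1 (xi C) s).

Let mgam := fracture_measurable hG m.
Let fgam := fracture_hausdorff hTh.
Let hvip := vip_semi_inner mgam fgam.

Definition xi_form (u v : V) : R := vip m gam (xi_field G C (gv u)) (gv v).

(** The components of the velocity in the tangential frame, to which the nonlinearity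
    applies. *)
Definition tang (u : V) (x : X) : 'cV[R]_m := (F x)^T *m gv u x.

Lemma gevB (u w : V) x : gv (u - w) x = gv u x - gv w x.
Proof.
rewrite -[- w]scaleN1r addrC gev_linear (_ : (_ + _) x = -1 *: gv w x + gv u x)//.
by rewrite scaleN1r addrC.
Qed.

Lemma vebd_xi_field u : vebd m gam u -> vebd m gam (xi_field G C u).
Proof.
move=> bu j; apply: (ebd_mulmx mgam) => [l|l]; first exact: (frame_ebd hG).
have bt : ebd m gam (fun x => ((F x)^T *m u x) l 0).
  apply: (ebd_mulmx mgam) => [i|i]; last exact: bu.
  have := frame_ebd hG i l; apply: (eq_ess_bounded mgam) => x _.
  by rewrite mxE.
have := ess_bounded_continuous_comp hxi.1 hxi.2 bt.
by apply: (eq_ess_bounded mgam) => x _; rewrite [RHS]mxE.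
Qed.

Lemma xi_field_dot (u w v : V) x :
  dot (xi_field G C (gv u) x - xi_field G C (gv w) x) (gv v x) =
  \sum_j (xi C (tang u x j 0) - xi C (tang w x j 0)) * tang v x j 0.
Proof.
rewrite /xi_field -mulmxBr dot_mulmx; apply: eq_bigr => j _.
by rewrite map_mxB_entry.
Qed.

Lemma xi_form_diff (u w v : V) : Vg G u -> Vg G w -> Vg G v ->
  xi_form u v - xi_form w v =
  vip m gam (fun x => xi_field G C (gv u) x - xi_field G C (gv w) x) (gv v).
Proof.
move=> hu hw hv.
have bu := vebd_xi_field (vebd_gev hG hTh hu).
have bw := vebd_xi_field (vebd_gev hG hTh hw).
have bv := vebd_gev hG hTh hv.
by rewrite /xi_form -(linear_onB (vebd_subspace mgam) (semi_innerL hvip bv) bu bw).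
Qed.

Lemma stabilised_form (Lg : R) (w u v : V) : Vg G w -> Vg G u -> Vg G v ->
  vip m gam (fun x => xi_field G C (gv w) x + Lg *: (gv u x - gv w x)) (gv v) =
  xi_form w v + Lg * vip m gam (gv (u - w)) (gv v).
Proof.
move=> hw hu hv; have bw := vebd_xi_field (vebd_gev hG hTh hw).
have bd := vebd_gev hG hTh (subspaceB (Vg_subspace hG hTh) hu hw).
rewrite addrC /xi_form -(semi_innerL hvip (vebd_gev hG hTh hv) Lg bd bw).
apply: eq_Rintegral => x _; congr dot.
by rewrite addrC (_ : (_ + _) x = Lg *: gv (u - w) x + xi_field G C (gv w) x)// gevB.
Qed.

Let ebd_diff (u w v : V) : Vg G u -> Vg G w -> Vg G v ->
  ebd m gam (fun x => dot (xi_field G C (gv u) x - xi_field G C (gv w) x) (gv v x)).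
Proof.
move=> hu hw hv; apply: ebd_dot; last exact: (vebd_gev hG hTh hv).
exact: (subspaceB (vebd_subspace mgam) (vebd_xi_field (vebd_gev hG hTh hu))
  (vebd_xi_field (vebd_gev hG hTh hw))).
Qed.

Lemma xi_form_mono (u w : V) : Vg G u -> Vg G w ->
  0 <= xi_form u (u - w) - xi_form w (u - w).
Proof.
move=> hu hw; have hd := subspaceB (Vg_subspace hG hTh) hu hw.
rewrite xi_form_diff//; apply: Rintegral_ge0 => x gx.
rewrite xi_field_dot; apply: sumr_ge0 => j _.
have [D [s _ ->] ->] := @difference_quotient R (xi C) hxi.1 (fun=> True)
  (tang w x j 0) (tang u x j 0) (fun _ _ _ _ _ _ => I) I I.
have -> : tang (u - w) x j 0 = tang u x j 0 - tang w x j 0.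
  by rewrite /tang gevB mulmxBr !mxE.
by rewrite -mulrA -expr2 mulr_ge0 ?sqr_ge0.
Qed.

Lemma dot_tang (u v : V) x : gam x -> Vg G v ->
  dot (gv u x) (gv v x) = \sum_j tang u x j 0 * tang v x j 0.
Proof.
by move=> gx hv; rewrite -(frame_isometry (gv u x) (gev_frame hG hTh hv gx)).
Qed.

(* an interval containing the values of the iterates *)
Variable P : R -> Prop.
Hypothesis cvx : forall s t r, P s -> P t -> s <= r <= t -> P r.

(** The pointwise inequality holds for each component in the frame, with D the slope of
    the nonlinearity between the two iterates. *)
Lemma xi_form_key (Lg zeta xim : R) (u0 u1 v : V) : 0 < Lg -> 0 <= zeta ->
  (forall s, P s -> xim <= derive1 (xi C) s <= 2 * (1 - zeta) * Lg) ->
  Vg G u0 -> Vg G u1 -> Vg G v ->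
  (forall x j, gam x -> P (tang u0 x j 0)) -> (forall x j, gam x -> P (tang u1 x j 0)) ->
  Lg * vip m gam (gv (u1 - u0)) (gv v) - (xi_form u1 v - xi_form u0 v) <=
  Lg / 2 * vip m gam (gv v) (gv v)
    + (Lg / 2 - zeta * xim) * vip m gam (gv (u1 - u0)) (gv (u1 - u0)).
Proof.
move=> L0 z0 hP h0 h1 hv P0 P1.
have hd := subspaceB (Vg_subspace hG hTh) h1 h0.
have bv := vebd_gev hG hTh hv; have bd := vebd_gev hG hTh hd.
have bdv := ebd_dot bd bv; have bvv := ebd_dot bv bv; have bdd := ebd_dot bd bd.
have bx := ebd_diff h0 h1 hv.
rewrite opprB (xi_form_diff h0 h1 hv) /vip.
have <- := hmeasure_int_scale mgam fgam (Lg / 2 - zeta * xim) bdd.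
have <- := hmeasure_int_linear mgam fgam Lg bdv bx.
have bdd' := ess_boundedZ (Lg / 2 - zeta * xim) bdd.
have <- := hmeasure_int_linear mgam fgam (Lg / 2) bvv bdd'.
apply: (le_hmeasure_int mgam fgam).
- exact: (ess_boundedD (ess_boundedZ Lg bdv) bx).
- exact: (ess_boundedD (ess_boundedZ (Lg / 2) bvv) bdd').
apply: aeW => x gx; rewrite xi_field_dot !dot_tang// !mulr_sumr -!big_split/=.
apply: ler_sum => j _.
have [D [s Ps ->] E] := difference_quotient hxi.1 cvx (P0 x j gx) (P1 x j gx).
have -> : tang (u1 - u0) x j 0 = tang u1 x j 0 - tang u0 x j 0.
  by rewrite /tang gevB mulmxBr !mxE.
rewrite -[xi C _ - _]opprB E mulNr.
have /andP[D1 D2] := hP _ Ps.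
exact: stabilization_young.
Qed.

(** The values of w are bounded but need not lie in P. *)
Lemma xi_form_cont (u : nat -> V) (w v : V) :
  (forall M, exists2 La, 0 <= La & forall a b, P a -> `|b| <= M ->
     `|xi C a - xi C b| <= La * `|a - b|) ->
  (forall k, Vg G (u k)) -> Vg G w -> Vg G v ->
  (forall k x j, gam x -> P (tang (u k) x j 0)) ->
  exists M, forall k, (xi_form (u k) v - xi_form w v) ^+ 2 <=
    M * vip m gam (gv (u k - w)) (gv (u k - w)).
Proof.
move=> hL hu hw hv Pu.
have bv := vebd_gev hG hTh hv; have bw := vebd_gev hG hTh hw.
have [mw [M hM]] := ebd_dot bw bw.
have [La La0 hLa] := hL (Num.sqrt M).
exists (La ^+ 2 * vip m gam (gv v) (gv v)) => k.
have hd := subspaceB (Vg_subspace hG hTh) (hu k) hw.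
have bd := vebd_gev hG hTh hd; have bdd := ebd_dot bd bd.
rewrite (xi_form_diff (hu k) hw hv).
have bdx : vebd m gam (fun x => xi_field G C (gv (u k)) x - xi_field G C (gv w) x).
  exact: (subspaceB (vebd_subspace mgam) (vebd_xi_field (vebd_gev hG hTh (hu k)))
    (vebd_xi_field bw)).
apply: (le_trans (cauchy_schwarz (vebd_subspace mgam) hvip bdx bv)).
rewrite mulrAC ler_wpM2r ?(semi_inner_ge0 hvip)//.
rewrite /vip; have <- := hmeasure_int_scale mgam fgam (La ^+ 2) bdd.
apply: (le_hmeasure_int mgam fgam (ebd_dot bdx bdx) (ess_boundedZ (La ^+ 2) bdd)).
apply: (@ae_imply _ _ R (hmeasure m) gam gam _ _ (@subset_refl _ gam) hM) => x gx wM.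
rewrite [leRHS]/= dot_tang// mulr_sumr.
have -> : dot (xi_field G C (gv (u k)) x - xi_field G C (gv w) x)
    (xi_field G C (gv (u k)) x - xi_field G C (gv w) x) =
    \sum_j (xi C (tang (u k) x j 0) - xi C (tang w x j 0)) ^+ 2.
  rewrite /xi_field -mulmxBr dot_mulmx mulmxA (frame_orthonormal hG gx) mul1mx.
  by apply: eq_bigr => j _; rewrite map_mxB_entry expr2.
apply: ler_sum => j _.
have -> : tang (u k - w) x j 0 = tang (u k) x j 0 - tang w x j 0.
  by rewrite /tang gevB mulmxBr !mxE.
rewrite -expr2 -exprMn -[leLHS]real_normK ?num_real// -[leRHS]real_normK ?num_real//.
rewrite lerXn2r ?nnegrE// normrM (ger0_norm La0); apply: hLa; first exact: Pu.
apply: le_trans (enorm_coord _ _) _; apply: le_trans (enorm_frame_le hG _ gx) _.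
rewrite /enorm; apply: ler_wsqrtr; apply: le_trans wM; exact: ler_norm.
Qed.

End nonlinear_form.

(** * The interface form *)

Section interface_form.
Context {R : realType} {m : nat}.
Local Notation X := 'cV[R]_m.+1.
Variables (G : geometry R m) (hG : geometry_ok G) (Th : mesh R m) (hTh : mesh_ok Th G).
Local Notation gam := (fracture G).
Local Notation Om i := (subdom G i).
Local Notation W := ('I_(ngcell Th) -> R^o)%type.
Variables (C : coeffs R m) (cK CK : R).
Hypothesis hK : uniformly_elliptic m.+1 (subdom G ord0 `|` subdom G ord_max) (perm C) cK CK.
Hypothesis halpha : 0 < alpha C.

Let mgam := fracture_measurable hG m.
Let bgam := bounded_fracture hG.
Let fgam := fracture_hausdorff hTh.
Let okg := @gcell_ok R m G Th hTh.

Let ebd_gpev (q : W) : ebd m gam (@gpev R m Th q).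
Proof. exact: (ebd_pw_const mgam okg). Qed.

Section one_side.
Variable i : 'I_2.
Local Notation V := ('I_(ncell Th i) -> X -> X)%type.
Local Notation Q := ('I_(ncell Th i) -> R^o)%type.
Local Notation SV := (@Vh R m Th G i : set V).
Local Notation cb := (@bcell R m Th i).

Let mOm := subdom_measurable hG i m.+1.
Let bOm := @bounded_subdom _ _ _ hG i.
Let fOm := subdom_hausdorff hTh i.
Let okb := @bcell_ok R m G Th hTh i.

Lemma Vh_subspace : is_subspace SV.
Proof. exact: (conforming_RT_subspace mOm bOm okb (Om i) fOm). Qed.

Let Vh_broken (v : V) : SV v -> broken_RT cb v.
Proof. by case. Qed.

Let vebd_bev (v : V) : SV v -> vebd m.+1 (Om i) (@bev R m Th i v).
Proof. by move=> hv; exact: (vebd_pw_field mOm bOm okb (Vh_broken hv)). Qed.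

Let bev_linear t (u v : V) :
  @bev R m Th i (t *: u + v) = t *: @bev R m Th i u + @bev R m Th i v.
Proof. exact: pw_field_linear. Qed.

Let ebd_bdiv (v : V) : SV v -> ebd m.+1 (Om i) (@bdiv R m Th i v).
Proof. by move=> hv; exact: (ebd_pw_div mOm okb (Vh_broken hv)). Qed.

Let ebd_bpev (q : Q) : ebd m.+1 (Om i) (@bpev R m Th i q).
Proof. exact: (ebd_pw_const mOm okb). Qed.

Definition normal_trace (v : V) : X -> R^o := ntr G i (@bev R m Th i v).

Lemma ebd_trace (v : V) : SV v -> ebd m gam (normal_trace v).
Proof.
move=> hv; apply: ebd_dot; last exact: (nrm_ebd hG).
exact: (vebd_pw_field mgam bgam okb (Vh_broken hv)).
Qed.

Lemma trace_linear t (u v : V) : normal_trace (t *: u + v) = t *: normal_trace u + normal_trace v.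
Proof.
apply/funext => x; rewrite /normal_trace /ntr bev_linear.
by rewrite (_ : (_ + _) x = t *: @bev R m Th i u x + @bev R m Th i v x)// dotL.
Qed.

Lemma trace_semi_inner : semi_inner SV (fun u v => ip m gam (normal_trace u) (normal_trace v)).
Proof.
apply: (@semi_inner_comp R V (X -> R^o) SV (ebd m gam) (ip m gam) normal_trace ebd_trace).
  by move=> t u v _ _; exact: trace_linear.
exact: (ip_semi_inner mgam fgam).
Qed.

Let hipO := ip_semi_inner mOm fOm.
Let hipg := ip_semi_inner mgam fgam.

Let c_semi_inner : semi_inner [set: Q] (@c_ R m G Th i).
Proof.
apply: (@semi_inner_comp R Q (X -> R^o) setT (ebd m.+1 (Om i)) (ip m.+1 (Om i))
  (fun q => pw_const cb q)).
- by move=> q _; exact: ebd_bpev.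
- by move=> t u v _ _; exact: pw_const_linear.
- exact: hipO.
Qed.

Let b_linear_l (q : Q) : linear_on SV (fun v => @b_ R m G Th i v q).
Proof.
apply: (@linear_on_comp R V (X -> R^o) SV (ebd m.+1 (Om i))
  (fun f => ip m.+1 (Om i) f (@bpev R m Th i q)) (fun v => @bdiv R m Th i v) ebd_bdiv).
  by move=> t u v hu hv; apply: pw_div_linear; exact: Vh_broken.
exact: (semi_innerL hipO (ebd_bpev q)).
Qed.

Let b_linear_r (v : V) : SV v -> linear_on [set: Q] (@b_ R m G Th i v).
Proof.
move=> hv; have bf := ebd_bdiv hv.
have lin := @linear_on_comp R Q (X -> R^o) setT (ebd m.+1 (Om i))
  (fun h => ip m.+1 (Om i) h (@bdiv R m Th i v))
  (fun q => pw_const cb q) (fun q _ => ebd_bpev q)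
  (fun t u v _ _ => pw_const_linear cb t u v) (semi_innerL hipO bf).
move=> t p q Sp Sq; have := lin t p q Sp Sq.
by rewrite /b_ !(semi_innerC hipO _ bf) //; exact: ebd_bpev.
Qed.

Let subdomU : Om i `<=` Om ord0 `|` Om ord_max.
Proof. by move=> x; have [->|->] := I2P i; [left|right]. Qed.

Let vebd_perm_inv u : vebd m.+1 (Om i) u -> vebd m.+1 (Om i) (perm_inv C u).
Proof.
move=> bu j; apply: (ebd_mulmx mOm) => [l|l]; last exact: bu.
have [mp [M hM]] := elliptic_ebd hK j l; split.
  apply: measurable_funS mp; last exact: subdomU.
  by apply: measurableU; exact: (subdom_measurable hG).
by exists M; apply: (@ae_imply _ _ R (hmeasure m.+1) _ _ _ _ subdomU hM) => x.
Qed.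

Let a_linear (v : V) : SV v -> linear_on SV (fun u => @a_ R m G C Th i u v).
Proof.
move=> hv.
have lin a (u w : X -> X) x : Om i x -> perm_inv C (a *: u + w) x =
    a *: perm_inv C u x + perm_inv C w x.
  by move=> _; rewrite /perm_inv (_ : (_ + _) x = a *: u x + w x)// mulmxDr -scalemxAr.
have l1 := @linear_on_comp R V (X -> X) SV (vebd m.+1 (Om i))
  (fun u => vip m.+1 (Om i) (perm_inv C u) (@bev R m Th i v)) (fun u => @bev R m Th i u)
  vebd_bev (fun t u w _ _ => bev_linear t u w)
  (vip_bilinear mOm fOm lin vebd_perm_inv (vebd_bev hv)).
have l2 := semi_innerL trace_semi_inner hv.
move=> t u w hu hw; have e1 := l1 t u w hu hw; have e2 := l2 t u w hu hw.
rewrite /a_ -!/(normal_trace _) e1 e2; ring.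
Qed.

Let a_coercive (v : V) : SV v ->
  (alpha C)^-1 * ip m gam (normal_trace v) (normal_trace v) <= @a_ R m G C Th i v v.
Proof.
move=> hv; rewrite /a_ lerDr; have bv := vebd_bev hv; have [_ c0 hae] := hK.
apply: (hmeasure_int_ge0 mOm (ebd_dot (vebd_perm_inv bv) bv)).
apply: (@ae_imply _ _ R (hmeasure m.+1) _ _ _ _ subdomU hae) => x Ox [_ h].
have [h1 _] := h (@bev R m Th i v x).
by rewrite dotC; apply: le_trans h1; rewrite mulr_ge0 ?sqr_ge0// ltW.
Qed.

Variables (dt : R) (u : gpres Th -> bvel Th i) (p : gpres Th -> bpres Th i).
Hypotheses (dt_gt0 : 0 < dt) (hu : forall la, star_problem G C dt la (u la) (p la)).

Let d (la : W) (v : V) := ip m gam (@gpev R m Th la) (normal_trace v).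

Let d_linear_l (v : V) : SV v -> linear_on [set: W] (d^~ v).
Proof.
move=> hv; apply: (@linear_on_comp R W (X -> R^o) setT (ebd m gam)
  (fun h => ip m gam h (normal_trace v)) (fun q => pw_const (@gcell R m Th) q)
  (fun q _ => ebd_gpev q) (fun t u v _ _ => pw_const_linear (@gcell R m Th) t u v)).
exact: (semi_innerL hipg (ebd_trace hv)).
Qed.

Let d_linear_r (la : W) : linear_on SV (d la).
Proof.
have lin := @linear_on_comp R V (X -> R^o) SV (ebd m gam)
  (fun h => ip m gam h (@gpev R m Th la)) normal_trace ebd_trace
  (fun t u w _ _ => trace_linear t u w) (semi_innerL hipg (ebd_gpev la)).
have dE v : SV v -> d la v = ip m gam (normal_trace v) (@gpev R m Th la).
  by move=> hv; exact: (semi_innerC hipg (ebd_gpev la) (ebd_trace hv)).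
move=> t v w hv hw; have e := lin t v w hv hw.
by rewrite (dE v hv) (dE w hw) (dE _ (Vh_subspace.2 t v w hv hw)).
Qed.

Let d_bounded (la : W) (v : V) : SV v ->
  d la v ^+ 2 <= @cg R m G Th la la * ip m gam (normal_trace v) (normal_trace v).
Proof.
move=> hv; exact: (cauchy_schwarz (ebd_subspace m gam) hipg (ebd_gpev la) (ebd_trace hv)).
Qed.

Let e_semi_inner := cg_semi_inner hG hTh.

(* the contribution of side i to the interface form *)
Let flux (la mu : W) : R := - ip m gam (normal_trace (u la)) (@gpev R m Th mu).

Let fluxE la mu : flux la mu = - d mu (u la).
Proof.
by rewrite /flux /d (semi_innerC hipg)//; exact: ebd_trace (hu la).1.
Qed.

Lemma flux_linear mu : linear_on [set: W] (flux^~ mu).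
Proof.
have := @steklov_linear R V Q W SV _ _ _ _ d _ dt (alpha C) u p Vh_subspace trace_semi_inner
  c_semi_inner a_linear a_coercive b_linear_l b_linear_r d_linear_l d_linear_r
  d_bounded dt_gt0 halpha hu mu.
by move=> lin t l1 l2 s1 s2; rewrite !fluxE; exact: lin.
Qed.

Lemma flux_ge0 mu : 0 <= flux mu mu.
Proof.
rewrite fluxE; exact: (@steklov_ge0 R V Q W SV _ _ _ _ d dt (alpha C) u p trace_semi_inner
  c_semi_inner a_coercive dt_gt0 halpha hu).
Qed.

Lemma flux_bounded la mu : flux la mu ^+ 2 <=
  alpha C ^+ 2 * (@cg R m G Th la la * @cg R m G Th mu mu).
Proof.
rewrite fluxE; exact: (@steklov_bounded R V Q W SV _ _ _ _ d _ dt (alpha C) u p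
  trace_semi_inner c_semi_inner e_semi_inner a_coercive d_bounded dt_gt0 halpha hu).
Qed.

End one_side.

Variables (dt : R) (u : forall i, gpres Th -> bvel Th i) (p : forall i, gpres Th -> bpres Th i).
Hypotheses (dt_gt0 : 0 < dt)
  (hu : forall i la, star_problem G C dt la (@u i la) (@p i la)).

Let s_formE (la mu : W) : @s_form R m G Th (@u) la mu =
  - ip m gam (@normal_trace ord0 (@u ord0 la)) (@gpev R m Th mu)
  - ip m gam (@normal_trace ord_max (@u ord_max la)) (@gpev R m Th mu).
Proof.
rewrite /s_form big_ord_recl big_ord_recl big_ord0 addr0 opprD.
by rewrite (_ : lift ord0 ord0 = ord_max)//; exact: val_inj.
Qed.

Lemma s_form_linear mu : linear_on [set: W] (fun la => @s_form R m G Th (@u) la mu).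
Proof.
move=> t l1 l2 s1 s2; have := flux_linear dt_gt0 (@hu ord0) mu t s1 s2.
have := flux_linear dt_gt0 (@hu ord_max) mu t s1 s2 => e1 e2.
by rewrite !s_formE e1 e2; ring.
Qed.

Lemma s_form_ge0 mu : 0 <= @s_form R m G Th (@u) mu mu.
Proof.
rewrite s_formE addr_ge0//.
  exact: (flux_ge0 dt_gt0 (@hu ord0)).
exact: (flux_ge0 dt_gt0 (@hu ord_max)).
Qed.

Lemma s_form_bounded : exists M, forall la mu : W, @s_form R m G Th (@u) la mu ^+ 2 <=
  M * (@cg R m G Th la la * @cg R m G Th mu mu).
Proof.
(* (x + y)^2 <= 2 (x^2 + y^2), with one term for each side *)
exists (4 * alpha C ^+ 2) => la mu; rewrite s_formE.
have := flux_bounded dt_gt0 (@hu ord0) la mu.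
have := flux_bounded dt_gt0 (@hu ord_max) la mu.
set x := - _; set y := - _; set z := _ * _; rewrite -mulrA -/z => h1 h2.
have : 0 <= (x - y) ^+ 2 by exact: sqr_ge0.
rewrite sqrrB sqrrD; lra.
Qed.

End interface_form.

(** * Contraction and convergence *)

(** Both assumptions on the nonlinearity give a convex set of values, containing the
    components of all iterates, on which the slopes lie between xim and Lxi. In the
    bounded-flux case a fixed field may leave this set, but then its values stay in a
    larger interval on which the nonlinearity is still Lipschitz, which is enough to pass
    to the limit. *)
Lemma nonlinearity_range (R : realType) (m : nat) (G : geometry R m) (hG : geometry_ok G)
    (Th : mesh R m) (C : coeffs R m) (S : data R m) (uit : nat -> gvel Th) (xim Lxi : R) :
  0 <= Lxi ->
  (xi_lipschitz C xim Lxi \/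
    exists2 Cxi, xi_bounded_flux G C S xim Lxi Cxi &
      forall k x, fracture G x -> enorm (gev (uit k) x) <= Cxi) ->
  [/\ xi_C1 C, forall s, 0 <= derive1 (xi C) s, 0 <= xim <= Lxi &
   exists P : R -> Prop,
   [/\ forall s t r, P s -> P t -> s <= r <= t -> P r,
       forall s, P s -> xim <= derive1 (xi C) s <= Lxi,
       forall k x j, fracture G x -> P (tang G (uit k) x j 0) &
       forall M, exists2 La : R, 0 <= La & forall a b, P a -> `|b| <= M ->
         `|xi C a - xi C b| <= La * `|a - b|]].
Proof.
move=> L0 [[hxi _ x0 hx]|[Cxi [hxi h0 -> [u [p [ug [pg [_ _ _ LE]]]]]] hC]].
  have x0' s : 0 <= derive1 (xi C) s.
    by have /andP[h _] := hx s; apply: le_trans h; exact: ltW.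
  split => //.
    by rewrite ltW//=; have /andP[h1 h2] := hx 0; exact: le_trans h2.
  exists (fun=> True); split => // M; exists Lxi => // a b _ _.
  have [D [s _ ->] ->] := @difference_quotient R (xi C) hxi.1 (fun=> True) b a
    (fun _ _ _ _ _ _ => I) I I.
  by rewrite normrM ler_wpM2r// ger0_norm//; have /andP[] := hx s.
split => //; first by rewrite lexx.
have cvx s t r : `|s| <= Cxi -> `|t| <= Cxi -> s <= r <= t -> `|r| <= Cxi.
  rewrite !ler_norml => /andP[s1 s2] /andP[t1 t2] /andP[r1 r2].
  by rewrite (le_trans s1 r1) (le_trans r2 t2).
exists (fun s => `|s| <= Cxi); split => //.
- move=> s sC; rewrite h0/= LE; apply: ub_le_sup; last by exists s.
  have cK : compact ((derive1 (xi C)) @` `[- Cxi, Cxi]%classic).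
    apply: continuous_compact; last exact: segment_compact.
    by apply: continuous_subspaceT; exact: hxi.2.
  have [M [_ hM]] := @compact_bounded R R^o _ cK.
  exists (`|M| + 1) => _ [r rC <-]; rewrite (le_trans (ler_norm _))//.
  apply: (hM (`|M| + 1)); first by rewrite ltr_pwDr// ler_norm.
  by exists r => //; rewrite /= in_itv/= -ler_norml.
- move=> k x j gx; apply: le_trans (hC k x gx).
  exact: le_trans (enorm_coord _ _) (enorm_frame_le hG _ gx).
- move=> M; have [La La0 hLa] := locally_lipschitz hxi.1 hxi.2 (Num.max M Cxi).
  exists La => // a b aC bM; apply: hLa; first by rewrite le_max aC orbT.
  by rewrite le_max bM.
Qed.

Theorem theorem5p10 (R : realType) (m : nat) (hm : m = 1%N \/ m = 2%N)
  (G : geometry R m) (hG : geometry_ok G)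
  (C : coeffs R m) (cK CK cKg CKg : R)
  (hK : uniformly_elliptic m.+1 (subdom G ord0 `|` subdom G ord_max) (perm C) cK CK)
  (hKg : uniformly_elliptic m (fracture G) (permg C) cKg CKg)
  (halpha : 0 < alpha C)
  (S : data R m) (hS : data_ok G S)
  (Th : mesh R m) (hTh : mesh_ok Th G)
  (* interface operators u^*_{h,i}, p^*_{h,i} at each time step *)
  (ustar : nat -> forall i, gpres Th -> bvel Th i)
  (pstar : nat -> forall i, gpres Th -> bpres Th i)
  (hstar : forall j, (1 <= j <= Nsteps S)%N -> forall i la,
     star_problem G C (tau S j) la (ustar j i la) (pstar j i la))
  (* initial pressures p^0_{h,i} and given fracture pressures lambda^j *)
  (p0h : forall i, bpres Th i) (lam : nat -> gpres Th)
  (ubar : nat -> forall i, bvel Th i) (pbar : nat -> forall i, bpres Th i)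
  (hbar : forall j, (1 <= j <= Nsteps S)%N -> forall i,
     bar_problem G C (tau S j) (srcn S j i)
       (if j == 1%N then p0h i else pstar j.-1 i (lam j.-1) + pbar j.-1 i)
       (ubar j i) (pbar j i))
  (* g^j_gamma *)
  (gg : nat -> 'cV[R]_m.+1 -> R)
  (hgg : forall j, (1 <= j <= Nsteps S)%N -> L2 m (fracture G) (gg j) /\
     forall mu : gpres Th, ip m (fracture G) (gg j) (gpev mu) =
       \sum_i ip m (fracture G) (ntr G i (bev (ubar j i))) (gpev mu))
  (xim Lxi zeta Lg : R) (hzeta : 0 <= zeta < 1)
  (hLg : Lg = Lxi / (2 * (1 - zeta))) (hLg0 : 0 < Lg)
  (n : nat) (hn : (1 <= n <= Nsteps S)%N)
  (* uit 0 = u^{n,-1}, uit k.+1 = u^{n,k} and lit k = lambda^{n,k} *)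
  (uit : nat -> gvel Th) (lit : nat -> gpres Th) (huit : Vg G (uit 0%N))
  (hit : forall k, moldd_step G C Lg (tau S n) (s_form G (ustar n))
     (fun x => srcgn S n x + gg n x) (lam n.-1) (uit k) (uit k.+1) (lit k))
  (hxi : xi_lipschitz C xim Lxi \/
     exists2 Cxi, xi_bounded_flux G C S xim Lxi Cxi &
       forall k x, fracture G x -> enorm (gev (uit k) x) <= Cxi) :
  (forall k, (1 <= k)%N ->
     norm_gamma G (lit k - lit k.-1) ^+ 2
     + tau S n * norm_s (s_form G (ustar n)) (lit k - lit k.-1) ^+ 2
     + (Lg / 2 + cKg) * tau S n * vnorm_gamma G (uit k.+1 - uit k) ^+ 2
     <= (Lg / 2 - zeta * xim) * tau S n * vnorm_gamma G (uit k - uit k.-1) ^+ 2) /\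
  exists (u : gvel Th) (la : gpres Th),
    [/\ reduced_scheme G C (tau S n) (s_form G (ustar n))
          (fun x => srcgn S n x + gg n x) (lam n.-1) u la,
        forall (u' : gvel Th) (la' : gpres Th),
          reduced_scheme G C (tau S n) (s_form G (ustar n))
            (fun x => srcgn S n x + gg n x) (lam n.-1) u' la' ->
          vnorm_gamma G (u' - u) = 0 /\ norm_gamma G (la' - la) = 0,
        (fun k => vnorm_gamma G (uit k - u)) @ \oo --> (0 : R) &
        (fun k => norm_gamma G (lit k - la)) @ \oo --> (0 : R)].
Proof.
pose dt := tau S n.
have dt_gt0 : 0 < dt by have [[_ h _] _ _] := hS; exact: h.
have /andP[z0 z1] := hzeta.
have LxiE : Lxi = 2 * (1 - zeta) * Lg.
  by rewrite hLg; field; rewrite subr_eq0 gt_eqF.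
have Lxi0 : 0 <= Lxi.
  by rewrite LxiE !mulr_ge0// ?subr_ge0 ltW.
have [hx1 hx0 /andP[xm0 xmL] [P [cvx hP Pu hLip]]] := nonlinearity_range hG Lxi0 hxi.
rewrite LxiE in hP xmL.
pose q := Lg / 2 - zeta * xim.
have qL : q <= Lg / 2 by rewrite /q gerBl mulr_ge0.
(* zeta xim <= 2 zeta (1 - zeta) Lg <= Lg / 2, as 4 zeta (1 - zeta) <= 1 *)
have q0 : 0 <= q.
  have : zeta * xim <= zeta * (2 * (1 - zeta) * Lg) by rewrite ler_wpM2l.
  have : 0 <= Lg / 2 * (1 - 2 * zeta) ^+ 2 by rewrite mulr_ge0 ?sqr_ge0// divr_ge0// ltW.
  rewrite /q => h1 h2; nra.
have [_ cKg0 _] := hKg.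
pose V := ('I_(ngcell Th) -> 'cV[R]_m.+1 -> 'cV[R]_m.+1)%type.
pose W := ('I_(ngcell Th) -> R^o)%type.
pose SV : set V := Vg G.
pose B (u v : V) : R := vip m (fracture G) (@gev R m Th u) (@gev R m Th v).
pose s : W -> W -> R := s_form G (ustar n).
pose rhs (mu : W) : R :=
  dt * ip m (fracture G) (fun x => srcgn S n x + gg n x) (@gpev R m Th mu).
have hB : semi_inner SV B := gev_semi_inner hG hTh.
have hc := cg_semi_inner hG hTh.
have slin := s_form_linear hG hTh hK halpha dt_gt0 (hstar n hn).
have sge0 := s_form_ge0 hG hTh hK halpha dt_gt0 (hstar n hn).
have sbd := s_form_bounded hG hTh hK halpha dt_gt0 (hstar n hn).
have hu k : Vg G (uit k).
  by case: k => [|k]; [exact: huit|exact: (hit k).1].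
have lin k : @linearised_problem R V W SV B (@ag R m G C Th) (xi_form G C) (@bg R m G Th)
    (@cg R m G Th) s rhs (lam n.-1) dt Lg (uit k) (uit k.+1) (lit k).
  split; first exact: hu.
  move=> v mu hv; have [_ /(_ v mu hv) [h1 h2]] := hit k.
  split; last exact: h2.
  by rewrite -(stabilised_form hG hTh hx1 Lg (hu k) (hu k.+1) hv).
have key k (v : V) : SV v -> Lg * B (uit k.+1 - uit k) v
    - (xi_form G C (uit k.+1) v - xi_form G C (uit k) v) <=
    Lg / 2 * B v v + q * B (uit k.+1 - uit k) (uit k.+1 - uit k).
  move=> hv; apply: (xi_form_key hG hTh hx1 hx0 cvx hLg0 z0 hP (hu k) (hu k.+1) hv).
    by move=> x j gx; exact: Pu.
  by move=> x j gx; exact: Pu.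
have subV := Vg_subspace hG hTh.
have vnormE (v : gvel Th) : Vg G v -> vnorm_gamma G v ^+ 2 = B v v.
  by move=> hv; rewrite sqr_sqrtr// (semi_inner_ge0 hB).
have normE (mu : gpres Th) : norm_gamma G mu ^+ 2 = cg G mu mu.
  by rewrite sqr_sqrtr// (semi_inner_ge0 hc).
have sqrt_cvg (x : nat -> R) : x @ \oo --> (0 : R) ->
    (fun k => Num.sqrt (x k)) @ \oo --> (0 : R).
  move=> x0; rewrite -[X in _ --> X](sqrtr0 R).
  by apply: continuous_cvg => //; exact: sqrt_continuous.
split.
  move=> [//|k] _; rewrite -/dt.
  rewrite normE sqr_sqrtr; last exact: sge0.
  rewrite vnormE; last by apply: (subspaceB subV); exact: hu.
  rewrite vnormE; last by apply: (subspaceB subV); exact: hu.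
  exact: (@iteration_contraction R V W SV B (@ag R m G C Th) (xi_form G C) (@bg R m G Th)
    (@cg R m G Th) s rhs (lam n.-1) dt Lg q cKg subV hc (ag_linear hG hTh hKg)
    (ag_coercive hG hTh hKg) (bg_linear_l hG hTh) (bg_linear_r hG hTh) slin dt_gt0
    _ _ _ _ _ (hu k) (lin k) (lin k.+1) (key k)).
have Xcont (w v : V) : SV w -> SV v -> exists M, forall k,
    (xi_form G C (uit k) v - xi_form G C w v) ^+ 2 <= M * B (uit k - w) (uit k - w).
  by move=> hw hv; exact: (xi_form_cont hG hTh hx1 hLip hu hw hv Pu).
have [u [la [sol ucv lcv]]] := @iteration_cvg R V W SV B (@ag R m G C Th) (xi_form G C)
  (@bg R m G Th) (@cg R m G Th) s rhs (lam n.-1) dt Lg q cKg subV (Vg_fin_span G Th)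
  pw_const_fin_span hB hc (ag_linear hG hTh hKg) (ag_coercive hG hTh hKg)
  (ag_bounded hG hTh hKg) (bg_linear_l hG hTh) (bg_linear_r hG hTh) (bg_bounded hG hTh)
  slin sge0 sbd dt_gt0 q0 cKg0 qL uit lit huit lin key Xcont.
exists u, la; split.
- exact: sol.
- move=> u' la' sol'.
  have [e1 e2] : B (u' - u) (u' - u) = 0 /\ @cg R m G Th (la' - la) (la' - la) = 0.
    exact: (@nonlinear_problem_unique R V W SV B (@ag R m G C Th) (xi_form G C)
      (@bg R m G Th) (@cg R m G Th) s rhs (lam n.-1) dt cKg subV hB hc
      (ag_linear hG hTh hKg) (ag_coercive hG hTh hKg) (bg_linear_l hG hTh)
      (bg_linear_r hG hTh) slin sge0 (xi_form_mono hG hTh hx1 hx0) dt_gt0 cKg0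
      _ _ _ _ sol sol').
  split; first by rewrite -[LHS]/(Num.sqrt (B (u' - u) (u' - u))) e1 sqrtr0.
  by rewrite -[LHS]/(Num.sqrt (@cg R m G Th (la' - la) (la' - la))) e2 sqrtr0.
- exact: (sqrt_cvg _ ucv).
- exact: (sqrt_cvg _ lcv).
Qed.
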